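(* Let $1<p\le 2$, $K\ge 1$ and $0<\tau_1<\dots<\tau_K<1$. Consider the linear model $y_t=\mathbf{x}_t'\boldsymbol{\beta}^*+\varepsilon_t$, $t=1,\dots,T$, with $\boldsymbol\beta^*\in\mathbb{R}^m$ unknown, centered nonrandom predictors $\mathbf{x}_t\in\mathbb{R}^m$, and i.i.d. errors $\varepsilon_t$ distributed as a random variable $\varepsilon$. Assume: (i) there is an $m\times m$ positive definite matrix $\mathbf{C}$ with $\lim_{T\to\infty}\frac1T\mathbf{X}'\mathbf{X}=\mathbf{C}$, where $\mathbf{X}=(\mathbf{x}_1,\dots,\mathbf{x}_T)'$ is the $T\times m$ design matrix; (ii) $E(|\varepsilon|^{2(p-1)})<\infty$; (iii) there is $\delta>0$ such that for every $k=1,\dots,K$ and every $b$ in the $\delta$-neighbourhood of $b^*_{\tau_k}$, $E(|\varepsilon-b|^{p-2})<\infty$. Let $\hat{\boldsymbol\beta}^{clp}$ be the composite $L^p$-quantile regression estimator. Then, as $T\to\infty$, $\sqrt{T}(\hat{\boldsymbol\beta}^{clp}-\boldsymbol\beta^* )$ is asymptotically normal (converges in distribution to a normal vector) with mean $0$ and covariance matrix $$\boldsymbol\Sigma_{clp}=\mathbf{C}^{-1}\,\frac{\sum_{k'=1}^K\sum_{k=1}^K E\big[\varphi_{\tau_{k'},p}(\varepsilon-b^*_{\tau_{k'}})\,\varphi_{\tau_k,p}(\varepsilon-b^*_{\tau_k})\big]}{\Big(\sum_{k=1}^K E\,\psi_{\tau_k,p}(\varepsilon-b^*_{\tau_k}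)\Big)^2}.$$
   Context: For $\tau\in(0,1)$ and $p>1$: $\eta_{\tau,p}(s)=|\tau-I(s<0)||s|^p$, $\varphi_{\tau,p}(s)=p|\tau-I(s<0)||s|^{p-1}\mathrm{sign}(s)$, and $\psi_{\tau,p}(s)=p(p-1)|\tau-I(s<0)||s|^{p-2}$. The $\tau$th $L^p$-quantile of a random variable $\varepsilon$ with $E|\varepsilon|^{p-1}<\infty$ is the minimizer over $b\in\mathbb{R}$ of $E[\eta_{\tau,p}(\varepsilon-b)-\eta_{\tau,p}(\varepsilon)]$; $b^*_\tau$ denotes the $\tau$th $L^p$-quantile of $\varepsilon$. The composite $L^p$-quantile regression estimator $\hat{\boldsymbol\beta}^{clp}$ (depending on $T$) is the $\boldsymbol\beta$-part of $$(\hat b_1,\dots,\hat b_K,\hat{\boldsymbol\beta}^{clp})=\arg\min_{b_1,\dots,b_K\in\mathbb{R},\,\boldsymbol\beta\in\mathbb{R}^m}\sum_{k=1}^K\sum_{t=1}^T\eta_{\tau_k,p}(y_t-b_k-\mathbf{x}_t'\boldsymbol\beta).$$ ''Centered predictors'' means $\frac1T\sum_{t=1}^T\mathbf{x}_t\to 0$ as $T\to\infty$.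
   Formalization: Added assumption: if p = 2 and τ_k ≠ 1/2, then P(ε = b*_{τ_k}) = 0; for p = 2 condition (iii) is void, and with such an atom the limit can be non-normal (e.g. m = K = 1, x_t = (−1)^t, ε with an atom at its τ-expectile). *)

(* Defs.v *)
From HB Require Import structures.
From mathcomp Require Import all_boot all_order all_algebra.
From mathcomp Require Import all_classical all_reals all_analysis.

Set Implicit Arguments.
Unset Strict Implicit.
Unset Printing Implicit Defensive.

Import Order.TTheory GRing.Theory Num.Theory.
Import numFieldTopology.Exports numFieldNormedType.Exports.

Local Open Scope classical_set_scope.
Local Open Scope ring_scope.

Section vectors.
Context {R : realType}.

Definition dotv (m : nat) (u v : 'cV[R]_m) : R := (u^T *m v) 0 0.

Definition posdefmx (m : nat) (C : 'M[R]_m) : Prop :=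
  C^T = C /\ forall v : 'cV[R]_m, v != 0 -> 0 < dotv v (C *m v).

(* The predictors x_1, x_2, ... are indexed from 0, so that the sample of
   size T consists of x 0, ..., x (T - 1). *)
Definition design (m : nat) (x : nat -> 'cV[R]_m) (T : nat) : 'M[R]_(T, m) :=
  \matrix_(t < T, j < m) x t j 0.

Definition centered (m : nat) (x : nat -> 'cV[R]_m) : Prop :=
  (T%:R^-1 *: \sum_(t < T) x t) @[T --> \oo] --> (0 : 'cV[R]_m).

End vectors.

Section loss.
Context {R : realType}.

Definition weight (tau s : R) : R := `|tau - (s < 0)%R%:R|.

Definition eta (tau p s : R) : R := weight tau s * `|s| `^ p.

Definition phi (tau p s : R) : R :=
  p * weight tau s * `|s| `^ (p - 1) * Num.sg s.

(* |s|^r in [0, +oo], with |0|^r = +oo for r < 0: the library's real power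
   has 0 `^ r = 0 for r < 0, which would make negative moments blind to
   atoms. As usual |0|^0 = 1. *)
Definition abs_pow (s r : R) : \bar R :=
  if (s == 0) && (r < 0) then +oo%E else (`|s| `^ r)%:E.

Definition psi (tau p s : R) : \bar R :=
  ((p * (p - 1) * weight tau s)%:E * abs_pow s (p - 2))%E.

End loss.

Section probability.
Context {d : measure_display} {Omega : measurableType d} {R : realType}.
Variable P : probability Omega R.

Definition identically_distributed (X : nat -> {RV P >-> R})
    (Y : {RV P >-> R}) : Prop :=
  forall (i : nat) (A : set R), measurable A -> P (X i @^-1` A) = P (Y @^-1` A).

Definition mutually_independent (X : nat -> {RV P >-> R}) : Prop :=
  forall (s : seq nat) (A : nat -> set R), uniq s ->
    (forall i, measurable (A i)) ->
    P (\bigcap_(i in [set` s]) (X i @^-1` A i)) =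
    (\prod_(i <- s) P (X i @^-1` A i))%E.

Definition Lp_quantile (p tau : R) (X : {RV P >-> R}) (b : R) : Prop :=
  forall b' : R,
    ('E_P[fun w => (eta tau p (X w - b) - eta tau p (X w))%R] <=
     'E_P[fun w => (eta tau p (X w - b') - eta tau p (X w))%R])%E.

(* 'cV[R]_m carries no sigma-algebra in the library; measurability of the
   coordinates is Borel measurability of the vector. *)
Definition random_vector (m : nat) (Z : Omega -> 'cV[R]_m) : Prop :=
  forall j : 'I_m, measurable_fun setT (fun w => Z w j 0).

(* The normal law on R with mean mu and variance v. The library's normal_prob
   takes the standard deviation, and is not the Dirac mass at deviation 0. *)
Definition normal_law (mu v : R) (A : set R) : \bar R :=
  if v == 0 then \d_mu A else normal_prob mu (Num.sqrt v) A.

(* N is a N(mu, Sigma) vector: each linear combination a'N is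
   N(a'mu, a'Sigma a); Sigma may be singular. *)
Definition normal_vector (m : nat) (N : Omega -> 'cV[R]_m)
    (mu : 'cV[R]_m) (Sigma : 'M[R]_m) : Prop :=
  random_vector N /\
  forall (a : 'cV[R]_m) (A : set R), measurable A ->
    P [set w | A (dotv a (N w))] =
    normal_law (dotv a mu) (dotv a (Sigma *m a)) A.

End probability.

Section weak_convergence.
Context {R : realType}.

Definition cvg_in_distribution (m : nat)
    (d : measure_display) (Omega : measurableType d) (P : probability Omega R)
    (Z : nat -> Omega -> 'cV[R]_m)
    (d' : measure_display) (Omega' : measurableType d')
    (Q : probability Omega' R) (N : Omega' -> 'cV[R]_m) : Prop :=
  forall f : 'cV[R]_m -> R, continuous f ->
    (exists M : R, forall z, `|f z| <= M) ->
    ('E_P[fun w => f (Z n w)] @[n --> \oo] --> 'E_Q[fun w => f (N w)])%E.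

Definition cvg_to_normal (m : nat)
    (d : measure_display) (Omega : measurableType d) (P : probability Omega R)
    (Z : nat -> Omega -> 'cV[R]_m) (mu : 'cV[R]_m) (Sigma : 'M[R]_m) : Prop :=
  exists (d' : measure_display) (Omega' : measurableType d')
    (Q : probability Omega' R) (N : Omega' -> 'cV[R]_m),
    normal_vector Q N mu Sigma /\ cvg_in_distribution P Z Q N.

End weak_convergence.

Section composite.
Context {R : realType}.

Definition clp_loss (m K T : nat) (p : R) (tau : 'I_K -> R)
    (x : nat -> 'cV[R]_m) (y : nat -> R) (b : 'I_K -> R) (beta : 'cV[R]_m) : R :=
  \sum_(k < K) \sum_(t < T) eta (tau k) p (y t - b k - dotv (x t) beta).

Definition clp_argmin (m K T : nat) (p : R) (tau : 'I_K -> R)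
    (x : nat -> 'cV[R]_m) (y : nat -> R) (b : 'I_K -> R) (beta : 'cV[R]_m) : Prop :=
  forall (b' : 'I_K -> R) (beta' : 'cV[R]_m),
    clp_loss T p tau x y b beta <= clp_loss T p tau x y b' beta'.

(* The expectations are finite under the moment assumptions, so that fine only
   changes their type. *)
Definition Sigma_clp (d : measure_display) (Omega : measurableType d)
    (P : probability Omega R) (m K : nat) (p : R) (tau : 'I_K -> R)
    (bstar : 'I_K -> R) (e : {RV P >-> R}) (C : 'M[R]_m) : 'M[R]_m :=
  ((\sum_(k' < K) \sum_(k < K)
      fine 'E_P[fun w => (phi (tau k') p (e w - bstar k') *
                          phi (tau k) p (e w - bstar k))%R]%E) /
   (\sum_(k < K) fine (\int[P]_w psi (tau k) p (e w - bstar k)%R)%E) ^+ 2)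
  *: invmx C.

End composite.

(* Main.v *)
(* Let theta be sqrt T times the deviation of (b, beta) from its target. The
   difference D_T(theta) of the losses at theta and at 0 equals theta' H_T
   theta / 2 - theta' W_T up to a sum of second-order remainders of eta, each
   at most a constant times h^2 |s|^(p-2) min(1, |h|/|s|) for a step h at the
   residual s. The negative moment (iii) makes the mean of this sum vanish
   uniformly on balls, and a weighted law of large numbers gives H_T -> H in
   L^1. Since the predictors are centered, H is block diagonal. D_T being
   convex, its minimizer is close to H^-1 W_T; this is expressed by a pointwise
   bound whose mean vanishes, so that the measurability of the intercept
   estimates does not matter. The beta-block of H^-1 W_T is a weighted sum of
   i.i.d. scores, which are centered because the L^p-quantile minimizes the
   mean loss. Its characteristic function converges by comparing it, factor by
   factor, with that of a Gaussian sum. Finally, bounded continuous functions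
   are approximated on boxes, with a global bound, by trigonometric polynomials
   (Bernstein polynomials in sines of the coordinates), whence weak
   convergence. *)
Require Import Defs.
From HB Require Import structures.
From mathcomp Require Import all_boot all_order all_algebra.
From mathcomp Require Import all_classical all_reals all_analysis.
From mathcomp Require Import measurable_realfun ring lra.

Set Implicit Arguments.
Unset Strict Implicit.
Unset Printing Implicit Defensive.

Import Order.TTheory GRing.Theory Num.Theory.
Import numFieldTopology.Exports numFieldNormedType.Exports.
Import Defs.

Local Open Scope classical_set_scope.
Local Open Scope ring_scope.

(** * Taylor expansion of the loss *)

Section real_powers.
Context {R : realType}.
Implicit Types p q s h u x y tau : R.

(** For p < 2 the second derivative of the loss is unbounded at 0 and only its first moment is under
    control. This rules out second-moment arguments for the Hessian, which is truncated instead, and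
    it dictates the factor min(1, |h|/|s|) in the Taylor remainder, to which dominated convergence
    applies. The same shape, an integrable function times min(1, c k), returns in the expansions of
    sine and cosine, in the truncation and in the tails of the limit law; [Ex_min_small] serves all
    four. No Lindeberg condition is assumed: convergence of the averages of x_t x_t' already forces
    max |x_t| / sqrt T to vanish. The second-order expansion fails at residuals equal to 0. An
    infinite negative moment excludes atoms there when p < 2; when p = 2 and tau = 1/2 the loss is
    quadratic and the expansion is exact everywhere. Characteristic functions are kept as pairs of
    real means of cosine and sine. The Gaussian one is never put in closed form: its
    multiplicativity, its continuity and its second-order expansion suffice. Convexity yields
    localization of the minimizer and the first-order condition, without consistency or
    differentiation under the integral. *)

Lemma powR_le_tangent q y : 0 < q <= 1 -> 0 <= y -> y `^ q <= 1 + q * (y - 1).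
Proof.
move=> /andP[q0 q1] y0; have [->|qN1] := eqVneq q 1.
  by rewrite powRr1//; lra.
have q_lt1 : 0 < 1 - q by rewrite subr_gt0 lt_neqAle qN1.
(* Young's inequality for [y ^ q] and 1 with the conjugate exponents 1/q and 1/(1 - q). *)
have := @conjugate_powR R (y `^ q) 1 q^-1 (1 - q)^-1 (powR_ge0 _ _) ler01.
rewrite !invr_gt0 !invrK => /(_ q0 q_lt1); rewrite addrC subrK => /(_ erefl).
by rewrite -powRrM mulfV ?gt_eqF// powRr1// powR1 /=; lra.
Qed.

(** Young's inequality for [y] and [x ^ (p - 1)] with the exponents p and p/(p - 1), rearranged. *)
Lemma powR_ge_tangent p x y : 1 < p -> 0 <= x -> 0 <= y ->
  x `^ p + p * x `^ (p - 1) * (y - x) <= y `^ p.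
Proof.
move=> p1 x0 y0; have p0 : 0 < p by lra.
have := @conjugate_powR R y (x `^ (p - 1)) p (p / (p - 1)) y0 (powR_ge0 _ _) p0.
have -> : 0 < p / (p - 1) by rewrite divr_gt0// subr_gt0.
have p1N0 : p - 1 != 0 by rewrite gt_eqF// subr_gt0.
move=> /(_ isT); have -> : p^-1 + (p / (p - 1))^-1 = 1.
  by field; rewrite p1N0 gt_eqF.
move=> /(_ erefl); rewrite -powRrM mulrCA mulfV// mulr1.
rewrite -(ler_pM2l p0).
have -> : p * (y `^ p / p + x `^ p / (p / (p - 1))) = y `^ p + (p - 1) * x `^ p.
  by field; rewrite p1N0 gt_eqF.
rewrite -(mulr_powRB1 x0 p0) => h; move: (x `^ (p - 1)) h => a; lra.
Qed.

(** Two uses of the tangent bound for the concave power: at y = 1 - u for the upper estimate and at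
    y = 1 / (1 - u), inverted, for the lower one. *)
Lemma powR_sub1_taylor1 q u : 0 < q <= 1 -> `|u| <= 2^-1 ->
  `|(1 - u) `^ q - 1 + q * u| <= u ^+ 2.
Proof.
move=> q01; rewrite ler_norml => /andP[u1 u2]; have /andP[q0 q1] := q01.
have v0 : 0 < 1 - u by lra.
have up : (1 - u) `^ q <= 1 - q * u.
  by have := powR_le_tangent q01 (ltW v0); lra.
have w0 : 0 < 1 - u + q * u by nra.
have lo : (1 - u) / (1 - u + q * u) <= (1 - u) `^ q.
  have := powR_le_tangent q01 (ltW (_ : 0 < (1 - u)^-1)).
  rewrite invr_gt0 => /(_ v0).
  have -> : 1 + q * ((1 - u)^-1 - 1) = (1 - u + q * u) / (1 - u).
    by field; rewrite gt_eqF.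
  rewrite -[X in X `^ q](powR_inv1 (ltW v0)) -powRrM mulN1r powRN => h.
  by rewrite -lef_pV2 ?posrE ?divr_gt0 ?powR_gt0// invf_div.
have ge : - u ^+ 2 <= (1 - u) / (1 - u + q * u) - 1 + q * u.
  have -> : (1 - u) / (1 - u + q * u) - 1 + q * u =
      - u ^+ 2 * (q * (1 - q) / (1 - u + q * u)).
    by field; rewrite gt_eqF.
  rewrite mulNr lerN2 ler_piMr ?sqr_ge0// ler_pdivrMr// mul1r; nra.
by rewrite ler_norml; apply/andP; split; nra.
Qed.

(** The derivative of the expression is -p times the remainder of [powR_sub1_taylor1] for the
    exponent p - 1, so the mean value theorem gains one power of |u|; the constant 2 bounds p. *)
Lemma powR_sub1_taylor2 p u : 1 < p <= 2 -> `|u| <= 2^-1 ->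
  `|(1 - u) `^ p - 1 + p * u - 2^-1 * p * (p - 1) * u ^+ 2| <= 2 * `|u| ^+ 3.
Proof.
move=> /andP[p1 p2] u12.
pose g (v : R) := (1 - v) `^ p - 1 + p * v - 2^-1 * p * (p - 1) * v ^+ 2.
pose g' (v : R) := - p * ((1 - v) `^ (p - 1) - 1 + (p - 1) * v).
have g0 : g 0 = 0 by rewrite /g subr0 powR1 expr0n /= !mulr0 subrr addr0 subr0.
have dg (v : R) : v < 1 -> is_derive v (1 : R) g (g' v).
  move=> v1; rewrite /g /g'.
  have v0 : 0 < 1 - v by rewrite subr_gt0.
  have d1 : is_derive (1 - v) (1 : R) (@powR R ^~ p) (p * (1 - v) `^ (p - 1)).
    by apply: is_derive1_powR.
  have d2 : is_derive v (1 : R) (fun v : R => (1 - v) `^ p)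
      (p * (1 - v) `^ (p - 1) * (0 - 1)).
    apply: (@is_derive1_comp _ (@powR R ^~ p) (fun v : R => 1 - v)).
  by apply: is_derive_eq; rewrite /GRing.scale/=; field.
have cg a b : b < 1 -> {within `[a, b], continuous g}.
  move=> b1; apply: derivable_within_continuous => v; rewrite in_itv/= => /andP[_ vb].
  by apply: (@ex_derive _ _ _ _ _ _ _ (dg v _)); lra.
have bnd c : `|c| <= `|u| -> `|g' c| <= 2 * `|u| ^+ 2.
  move=> cu; rewrite /g' normrM normrN (ger0_norm (_ : 0 <= p)); last by lra.
  rewrite ler_pM//; first by lra.
  apply: le_trans (powR_sub1_taylor1 _ _) _; [lra|exact: le_trans cu _|].
  by rewrite -(real_normK (num_real c)) ler_pXn2r// nnegrE.
have goal c : `|c| <= `|u| -> `|g u - g 0| = `|g' c| * `|u| -> `|g u| <= 2 * `|u| ^+ 3.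
  by move=> cu; rewrite g0 subr0 => ->; rewrite exprSr mulrA ler_wpM2r// bnd.
have [u0|u0|->] := ltgtP u 0; last by rewrite -/(g 0) g0 normr0 expr0n mulr0.
- have [||c] := @MVT _ g g' u 0 u0.
  + by move=> v; rewrite in_itv/= => /andP[_ v0]; apply: dg; lra.
  + by apply: cg.
  rewrite in_itv/= => /andP[c1 c2] e; apply: (goal c).
    by rewrite !ltr0_norm// lerN2 ltW.
  by rewrite distrC e normrM sub0r normrN.
- have [||c] := @MVT _ g g' 0 u u0.
  + move=> v; rewrite in_itv/= => /andP[_ v0]; apply: dg.
    by move: u12; rewrite gtr0_norm// => h; lra.
  + by apply: cg; move: u12; rewrite gtr0_norm// => h; lra.
  rewrite in_itv/= => /andP[c1 c2] e; apply: (goal c).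
    by rewrite !gtr0_norm// ltW.
  by rewrite e normrM subr0.
Qed.

End real_powers.

Section loss_expansion.
Context {R : realType}.
Implicit Types p q s h u x y tau : R.

Lemma weight_ge0E tau s : 0 < tau -> 0 <= s -> weight tau s = tau.
Proof. by move=> t0 s0; rewrite /weight ltNge s0 /= subr0 gtr0_norm. Qed.

Lemma weight_lt0E tau s : tau < 1 -> s < 0 -> weight tau s = 1 - tau.
Proof. by move=> t1 s0; rewrite /weight s0 distrC gtr0_norm// subr_gt0. Qed.

Lemma weight_gt0 tau s : 0 < tau < 1 -> 0 < weight tau s.
Proof.
move=> /andP[t0 t1]; have [s0|s0] := leP 0 s; first by rewrite weight_ge0E.
by rewrite weight_lt0E// subr_gt0.
Qed.

Lemma weight_le1 tau s : 0 < tau < 1 -> weight tau s <= 1.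
Proof.
move=> /andP[t0 t1]; have [s0|s0] := leP 0 s; first by rewrite weight_ge0E// ltW.
by rewrite weight_lt0E//; lra.
Qed.

Lemma eta_ge0 tau p s : 0 < tau < 1 -> 0 <= eta tau p s.
Proof. by move=> t; rewrite mulr_ge0 ?powR_ge0// ltW// weight_gt0. Qed.

Lemma weightN tau s : 0 < tau < 1 -> s != 0 -> weight tau (- s) = weight (1 - tau) s.
Proof.
move=> /andP[t0 t1]; rewrite neq_lt => /orP[s0|s0].
  by rewrite weight_ge0E ?oppr_ge0 ?ltW// weight_lt0E//; lra.
by rewrite weight_lt0E ?oppr_lt0// weight_ge0E//; [lra|exact: ltW].
Qed.

Lemma etaN tau p s : 0 < tau < 1 -> p != 0 -> eta tau p (- s) = eta (1 - tau) p s.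
Proof.
move=> t p0; rewrite /eta; have [->|s0] := eqVneq s 0.
  by rewrite oppr0 normr0 powR0// !mulr0.
by rewrite weightN// normrN.
Qed.

Lemma phiN tau p s : 0 < tau < 1 -> phi tau p (- s) = - phi (1 - tau) p s.
Proof.
move=> t; rewrite /phi; have [->|s0] := eqVneq s 0.
  by rewrite oppr0 sgr0 !mulr0 oppr0.
by rewrite weightN// normrN sgrN mulrN.
Qed.

Lemma onem_itv tau : 0 < tau < 1 -> 0 < 1 - tau < 1.
Proof. by lra. Qed.

(** The reflection s -> -s exchanges tau and 1 - tau, which reduces the claim to x >= 0. There it is
    the tangent bound for a power, with zero slope at x = 0. *)
Lemma eta_ge_tangent tau p x y : 0 < tau < 1 -> 1 < p ->
  eta tau p x + phi tau p x * (y - x) <= eta tau p y.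
Proof.
move=> + p1; have pN0 : p != 0 by rewrite gt_eqF//; lra.
have key t a b : 0 < t < 1 -> 0 <= a ->
    eta t p a + phi t p a * (b - a) <= eta t p b.
  move=> t01 a0; have /andP[t0 t1] := t01.
  move: a0; rewrite le_eqVlt => /predU1P[<-|a0].
    by rewrite /phi sgr0 mulr0 mul0r addr0 /eta normr0 powR0// mulr0 eta_ge0.
  rewrite /phi /eta (weight_ge0E t0 (ltW a0)) (gtr0_norm a0) gtr0_sg// mulr1.
  have [b0|b0] := leP 0 b.
    rewrite weight_ge0E// ger0_norm//.
    have := powR_ge_tangent p1 (ltW a0) b0; rewrite -(ler_pM2l t0).
    by apply: le_trans; rewrite le_eqVlt; apply/orP; left; apply/eqP; ring.
  (* For b < 0 the tangent at a > 0 has already become nonpositive, because p > 1. *)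
  apply: (@le_trans _ _ 0); last exact: eta_ge0.
  rewrite -(mulr_powRB1 (ltW a0)); last lra.
  have := powR_ge0 a (p - 1); move: (a `^ (p - 1)) => c c0.
  have -> : t * (a * c) + p * t * c * (b - a) = t * c * (a + p * (b - a)) by ring.
  rewrite mulr_ge0_le0//; [exact: mulr_ge0 (ltW t0) c0|nra].
move=> t01; have [x0|x0] := leP 0 x; first exact: key.
have := @key (1 - tau) (- x) (- y) (onem_itv t01).
rewrite -!etaN ?onem_itv// !opprK phiN ?onem_itv// subKr => /(_ _).
rewrite oppr_ge0 (ltW x0) => /(_ isT).
by rewrite (_ : - y + x = - (y - x)) ?mulrNN//; ring.
Qed.

(* psi for s != 0; at 0, powR gives 0 instead of +oo when p < 2. *)
Definition psiR tau p s : R := p * (p - 1) * weight tau s * `|s| `^ (p - 2).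

Lemma psiR_ge0 tau p s : 0 < tau < 1 -> 1 < p -> 0 <= psiR tau p s.
Proof.
move=> t01 p1; rewrite /psiR mulr_ge0 ?powR_ge0// mulr_ge0 ?(ltW (weight_gt0 _ _))//.
by rewrite mulr_ge0 ?subr_ge0 ?(ltW p1)// (le_trans _ (ltW p1)).
Qed.

Lemma psiR_le tau p s : 0 < tau < 1 -> 1 < p -> psiR tau p s <= p * (p - 1) * `|s| `^ (p - 2).
Proof.
move=> t01 p1; rewrite /psiR ler_wpM2r ?powR_ge0// ler_piMr ?weight_le1//.
by rewrite mulr_ge0 ?subr_ge0 ?(ltW p1)// (le_trans _ (ltW p1)).
Qed.

(* Modulus of the second-order Taylor remainder: min(1, delta/|s|) makes its
   mean vanish with delta as soon as |s|^(p-2) is integrable. *)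
Definition rho p s (delta : R) : R := `|s| `^ (p - 2) * Num.min 1 (delta / `|s|).

Definition taylor_rem tau p s h : R := eta tau p (s - h) - eta tau p s + phi tau p s * h.

Lemma taylor_rem_ge0 tau p s h : 0 < tau < 1 -> 1 < p -> 0 <= taylor_rem tau p s h.
Proof.
by move=> t p1; have := eta_ge_tangent s (s - h) t p1; rewrite /taylor_rem; lra.
Qed.

Lemma taylor_remN tau p s h : 0 < tau < 1 -> p != 0 ->
  taylor_rem (1 - tau) p (- s) (- h) = taylor_rem tau p s h.
Proof.
move=> t01 p0; rewrite /taylor_rem -opprD !etaN ?onem_itv// phiN ?onem_itv//.
by rewrite subKr mulrNN.
Qed.

Lemma psiRN tau p s : 0 < tau < 1 -> s != 0 -> psiR (1 - tau) p (- s) = psiR tau p s.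
Proof. by move=> t01 s0; rewrite /psiR weightN ?onem_itv// subKr normrN. Qed.

(** By homogeneity: with h = s u, both sides are s^p times an expression in u, which reduces the
    claim to s = 1. *)
Let taylor_rem_bound_pos tau p s h : 0 < tau < 1 -> 1 < p <= 2 -> 0 < s ->
  `|taylor_rem tau p s h - 2^-1 * psiR tau p s * h ^+ 2| <= 40 * h ^+ 2 * rho p s `|h|.
Proof.
move=> t01 p12 s0; have /andP[t0 t1] := t01; have /andP[p1 p2] := p12.
pose u := h / s; have hE : h = s * u by rewrite /u mulrCA mulfV ?mulr1// gt_eqF.
have spE1 : s * s `^ (p - 1) = s `^ p by rewrite mulr_powRB1//; lra.
have spE2 : s * s `^ (p - 2) = s `^ (p - 1).
  rewrite -(@mulr_powRB1 _ s (p - 1)) ?ltW//; last lra.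
  by congr (_ * _ `^ _); ring.
have sp0 : 0 < s `^ p by rewrite powR_gt0.
have -> : 40 * h ^+ 2 * rho p s `|h| = s `^ p * (40 * u ^+ 2 * Num.min 1 `|u|).
  rewrite /rho (gtr0_norm s0) hE normrM (gtr0_norm s0).
  rewrite [s * `|u|]mulrC mulfK ?gt_eqF// -spE1 -spE2; ring.
have -> : taylor_rem tau p s h - 2^-1 * psiR tau p s * h ^+ 2 =
    s `^ p * (weight tau (s * (1 - u)) * `|1 - u| `^ p
      + tau * (- 1 + p * u - 2^-1 * p * (p - 1) * u ^+ 2)).
  rewrite /taylor_rem /psiR /phi /eta (gtr0_norm s0) gtr0_sg// (weight_ge0E t0 (ltW s0)).
  have -> : s - h = s * (1 - u) by rewrite hE; ring.
  rewrite normrM (gtr0_norm s0) powRM ?normr_ge0 ?(ltW s0)// hE.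
  rewrite -spE1 -spE2; ring.
rewrite normrM (gtr0_norm sp0) ler_pM2l//.
have u2 : u ^+ 2 = `|u| ^+ 2 by rewrite real_normK ?num_real.
(* For |u| <= 1/2 the residual keeps its sign and the cubic Taylor bound applies. Otherwise min(1,
   |u|) >= 1/2, and each of the two parts is at most (1 + |u|)^2 <= 9 u^2; the constant 40 leaves
   room for 18 u^2 against 20 u^2. *)
have [u12|u12] := leP `|u| 2^-1.
  have /andP[ul uu] : - 2^-1 <= u <= 2^-1 by rewrite -ler_norml.
  rewrite weight_ge0E//; last by rewrite mulr_ge0 ?ltW//; lra.
  rewrite (ger0_norm (_ : 0 <= 1 - u)); last by lra.
  rewrite -mulrDr normrM (gtr0_norm t0) min_r; last by lra.
  have := powR_sub1_taylor2 p12 u12.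
  rewrite -!addrA => h2.
  apply: (le_trans (ler_piMl (normr_ge0 _) (ltW t1))); apply: (le_trans h2).
  rewrite exprSr mulrA u2 ler_wpM2r// ler_wpM2r// ?sqr_ge0//; lra.
have m12 : 2^-1 <= Num.min 1 `|u| by rewrite le_min (ltW u12) andbT; lra.
have b1 : `|1 - u| `^ p <= (1 + `|u|) ^+ 2.
  rewrite -powR_mulrn ?addr_ge0//.
  apply: (@le_trans _ _ ((1 + `|u|) `^ p)).
    rewrite ge0_ler_powR// ?nnegrE ?addr_ge0//; first by lra.
    by rewrite (le_trans (ler_normB _ _))// normr1.
  by rewrite ler_powR// lerDl.
have w0 : 0 <= weight tau (s * (1 - u)) by rewrite ltW// weight_gt0.
have w1 : weight tau (s * (1 - u)) <= 1 by rewrite weight_le1.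
have A1 : weight tau (s * (1 - u)) * `|1 - u| `^ p <= (1 + `|u|) ^+ 2.
  by rewrite (le_trans _ b1)// ler_piMl// powR_ge0.
have A0 : 0 <= weight tau (s * (1 - u)) * `|1 - u| `^ p by rewrite mulr_ge0// powR_ge0.
have B : `|- 1 + p * u - 2^-1 * p * (p - 1) * u ^+ 2| <= 1 + 2 * `|u| + `|u| ^+ 2.
  apply: (le_trans (ler_normB _ _)); rewrite lerD//.
    apply: (le_trans (ler_normD _ _)); rewrite normrN normr1 lerD//.
    by rewrite normrM ler_wpM2r// gtr0_norm//; lra.
  rewrite normrM normrX ger0_norm; last by nra.
  by rewrite ler_piMl ?sqr_ge0//; nra.
apply: (le_trans (ler_normD _ _)); rewrite (ger0_norm A0) normrM (gtr0_norm t0).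
have C : tau * `|- 1 + p * u - 2^-1 * p * (p - 1) * u ^+ 2| <= 1 + 2 * `|u| + `|u| ^+ 2.
  by apply: le_trans B; rewrite ler_piMl// ltW.
apply: (le_trans (lerD A1 C)); rewrite u2.
apply: (@le_trans _ _ (40 * `|u| ^+ 2 * 2^-1)); last first.
  by rewrite ler_wpM2l// mulr_ge0// sqr_ge0.
by nra.
Qed.

(** Negative residuals follow by reflection. At s = 0 the right-hand side is 0, since division by 0
    gives 0, so the expansion has to be exact there: this is the case of the quadratic loss s^2 / 2,
    where 0 ^ 0 = 1 gives [psiR] the right value. *)
Lemma taylor_rem_bound tau p s h : 0 < tau < 1 -> 1 < p <= 2 ->
  s != 0 \/ (p = 2 /\ tau = 2^-1) ->
  `|taylor_rem tau p s h - 2^-1 * psiR tau p s * h ^+ 2| <= 40 * h ^+ 2 * rho p s `|h|.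
Proof.
move=> t01 p12; have pN0 : p != 0 by rewrite gt_eqF//; lra.
have [s0|s0|->] := ltgtP s 0.
- move=> _; have := @taylor_rem_bound_pos (1 - tau) p (- s) (- h) (onem_itv t01) p12.
  by rewrite oppr_gt0 taylor_remN// psiRN ?lt_eqF// /rho !normrN sqrrN => /(_ s0).
- by move=> _; exact: taylor_rem_bound_pos.
move=> [//|[-> ->]].
rewrite /taylor_rem /psiR /rho /eta /phi sgr0 mulr0 mul0r !sub0r normr0 powR0//.
rewrite mulr0 subr0 addr0 !subrr powRr0 normrN mulr1.
have w (x : R) : weight (2^-1 : R) x = 2^-1.
  by have [x0|x0] := leP 0 x; [rewrite weight_ge0E|rewrite weight_lt0E]; lra.
rewrite !w powR_mulrn// real_normK ?num_real// (_ : _ - _ = 0) ?normr0; last by field.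
by rewrite invr0 mulr0 min_r ?ler01// !mulr0.
Qed.

End loss_expansion.

(** * Expectations and independence *)

Section expectation_calculus.
Context d (T : measurableType d) (R : realType) (P : probability T R).
Implicit Types f g k : T -> R.

Definition integ f := P.-integrable [set: T] (EFin \o f).

(** Real-valued, so that estimates close by linear arithmetic; the value is the intended one for [f]
    with [integ f]. *)
Definition Ex f : R := \int[P]_x f x.

Lemma integ_measurable f : integ f -> measurable_fun setT f.
Proof. by move=> /measurable_int/measurable_EFinP. Qed.

Lemma integD f g : integ f -> integ g -> integ (fun x => f x + g x).
Proof. by move=> hf hg; exact: (integrableD measurableT hf hg). Qed.

Lemma integB f g : integ f -> integ g -> integ (fun x => f x - g x).
Proof. by move=> hf hg; exact: (integrableB measurableT hf hg). Qed.

Lemma integZ (c : R) f : integ f -> integ (fun x => c * f x).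
Proof. by move=> hf; exact: (integrableZl measurableT c hf). Qed.

Lemma integ_cst (c : R) : integ (fun=> c).
Proof. exact: finite_measure_integrable_cst. Qed.

Lemma integ_sum I (s : seq I) (F : I -> T -> R) :
  (forall i, integ (F i)) -> integ (fun x => \sum_(i <- s) F i x).
Proof.
move=> hF; elim: s => [|i s ih].
  by under eq_fun do rewrite big_nil; exact: integ_cst.
by under eq_fun do rewrite big_cons; exact: integD.
Qed.

Lemma integ_norm f : integ f -> integ (fun x => `|f x|).
Proof. by move=> hf; exact: (integrable_norm hf). Qed.

Lemma integ_le f g : measurable_fun setT f -> (forall x, `|f x| <= g x) ->
  integ g -> integ f.
Proof.
move=> mf fg; apply: le_integrable => //; first exact/measurable_EFinP.
by move=> x _ /=; rewrite lee_fin (le_trans (fg x))// ler_norm.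
Qed.

Lemma integ_bounded f (M : R) : measurable_fun setT f -> (forall x, `|f x| <= M) ->
  integ f.
Proof. by move=> mf fM; apply: (integ_le mf fM); exact: integ_cst. Qed.

Lemma EFin_Ex f : integ f -> ((Ex f)%:E = \int[P]_x (f x)%:E)%E.
Proof. by move=> hf; rewrite fineK//; exact: integrable_fin_num. Qed.

Lemma Ex_cst (c : R) : Ex (fun=> c) = c.
Proof. by rewrite /Ex /Rintegral integral_cst//= probability_setT mule1. Qed.

Lemma ExD f g : integ f -> integ g -> Ex (fun x => f x + g x) = Ex f + Ex g.
Proof. exact: RintegralD. Qed.

Lemma ExB f g : integ f -> integ g -> Ex (fun x => f x - g x) = Ex f - Ex g.
Proof. exact: RintegralB. Qed.

Lemma ExZ (c : R) f : integ f -> Ex (fun x => c * f x) = c * Ex f.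
Proof. exact: RintegralZl. Qed.

Lemma Ex_sum I (s : seq I) (F : I -> T -> R) : (forall i, integ (F i)) ->
  Ex (fun x => \sum_(i <- s) F i x) = \sum_(i <- s) Ex (F i).
Proof.
move=> hF; elim: s => [|i s ih].
  by under eq_fun do rewrite big_nil; rewrite big_nil Ex_cst.
under eq_fun do rewrite big_cons.
by rewrite big_cons ExD ?ih//; exact: integ_sum.
Qed.

Lemma Ex_le f g : integ f -> integ g -> (forall x, f x <= g x) -> Ex f <= Ex g.
Proof. by move=> hf hg fg; exact: le_Rintegral. Qed.

Lemma Ex_ge0 f : (forall x, 0 <= f x) -> 0 <= Ex f.
Proof. by move=> f0; exact: Rintegral_ge0. Qed.

Lemma Ex_norm_le f : integ f -> `|Ex f| <= Ex (fun x => `|f x|).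
Proof. by move=> hf; exact: le_normr_Rintegral. Qed.

Lemma Ex_le_ae f g : integ f -> integ g ->
  (forall x, 0 <= f x) -> (forall x, 0 <= g x) ->
  {ae P, forall x, f x <= g x} -> Ex f <= Ex g.
Proof.
move=> hf hg f0 g0 fg; rewrite -lee_fin !EFin_Ex//.
have := expectation_le (integ_measurable hf) (integ_measurable hg) f0 g0 fg.
by rewrite unlock.
Qed.

Lemma Ex_dominated (F : nat -> T -> R) f g :
  (forall n, measurable_fun setT (F n)) -> measurable_fun setT f ->
  (forall x, F n x @[n --> \oo] --> f x) -> integ g ->
  (forall n x, `|F n x| <= g x) -> Ex (F n) @[n --> \oo] --> Ex f.
Proof.
move=> mF mf Ff hg Fg.
have hF n : integ (F n) by apply: integ_le hg => //; exact: Fg.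
have [||||hf _ h] := @dominated_convergence _ T R P setT measurableT
    (fun n => EFin \o F n) (EFin \o f) (EFin \o g) _ _ _ hg _.
- by move=> n; exact/measurable_EFinP.
- exact/measurable_EFinP.
- by apply: aeW => x _; apply/fine_cvgP; split; [exact: nearW|exact: Ff].
- by apply: aeW => x n _; rewrite lee_fin.
by apply/fine_cvg; rewrite fineK; [exact: h|exact: integrable_fin_num].
Qed.

(* Uniform-in-c smallness follows from the sequence c = 1/(n+1) because the
   integrand is monotone in c. *)
Lemma Ex_min_small g k (e : R) : integ g -> (forall x, 0 <= g x) ->
  measurable_fun setT k -> (forall x, 0 <= k x) -> 0 < e ->
  exists2 delta, 0 < delta & forall c, 0 <= c <= delta ->
    Ex (fun x => g x * Num.min 1 (c * k x)) <= e.
Proof.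
move=> hg g0 mk k0 e0.
have mF c : measurable_fun setT (fun x => g x * Num.min 1 (c * k x)).
  apply: measurable_funM; first exact: integ_measurable.
  by apply: measurable_minr => //; exact: measurable_funM.
have min0 c x : 0 <= c -> 0 <= Num.min 1 (c * k x).
  by move=> c0; rewrite le_min ler01 mulr_ge0.
have hF c : 0 <= c -> integ (fun x => g x * Num.min 1 (c * k x)).
  move=> c0; apply: (integ_le (mF c) _ hg) => x.
  rewrite ger0_norm ?mulr_ge0 ?min0// ler_piMr// ge_min lexx//.
have : Ex (fun x => g x * Num.min 1 (n.+1%:R^-1 * k x)) @[n --> \oo] --> Ex (fun=> 0).
  apply: (@Ex_dominated _ _ g) => //.
  - move=> x; rewrite -[X in _ --> X](mulr0 (g x)); apply: cvgMr.
    apply: (@squeeze_cvgr _ _ _ _ (fun=> 0) (fun n => n.+1%:R^-1 * k x)).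
    + by apply: nearW => n; rewrite min0//= ge_min lexx orbT.
    + exact: cvg_cst.
    + rewrite -[X in _ --> X](mul0r (k x)); apply: cvgMl.
      exact: cvg_harmonic.
  - move=> n x; rewrite ger0_norm ?mulr_ge0 ?min0// ler_piMr// ge_min lexx//.
rewrite Ex_cst => /cvgrPdist_lt /(_ _ e0)[N _ /(_ N (leqnn N))] /=.
rewrite sub0r normrN ger0_norm; last by apply: Ex_ge0 => x; rewrite mulr_ge0// min0.
move=> he; exists N.+1%:R^-1; first by rewrite invr_gt0.
move=> c /andP[c0 cN]; apply: le_trans (ltW he); apply: Ex_le.
- exact: hF.
- exact: hF.
- move=> x; rewrite ler_wpM2l// le_min !ge_min lexx/=.
  by rewrite ler_wpM2r ?orbT.
Qed.

End expectation_calculus.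

Section independence.
Context d (T : measurableType d) (R : realType) (P : probability T R).

Definition indep d1 d2 (T1 : measurableType d1) (T2 : measurableType d2)
    (X : T -> T1) (Y : T -> T2) :=
  forall A B, measurable A -> measurable B ->
    P (X @^-1` A `&` Y @^-1` B) = (P (X @^-1` A) * P (Y @^-1` B))%E.

(** The joint law and the product of the laws agree on rectangles, which determine a product
    measure. *)
Lemma indep_prodE d1 d2 (T1 : measurableType d1) (T2 : measurableType d2)
    (X : {mfun T >-> T1}) (Y : {mfun T >-> T2}) D :
  indep X Y -> measurable D ->
  P ((fun w => (X w, Y w)) @^-1` D) = (distribution P X \x distribution P Y)%E D.
Proof.
move=> XY mD.
have mZ : measurable_fun setT (fun w => (X w, Y w)) by exact: measurable_fun_pair.
pose Z : {mfun T >-> (T1 * T2)%type} :=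
  MeasurableFun.Pack (MeasurableFun.Class (isMeasurableFun.Build _ _ _ _ _ mZ)).
rewrite -[LHS]/(distribution P Z D); exact/esym/product_measure_unique.
Qed.

(** Tonelli on the product of the two laws gives integrability; Fubini then gives the value. *)
Lemma indep_integM d1 d2 (T1 : measurableType d1) (T2 : measurableType d2)
    (X : T -> T1) (Y : T -> T2) (F : T1 -> R) (G : T2 -> R) :
  measurable_fun setT X -> measurable_fun setT Y ->
  measurable_fun setT F -> measurable_fun setT G ->
  indep X Y -> integ P (F \o X) -> integ P (G \o Y) ->
  integ P (fun w => F (X w) * G (Y w)) /\
  Ex P (fun w => F (X w) * G (Y w)) = Ex P (F \o X) * Ex P (G \o Y).
Proof.
move=> mX mY mF mG XY iF iG.
pose X' : {mfun T >-> T1} :=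
  MeasurableFun.Pack (MeasurableFun.Class (isMeasurableFun.Build _ _ _ _ _ mX)).
pose Y' : {mfun T >-> T2} :=
  MeasurableFun.Pack (MeasurableFun.Class (isMeasurableFun.Build _ _ _ _ _ mY)).
have mZ : measurable_fun setT (fun w => (X w, Y w)) by exact: measurable_fun_pair.
pose Z' : {mfun T >-> (T1 * T2)%type} :=
  MeasurableFun.Pack (MeasurableFun.Class (isMeasurableFun.Build _ _ _ _ _ mZ)).
pose m1 := distribution P X'; pose m2 := distribution P Y'.
have m12 D : measurable D -> (m1 \x m2)%E D = distribution P Z' D.
  by move=> mD; rewrite -indep_prodE.
pose f : (T1 * T2)%type -> \bar R := fun z => (F z.1 * G z.2)%:E.
have mf : measurable_fun setT f.
  apply/measurable_EFinP; apply: measurable_funM.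
    by apply: measurableT_comp => //; exact: measurable_fst.
  by apply: measurableT_comp => //; exact: measurable_snd.
have i1 : m1.-integrable setT (EFin \o F).
  by apply: integrable_pushforward => //; exact/measurable_EFinP.
have i2 : m2.-integrable setT (EFin \o G).
  by apply: integrable_pushforward => //; exact/measurable_EFinP.
have i12 : (m1 \x m2)%E.-integrable setT f.
  apply/integrable12ltyP => //=.
  have fin2 : (\int[m2]_y `|G y|%:E)%E \is a fin_num.
    by apply: integrable_fin_num => //; exact: (integrable_norm i2).
  under eq_integral => x _.
    under eq_integral => y _ do rewrite /f /= normrM EFinM.
    rewrite ge0_integralZl//; last first.
      by apply/measurable_EFinP; exact: measurableT_comp.
    rewrite -(fineK fin2) muleC; over.
  rewrite ge0_integralZl//; last 2 first.
  - by apply/measurable_EFinP; exact: measurableT_comp.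
  - by rewrite lee_fin fine_ge0// integral_ge0.
  rewrite lte_mul_pinfty// ?lee_fin ?fine_ge0 ?integral_ge0//.
  by have /integrableP[] := i1.
have eqm g : (\int[(m1 \x m2)%E]_z g z = \int[distribution P Z']_z g z)%E.
  by apply: eq_measure_integral => A mA _; exact: m12.
have iZ : integ P (fun w => F (X w) * G (Y w)).
  apply/integrableP; split.
    apply/measurable_EFinP; apply: measurable_funM; exact: measurableT_comp.
  have /integrableP[_] := i12; rewrite eqm ge0_integral_distribution//.
  exact: measurableT_comp.
split => //; apply: EFin_inj; rewrite EFinM !EFin_Ex//.
have := @integral_distribution _ _ _ _ _ P Z' f mf iZ => /= <-.
rewrite -eqm -integral12_prod_meas1//=.
under eq_integral => x _.
  rewrite /fubini_F; under eq_integral => y _ do rewrite /f /= EFinM.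
  rewrite integralZl//; over.
have fin2 : (\int[m2]_y (G y)%:E)%E \is a fin_num by exact: integrable_fin_num.
under eq_integral => x _ do rewrite -(fineK fin2).
rewrite integralZr// fineK//; congr (_ * _)%E.
- by rewrite -[RHS](@integral_distribution _ _ _ _ _ P X' (EFin \o F))//; exact/measurable_EFinP.
- by rewrite -[RHS](@integral_distribution _ _ _ _ _ P Y' (EFin \o G))//; exact/measurable_EFinP.
Qed.

End independence.

(** The variables may live on different spaces: this carries expectations from each error to [e],
    and from a normal variable on any space to [N01]. *)
Lemma Ex_eq_law d (T : measurableType d) d' (T' : measurableType d') d1
    (T1 : measurableType d1) (R : realType)
    (P : probability T R) (Q : probability T' R) (X : T -> T1) (Y : T' -> T1)
    (F : T1 -> R) :
  measurable_fun setT X -> measurable_fun setT Y -> measurable_fun setT F ->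
  (forall A, measurable A -> P (X @^-1` A) = Q (Y @^-1` A)) ->
  integ Q (F \o Y) -> integ P (F \o X) /\ Ex P (F \o X) = Ex Q (F \o Y).
Proof.
move=> mX mY mF XY iY.
pose X' : {mfun T >-> T1} :=
  MeasurableFun.Pack (MeasurableFun.Class (isMeasurableFun.Build _ _ _ _ _ mX)).
pose Y' : {mfun T' >-> T1} :=
  MeasurableFun.Pack (MeasurableFun.Class (isMeasurableFun.Build _ _ _ _ _ mY)).
have eqm (g : T1 -> \bar R) :
    (\int[distribution P X']_z g z = \int[distribution Q Y']_z g z)%E.
  by apply: eq_measure_integral => A mA _; exact: XY.
have mF' : measurable_fun setT (EFin \o F) by exact/measurable_EFinP.
have iX : integ P (F \o X).
  apply/integrableP; split.
    by apply/measurable_EFinP; exact: measurableT_comp.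
  have mF'' : measurable_fun setT (fun x => `|(EFin \o F) x|%E).
    exact: measurableT_comp.
  rewrite -(@ge0_integral_distribution _ _ _ _ _ P X' _ mF'')// eqm.
  by rewrite (@ge0_integral_distribution _ _ _ _ _ Q Y' _ mF'')//; case/integrableP: iY.
split => //; apply: EFin_inj; rewrite !EFin_Ex//.
rewrite -(@integral_distribution _ _ _ _ _ P X' (EFin \o F))// eqm.
exact: (@integral_distribution _ _ _ _ _ Q Y' (EFin \o F)).
Qed.

(** * Independence of a sum of past terms from the next error *)

Section mutual_independence.
Context d (T : measurableType d) (R : realType) (P : probability T R).
Variable eps : nat -> {RV P >-> R}.
Hypothesis eps_indep : mutually_independent eps.

Let cyl n : set (set T) := [set D | exists2 A : nat -> set R,
  (forall i, measurable (A i)) & D = \bigcap_(i in [set` iota 0 n]) (eps i @^-1` A i)].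

Let cyl_measurable n : cyl n `<=` measurable.
Proof.
move=> D [A mA ->]; apply: fin_bigcap_measurable => // i _.
exact: measurable_funPTI.
Qed.

(** As functions of [E] both sides are finite measures. Mutual independence makes them agree on the
    pi-system [cyl n], hence on the sigma-algebra that it generates. *)
Let indep_cyl n E B : <<s cyl n >> E -> measurable B ->
  P (E `&` eps n @^-1` B) = (P E * P (eps n @^-1` B))%E.
Proof.
move=> sE mB.
have mnB : measurable (eps n @^-1` B).
  exact: measurable_funPTI.
have finB : P (eps n @^-1` B) \is a fin_num by exact: fin_num_measure.
have r0 : 0 <= fine (P (eps n @^-1` B)) by exact: fine_ge0.
pose m1 := mrestr P mnB; pose m2 := mscale (NngNum r0) P.
have -> : P (E `&` eps n @^-1` B) = m1 E by [].
have -> : (P E * P (eps n @^-1` B))%E = m2 E.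
  by rewrite /m2 /mscale /= fineK// muleC.
apply: (g_sigma_algebra_measure_unique (cyl n) (@cyl_measurable n) (fun=> setT)) sE => //.
- by move=> _; exists (fun=> setT) => //; apply/seteqP; split.
- by apply/seteqP; split => // x _; exists 0%N.
- move=> _ _ [A mA ->] [A' mA' ->]; exists (fun i => A i `&` A' i).
    by move=> i; exact: measurableI.
  apply/seteqP; split => [w [h1 h2] i hi|w h].
    by split; [exact: h1|exact: h2].
  by split => i /h [].
- move=> D [A mA ->].
  (* The past constraints followed by [B] at index n: mutual independence is used for the lists of
     the first n and n + 1 indices. *)
  pose C i := if (i < n)%N then A i else B.
  have CE i : i \in iota 0 n -> C i = A i by rewrite mem_iota add0n /C => /andP[_ ->].
  have CnE : C n = B by rewrite /C ltnn.
  have mC i : measurable (C i) by rewrite /C; case: ifP.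
  have := @eps_indep (iota 0 n.+1) C (iota_uniq _ _) mC.
  have := @eps_indep (iota 0 n) C (iota_uniq _ _) mC.
  have iotaE : iota 0 n.+1 = iota 0 n ++ [:: n] by rewrite -addn1 iotaD add0n.
  rewrite iotaE big_cat big_seq1 /= CnE => <- h.
  rewrite /m1 /mrestr /m2 /mscale /= fineK// muleC.
  have -> : \bigcap_(i in [set` iota 0 n]) eps i @^-1` A i =
      \bigcap_(i in [set` iota 0 n]) eps i @^-1` C i.
    by apply: eq_bigcapr => i /= /CE ->.
  rewrite -h; congr (P _); apply/seteqP; split => [w [h1 h2] i /=|w h1].
    rewrite mem_cat => /orP[/h1//|]; rewrite inE => /eqP ->; by rewrite CnE.
  split; first by move=> i hi; apply: h1; rewrite /= mem_cat hi.
  by rewrite -CnE; apply: h1; rewrite /= mem_cat inE eqxx orbT.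
- by move=> _; rewrite -[X in (X < _)%E]/(P (setT `&` eps n @^-1` B)) setTI ltey_eq finB.
Qed.

Lemma indep_sum n (h : nat -> R -> R) : (forall i, measurable_fun setT (h i)) ->
  indep P (fun w => \sum_(i < n) h i (eps i w)) (eps n).
Proof.
move=> mh A B mA mB; apply: indep_cyl => //.
pose G := cyl n.
suff : measurable_fun setT ((fun w => \sum_(i < n) h i (eps i w)) : g_sigma_algebraType G -> R).
  by move=> /(_ measurableT A mA); rewrite setTI.
apply: measurable_sum => i.
apply: (@measurableT_comp _ _ _ _ _ _ (h i) _ (eps i : g_sigma_algebraType G -> R)) => //.
move=> _ D mD; rewrite setTI; apply: sub_sigma_algebra.
exists (fun j : nat => if j == i :> nat then D else setT).
  by move=> j; case: ifP.
apply/seteqP; split => [w hw j /=|w hw].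
  by case: ifP => // /eqP ->.
have := hw i; rewrite /= eqxx; apply.
by rewrite mem_iota add0n ltn_ord.
Qed.

End mutual_independence.

(** * Normal laws *)

Section normal_moments.
Context {R : realType}.
Notation mu := (@lebesgue_measure R).
Import HBNNSimple.

(** Integration against a density. For indicators it is the definition of [normal_prob]; simple
    functions and monotone convergence do the rest. *)
Lemma ge0_integral_normal_prob (m s : R) (f : measurableTypeR R -> \bar R) :
  measurable_fun setT f -> (forall x, 0 <= f x)%E ->
  (\int[normal_prob m s]_x f x = \int[mu]_x (f x * (normal_pdf m s x)%:E))%E.
Proof.
move=> mf f0; have mpdf := @measurable_normal_pdf R m s.
pose f_ := nnsfun_approx measurableT mf.
have cf x : (f_ n x)%:E @[n --> \oo] --> f x by exact: cvg_nnsfun_approx.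
have ndf x a b : (a <= b)%N -> f_ a x <= f_ b x.
  by move=> ab; exact/lefP/nd_nnsfun_approx.
transitivity (limn (fun n => \int[normal_prob m s]_x (f_ n x)%:E)%E).
  rewrite -monotone_convergence//.
  - by apply: eq_integral => x _; apply/esym/cvg_lim.
  - by move=> n; exact/measurable_EFinP.
  - by move=> n x _; rewrite lee_fin.
  - by move=> x _ a b ab; rewrite lee_fin ndf.
transitivity (limn (fun n => \int[mu]_x ((f_ n x)%:E * (normal_pdf m s x)%:E))%E); last first.
  rewrite -monotone_convergence//.
  - apply: eq_integral => x _; apply/cvg_lim => //.
    apply: cvgeZr => //; exact: cf.
  - by move=> n; apply/measurable_EFinP; exact: measurable_funM.
  - by move=> n x _; rewrite lee_fin mulr_ge0// normal_pdf_ge0.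
  - by move=> x _ a b ab; rewrite lee_fin ler_wpM2r ?normal_pdf_ge0 ?ndf.
congr (limn _); apply/funext => n.
transitivity (\sum_(k \in range (f_ n)) (k%:E * normal_prob m s (f_ n @^-1` [set k])))%E.
  under eq_integral do rewrite fimfunE -fsumEFin//.
  rewrite ge0_integral_fsum//; last 2 first.
  - by move=> y; exact/measurable_EFinP/measurable_funM.
  - by move=> y x _; rewrite nnfun_muleindic_ge0.
  apply: eq_fsbigr => r _; rewrite integralZl_indic_nnsfun// integral_indic//=.
  by rewrite setIT.
transitivity (\int[mu]_x \sum_(k \in range (f_ n))
    ((k * \1_(f_ n @^-1` [set k]) x)%:E * (normal_pdf m s x)%:E))%E; last first.
  apply: eq_integral => x _; rewrite -ge0_mule_fsuml//; last first.
    by move=> y; rewrite nnfun_muleindic_ge0.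
  by rewrite fsumEFin// -fimfunE.
rewrite ge0_integral_fsum//; last 2 first.
- move=> y; apply/measurable_EFinP/measurable_funM => //; exact: measurable_funM.
- by move=> y x _; rewrite mule_ge0 ?nnfun_muleindic_ge0// lee_fin normal_pdf_ge0.
apply: eq_fsbigr => r /set_mem[y _ <-].
rewrite /normal_prob [X in (_ * X)%E]integral_mkcond -ge0_integralZl//.
- apply: eq_integral => x _; rewrite epatch_indic -EFinM; congr EFin; ring.
- apply/measurable_restrict => //; apply: measurable_funTS.
  exact/measurable_EFinP.
- by move=> x _; rewrite epatch_indic mule_ge0// ?lee_fin ?normal_pdf_ge0.
- by rewrite lee_fin.
Qed.

Lemma ge0_integral_addr (c : R) (f : measurableTypeR R -> \bar R) :
  measurable_fun setT f -> (forall x, 0 <= f x)%E ->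
  (\int[mu]_x f (x + c)%R = \int[mu]_x f x)%E.
Proof.
move=> mf f0.
have mphi : measurable_fun setT (fun x : measurableTypeR R => x + c : measurableTypeR R).
  exact: measurable_funD.
have := ge0_integral_pushforward mphi mu measurableT mf (fun x _ => f0 x).
rewrite preimage_setT /= => <-.
apply: eq_measure_integral => A mA _; apply/esym/lebesgue_measure_unique => // X.
move=> [[a b]] _ <-; transitivity (mu `]a - c, b - c]%classic); last first.
  congr (mu _); apply/seteqP; split => x /=;
  by rewrite !in_itv/= ltrBlDr lerBrDr.
rewrite !lebesgue_measure_itv/= !lte_fin ltrD2r; case: ifP => // _.
by rewrite -!EFinB; congr EFin; ring.
Qed.

Lemma lebesgue_measure_mulr (s : R) (A : set R) : 0 < s -> measurable A ->
  (mu A = s%:E * mu ((fun x => s * x)%R @^-1` A))%E.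
Proof.
move=> s0 mA.
have mphi : measurable_fun setT (fun x : measurableTypeR R => s * x : measurableTypeR R).
  exact: measurable_funM.
pose nu := measure_function_pushforward__canonical__measure_function_Measure mu mphi.
have s0' := ltW s0.
rewrite (@lebesgue_measure_unique _ (mscale (NngNum s0') nu))//.
move=> X [[a b]] _ <-; rewrite /mscale /pushforward /=.
transitivity (s%:E * mu `](a / s)%R, (b / s)%R]%classic)%E; last first.
  congr (_ * mu _)%E; apply/seteqP; split => x /=;
  by rewrite !in_itv/= ltr_pdivrMr// ler_pdivlMr// ![x * s]mulrC.
rewrite !lebesgue_measure_itv/= !lte_fin ltr_pM2r ?invr_gt0//.
case: ifP => _; last by rewrite mule0.
by rewrite -!EFinB -EFinM -mulrBl mulrCA mulfV ?mulr1// gt_eqF.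
Qed.

Lemma normal_pdf_mulr (s x : R) : 0 < s ->
  normal_pdf 0 1 x = s * normal_pdf 0 s (s * x).
Proof.
move=> s0; rewrite !normal_pdfE ?gt_eqF// /normal_fun !subr0 mulrA.
congr (_ * expR _).
  rewrite /normal_peak expr1n mul1r -mulrnAr sqrtrM ?sqr_ge0// sqrtr_sqr gtr0_norm//.
  by rewrite invfM mulrA mulfV ?mul1r// gt_eqF.
by field; rewrite gt_eqF.
Qed.

(** Positive factors rescale the density; a negative factor is one of these composed with the
    reflection, which preserves the centered law. *)
Lemma normal_prob_mulr (s : R) (A : set R) : s != 0 -> measurable A ->
  normal_prob 0 1 ((fun x => s * x) @^-1` A) = normal_prob 0 `|s| A.
Proof.
have mphi c : measurable_fun setT (fun x : measurableTypeR R => c * x : measurableTypeR R).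
  exact: measurable_funM.
have mI (t : R) (B : set R) (c : R) : measurable B -> measurable_fun setT
    (fun x : measurableTypeR R => (c * normal_pdf 0 t x * \1_B x)%:E).
  move=> mB; apply/measurable_EFinP; apply: measurable_funM => //.
  by apply: measurable_funM => //; exact: measurable_normal_pdf.
have pdf0 (t : R) (B : set R) (c x : R) : 0 <= c -> (0 <= (c * normal_pdf 0 t x * \1_B x)%:E)%E.
  by move=> c0; rewrite lee_fin !mulr_ge0// normal_pdf_ge0.
have probE (t : R) (B : set R) : measurable B ->
    normal_prob 0 t B = (\int[mu]_x (1 * normal_pdf 0 t x * \1_B x)%:E)%E.
  move=> mB; rewrite /normal_prob integral_mkcond.
  by apply: eq_integral => x _; rewrite epatch_indic -EFinM mul1r.
have pos (t : R) (B : set R) : 0 < t -> measurable B ->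
    normal_prob 0 1 ((fun x => t * x) @^-1` B) = normal_prob 0 t B.
  move=> t0 mB; have mB' : measurable ((fun x => t * x) @^-1` B).
    by rewrite -[X in measurable X]setTI; exact: mphi.
  rewrite !probE//.
  pose nu := measure_function_pushforward__canonical__measure_function_Measure mu (mphi t).
  transitivity (\int[mu]_x (t * normal_pdf 0 t (t * x) * \1_B (t * x))%:E)%E.
    by apply: eq_integral => x _; rewrite mul1r (normal_pdf_mulr _ t0) !indicE.
  have := ge0_integral_pushforward (mphi t) mu measurableT (mI t B t mB)
    (fun x _ => pdf0 t B t x (ltW t0)).
  rewrite preimage_setT /= => <-.
  rewrite -[RHS]/(\int[mu]_(x in setT) (1 * normal_pdf 0 t x * \1_B x)%:E)%E.
  have t0' := ltW t0.
  transitivity (\int[mscale (NngNum t0') nu]_x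
      (1 * normal_pdf 0 t x * \1_B x)%:E)%E.
    rewrite ge0_integral_mscale//=; last 2 first.
    - by apply: measurable_funTS; exact: mI.
    - by move=> x _; exact: pdf0.
    rewrite -ge0_integralZl//; last 2 first.
    - exact: mI.
    - by move=> x _; exact: pdf0.
    by apply: eq_integral => x _; rewrite -EFinM !mulrA mulr1.
  by apply: eq_measure_integral => C mC _; exact/esym/(lebesgue_measure_mulr t0).
have sym (B : set R) : measurable B -> normal_prob 0 1 (-%R @^-1` B) = normal_prob 0 1 B.
  move=> mB; have mN : measurable_fun setT (-%R : measurableTypeR R -> measurableTypeR R).
    exact: oppr_measurable.
  have mB' : measurable (-%R @^-1` B).
    by rewrite -[X in measurable X]setTI; exact: mN.
  rewrite !probE//.
  transitivity (\int[mu]_x (1 * normal_pdf 0 1 (- x) * \1_B (- x))%:E)%E.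
    apply: eq_integral => x _; rewrite !normal_pdfE ?oner_eq0// /normal_fun !subr0 sqrrN.
    by rewrite !indicE.
  have := ge0_integral_pushforward mN mu measurableT (mI 1 B 1 mB)
    (fun x _ => pdf0 1 B 1 x ler01).
  rewrite preimage_setT /= => <-.
  by apply: eq_measure_integral => C mC _; exact: lebesgue_measureN.
move=> s0 mA; have [sn|sp|s00] := ltgtP s 0; last by rewrite s00 eqxx in s0.
  rewrite (ltr0_norm sn) -(pos (- s)) ?oppr_gt0// -sym; last first.
    by rewrite -[X in measurable X]setTI; exact: mphi.
  congr (normal_prob _ _ _); apply/seteqP; split => x /=;
  by rewrite mulrN mulNr.
by rewrite (gtr0_norm sp); exact: pos.
Qed.

Definition N01 : probability (measurableTypeR R) R := normal_prob (0 : R) 1.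

(** This is 1 + z <= exp z applied to the ratio of the two Gaussian exponentials. Integrated over x,
    it yields the second moment without integration by parts. *)
Let normal_pdf_tangent (s x : R) : 0 < s ->
  normal_pdf 0 1 x + 2^-1 * (1 - s ^- 2) * (x ^+ 2 * normal_pdf 0 1 x) <=
  s * normal_pdf 0 s x.
Proof.
move=> s0; have -> : s * normal_pdf 0 s x = normal_pdf 0 1 (s^-1 * x).
  by rewrite (normal_pdf_mulr _ s0) mulrA mulfV ?mul1r// gt_eqF.
rewrite !normal_pdfE ?oner_eq0// /normal_fun !subr0.
set c := normal_peak 1.
have -> : - (s^-1 * x) ^+ 2 / (1 ^+ 2 *+ 2) =
    - x ^+ 2 / (1 ^+ 2 *+ 2) + 2^-1 * (1 - s ^- 2) * x ^+ 2 :> R.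
  by field; rewrite gt_eqF.
rewrite expRD mulrA; set E := expR (- x ^+ 2 / _).
have -> : c * E + 2^-1 * (1 - s ^- 2) * x ^+ 2 * (c * E) =
  c * E * (1 + 2^-1 * (1 - s ^- 2) * x ^+ 2) by ring.
rewrite [leRHS]mulrA.
rewrite ler_wpM2l ?mulr_ge0 ?normal_peak_ge0 ?expR_ge0//.
exact: expR_ge1Dx.
Qed.

(** The case s = 2 of [normal_pdf_tangent] reads pdf + (3/8) x^2 pdf <= 2 pdf_2, whence the factor
    8/3. *)
Let integrable_sqr_pdf : mu.-integrable setT (fun x => (x ^+ 2 * normal_pdf 0 1 x)%:E).
Proof.
apply: (@le_integrable _ _ _ mu setT measurableT _
    (fun x => ((8 / 3) * (2 * normal_pdf 0 2 x))%:E)).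
- apply/measurable_EFinP/measurable_funM; last exact: measurable_normal_pdf.
  exact: measurable_funX.
- move=> x _; have pdf0 t : 0 <= normal_pdf 0 t x := normal_pdf_ge0 _ _ _.
  rewrite /= lee_fin ger0_norm; last exact: mulr_ge0 (sqr_ge0 _) _.
  rewrite ger0_norm; last by rewrite mulr_ge0// mulr_ge0.
  have := @normal_pdf_tangent 2 x (ltr0n _ 2).
  have := normal_pdf_ge0 0 1 x; move: (normal_pdf _ _ _) => q q0.
  move: (normal_pdf 0 2 x) => q2.
  have -> : (2 : R) ^- 2 = 4^-1 by rewrite -natrX.
  by move: (x ^+ 2 * q) => z; lra.
- exact: (integrableZl measurableT (8 / 3)
    (integrableZl measurableT 2 (integrable_normal_pdf 0 2))).
Qed.

Lemma normal_second_moment : integ N01 (fun x => x ^+ 2) /\ Ex N01 (fun x => x ^+ 2) = 1.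
Proof.
have mX : measurable_fun setT (fun x : measurableTypeR R => (x ^+ 2)%:E).
  by apply/measurable_EFinP; exact: measurable_funX.
have X0 (x : measurableTypeR R) : (0 <= (x ^+ 2)%:E)%E by rewrite lee_fin sqr_ge0.
have NE : (\int[N01]_x (x ^+ 2)%:E = \int[mu]_x (x ^+ 2 * normal_pdf 0 1 x)%:E)%E.
  by rewrite ge0_integral_normal_prob//; apply: eq_integral => x _; rewrite EFinM.
split.
  apply/integrableP; split => //.
  have /integrableP[_] := integrable_sqr_pdf; congr (_ < _)%E.
  transitivity (\int[N01]_x (x ^+ 2)%:E)%E.
    rewrite NE; apply: eq_integral => x _ /=.
    by rewrite ger0_norm//; exact: mulr_ge0 (sqr_ge0 _) (normal_pdf_ge0 _ _ _).
  by apply: eq_integral => x _ /=; rewrite ger0_norm// sqr_ge0.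
rewrite /Ex /Rintegral NE -/(Rintegral _ _ _); clear NE; set J := Rintegral _ _ _.
have ip s : mu.-integrable setT (EFin \o normal_pdf 0 s) by exact: integrable_normal_pdf.
have J0 : 0 <= J by apply: Rintegral_ge0 => x _; rewrite mulr_ge0 ?sqr_ge0 ?normal_pdf_ge0.
(* An inequality in s with equality at s = 1: the derivatives of both sides, J and 1, must agree
   there. *)
have key (s : R) : 0 < s -> 1 + 2^-1 * (1 - s ^- 2) * J <= s.
  move=> s0; have pdf1 t : \int[mu]_x normal_pdf 0 t x = 1.
    by rewrite /Rintegral integral_normal_pdf.
  have is2 c := integrableZl measurableT c integrable_sqr_pdf.
  have <- : \int[mu]_x (normal_pdf 0 1 x + 2^-1 * (1 - s ^- 2) * (x ^+ 2 * normal_pdf 0 1 x))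
      = 1 + 2^-1 * (1 - s ^- 2) * J.
    by rewrite RintegralD// ?pdf1 ?RintegralZl//; exact: is2.
  have E2 : \int[mu]_x (s * normal_pdf 0 s x) = s by rewrite RintegralZl// pdf1 mulr1.
  rewrite -[X in _ <= X]E2.
  apply: le_Rintegral => //.
  - exact: (integrableD measurableT (ip 1) (is2 _)).
  - exact: (integrableZl measurableT _ (ip s)).
  - by move=> x _; exact: normal_pdf_tangent.
(* If J = 1 + 2t or J = 1 - 2t with t > 0, then s = 1 + t or s = 1 - t violates [key] by a term of
   order t^2. *)
apply/eqP; rewrite eq_le; apply/andP; split; rewrite leNgt; apply/negP => J1.
- pose t := (J - 1) / 2; have JE : J = 1 + 2 * t by rewrite /t; field.
  have t0 : 0 < t by lra.
  have := key (1 + t) (ltr_pwDl ltr01 (ltW t0)); rewrite JE.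
  have -> : 1 + 2^-1 * (1 - (1 + t) ^- 2) * (1 + 2 * t) =
    (1 + t) + t ^+ 2 / (2 * (1 + t) ^+ 2) :> R by field; rewrite gt_eqF; lra.
  by rewrite gerDl leNgt divr_gt0 ?exprn_gt0// mulr_gt0// exprn_gt0//; lra.
- pose t := (1 - J) / 2; have JE : J = 1 - 2 * t by rewrite /t; field.
  have t0 : 0 < t by lra.
  have t1 : 0 < 1 - t by lra.
  have := key (1 - t) t1; rewrite JE.
  have -> : 1 + 2^-1 * (1 - (1 - t) ^- 2) * (1 - 2 * t) =
    (1 - t) + t ^+ 2 / (2 * (1 - t) ^+ 2) :> R by field; rewrite gt_eqF; lra.
  by rewrite gerDl leNgt divr_gt0 ?exprn_gt0// mulr_gt0// exprn_gt0.
Qed.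

Lemma normal_odd (F : measurableTypeR R -> R) : measurable_fun setT F ->
  (forall x : R, F (- x) = - F x) -> integ N01 F -> Ex N01 F = 0.
Proof.
move=> mF oF iF.
have := @Ex_eq_law _ _ _ _ _ _ R N01 N01 (-%R : measurableTypeR R -> measurableTypeR R)
  (id : measurableTypeR R -> measurableTypeR R) F.
move=> /(_ (@oppr_measurable _ _) (@measurable_id _ _ _) mF)[||_] //.
  move=> A mA; have := @normal_prob_mulr (-1) A; rewrite oppr_eq0 oner_eq0 normrN normr1.
  move=> /(_ isT mA) h; rewrite -[RHS]/(normal_prob 0 1 A) -h; congr (normal_prob _ _ _).
  by apply/funext => x /=; rewrite mulN1r.
have -> : Ex N01 (F \o -%R) = - Ex N01 F.
  rewrite -mulN1r -ExZ//; congr (Ex _ _); apply/funext => x.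
  by rewrite /= oF mulN1r.
have -> : Ex N01 (F \o id) = Ex N01 F by [].
by lra.
Qed.

End normal_moments.

Section normal_convolution.
Context {R : realType}.
Notation mu := (@lebesgue_measure R).

(** Completing the square in x. On the right stand the density of the sum at y and the conditional
    density of the first summand given the sum, with mean s^2 y / r^2 and deviation s t / r. *)
Lemma normal_pdf_convolution (s t x y : R) : 0 < s -> 0 < t ->
  let r := Num.sqrt (s ^+ 2 + t ^+ 2) in
  normal_pdf 0 t (y - x) * normal_pdf 0 s x =
  normal_pdf 0 r y * normal_pdf (s ^+ 2 / r ^+ 2 * y) (s * t / r) x.
Proof.
move=> s0 t0 r; have r0 : 0 < r by rewrite sqrtr_gt0 addr_gt0// exprn_gt0.
have r2 : r ^+ 2 = s ^+ 2 + t ^+ 2 by rewrite sqr_sqrtr// addr_ge0// sqr_ge0.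
have q0 : 0 < s * t / r by rewrite divr_gt0// mulr_gt0.
rewrite !normal_pdfE ?gt_eqF// /normal_fun.
have pk : normal_peak t * normal_peak s = normal_peak r * normal_peak (s * t / r).
  have pos (u : R) : 0 <= u ^+ 2 * pi *+ 2.
    by rewrite mulrn_wge0// mulr_ge0 ?pi_ge0 ?sqr_ge0.
  rewrite /normal_peak -!invfM -!sqrtrM//.
  congr (Num.sqrt _)^-1; field; exact: lt0r_neq0.
rewrite mulrACA pk [RHS]mulrACA -!expRD; congr (_ * expR _).
rewrite !subr0 expr_div_n exprMn r2; field.
by rewrite !gt_eqF//= -r2 exprn_gt0.
Qed.

Let measurable_conv (s t : R) (A : set R) : measurable A ->
  measurable_fun setT (fun z : measurableTypeR R * measurableTypeR R =>
    (normal_pdf 0 t (z.2 - z.1) * \1_A z.2 * normal_pdf 0 s z.1)%:E).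
Proof.
move=> mA; apply/measurable_EFinP; apply: measurable_funM.
  apply: measurable_funM.
    apply: measurableT_comp; first exact: measurable_normal_pdf.
    by apply: measurable_funB; [exact: measurable_snd|exact: measurable_fst].
  by apply: measurableT_comp => //; exact: measurable_snd.
by apply: measurableT_comp; [exact: measurable_normal_pdf|exact: measurable_fst].
Qed.

Let add_preimage (A : set R) : set (measurableTypeR R * measurableTypeR R) :=
  (fun z => z.1 + z.2) @^-1` A.

Let measurable_addP A : measurable A -> measurable (add_preimage A).
Proof.
move=> mA; rewrite -[X in measurable X]setTI.
by apply: (measurable_funD (@measurable_fst _ _ _ _) (@measurable_snd _ _ _ _)).
Qed.

Let xsection_addE A (x : R) : xsection (add_preimage A) x = (fun y => x + y) @^-1` A.
Proof. by apply/seteqP; split => y; rewrite /xsection /= inE. Qed.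

(** After Tonelli, the conditional density of [normal_pdf_convolution] integrates to 1 in x and only
    the density of the sum remains. *)
Lemma normal_prob_convolution (s t : R) (A : set R) : 0 < s -> 0 < t -> measurable A ->
  (\int[normal_prob 0 s]_x normal_prob 0 t ((fun y => x + y)%R @^-1` A))%E =
  normal_prob 0 (Num.sqrt (s ^+ 2 + t ^+ 2)) A.
Proof.
move=> s0 t0 mA; set r := Num.sqrt _.
have mpdf m u : measurable_fun setT (fun x : measurableTypeR R => normal_pdf m u x).
  exact: measurable_normal_pdf.
have mshift (x : R) : measurable ((fun y => x + y) @^-1` A).
  rewrite -[X in measurable X]setTI.
  by apply: (measurable_funD (measurable_cst x) (@measurable_id _ _ _)).
have shiftE (x : R) : (normal_prob 0 t ((fun y => x + y)%R @^-1` A) =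
    \int[mu]_y (normal_pdf 0 t (y - x) * \1_A y)%:E)%E.
  rewrite -[RHS](@ge0_integral_addr _ x); last 2 first.
  - apply/measurable_EFinP/measurable_funM => //.
    apply: measurableT_comp; first exact: measurable_normal_pdf.
    exact: measurable_funB.
  - by move=> y; rewrite lee_fin mulr_ge0// normal_pdf_ge0.
  rewrite /normal_prob integral_mkcond; apply: eq_integral => y _.
  by rewrite epatch_indic -EFinM addrK !indicE [(y + x)%R]addrC; congr (_ * _)%:E.
pose h (x y : R) : \bar R := (normal_pdf 0 t (y - x) * \1_A y * normal_pdf 0 s x)%:E.
have h0 z : (0 <= h z.1 z.2)%E by rewrite lee_fin !mulr_ge0// normal_pdf_ge0.
have mh := @measurable_conv s t A mA.
have inner (x : R) : (normal_prob 0 t ((fun y => x + y)%R @^-1` A) * (normal_pdf 0 s x)%:E =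
    \int[mu]_y h x y)%E.
  rewrite shiftE -ge0_integralZr//.
  - apply/measurable_EFinP/measurable_funM => //.
    apply: measurableT_comp; first exact: measurable_normal_pdf.
    exact: measurable_funB.
  - by move=> y _; rewrite lee_fin mulr_ge0// normal_pdf_ge0.
  - by rewrite lee_fin normal_pdf_ge0.
rewrite ge0_integral_normal_prob; last 2 first.
- under eq_fun do rewrite -xsection_addE.
  exact: measurable_fun_xsection (measurable_addP mA).
- by move=> x; exact: measure_ge0.
under eq_integral do rewrite inner.
transitivity (\int[mu]_y \int[mu]_x h x y)%E.
  exact: (fubini_tonelli (fun z : measurableTypeR R * measurableTypeR R => h z.1 z.2)).
rewrite /normal_prob [RHS]integral_mkcond; apply: eq_integral => y _.
rewrite epatch_indic -EFinM -[RHS]mule1.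
rewrite -(@integral_normal_pdf R (s ^+ 2 / r ^+ 2 * y) (s * t / r)).
rewrite -ge0_integralZl//.
- apply: eq_integral => x _; rewrite /h -EFinM mulrAC normal_pdf_convolution//.
  by rewrite -!mulrA [X in _ * X]mulrC.
- exact/measurable_EFinP.
- by move=> x _; rewrite lee_fin normal_pdf_ge0.
- by rewrite lee_fin mulr_ge0// normal_pdf_ge0.
Qed.

Lemma normal_law_scale (s : R) (A : set R) : measurable A ->
  N01 ((fun x => s * x) @^-1` A) = normal_law 0 (s ^+ 2) A.
Proof.
move=> mA; rewrite /normal_law sqrf_eq0; have [->|s0] := eqVneq s 0.
  rewrite diracE; have [A0|A0] := boolP (0 \in A).
    rewrite (_ : _ @^-1` A = setT) ?probability_setT//.
    by apply/seteqP; split => // x _ /=; rewrite mul0r; exact/set_mem.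
  rewrite (_ : _ @^-1` A = set0) ?measure0//.
  apply/seteqP; split => // x /=; rewrite mul0r => h.
  by move: A0; rewrite mem_set.
by rewrite sqrtr_sqr; exact: normal_prob_mulr.
Qed.

Lemma normal_law_add d (T : measurableType d) (P : probability T R) (X Y : T -> R)
    (v1 v2 : R) (A : set R) :
  measurable_fun setT X -> measurable_fun setT Y -> indep P X Y ->
  0 <= v1 -> 0 <= v2 ->
  (forall B, measurable B -> P (X @^-1` B) = normal_law 0 v1 B) ->
  (forall B, measurable B -> P (Y @^-1` B) = normal_law 0 v2 B) ->
  measurable A -> P ((fun w => X w + Y w) @^-1` A) = normal_law 0 (v1 + v2) A.
Proof.
move=> mX mY XY v10 v20 lX lY mA.
have mX' : measurable_fun setT (X : T -> measurableTypeR R) by exact: mX.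
have mY' : measurable_fun setT (Y : T -> measurableTypeR R) by exact: mY.
pose X' : {mfun T >-> measurableTypeR R} :=
  MeasurableFun.Pack (MeasurableFun.Class (isMeasurableFun.Build _ _ _ _ _ mX')).
pose Y' : {mfun T >-> measurableTypeR R} :=
  MeasurableFun.Pack (MeasurableFun.Class (isMeasurableFun.Build _ _ _ _ _ mY')).
pose D := add_preimage A.
have mD : measurable D by exact: measurable_addP.
have xsE (x : R) : xsection D x = (fun y => x + y) @^-1` A by exact: xsection_addE.
have -> : P ((fun w => X w + Y w) @^-1` A) =
    (\int[distribution P X']_x distribution P Y' (xsection D x))%E.
  by rewrite -[LHS]/(P ((fun w => (X' w, Y' w)) @^-1` D)) indep_prodE.
have mxs : measurable_fun setT (fun x => distribution P Y' (xsection D x)).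
  exact: measurable_fun_xsection.
(* A summand of variance 0 has a Dirac law and no density, so both degenerate cases are settled
   before the convolution. *)
have [v20'|v2N0] := eqVneq v2 0.
  have lY0 B : measurable B -> P (Y @^-1` B) = \d_(0 : R) B.
    by move=> mB; rewrite lY// /normal_law v20' eqxx.
  rewrite v20' addr0 -lX//.
  transitivity (\int[distribution P X']_x (\1_A x)%:E)%E.
    apply: eq_integral => x _; rewrite xsE [LHS]lY0.
      by rewrite diracE /= indicE; congr ((nat_of_bool _)%:R%:E); apply/idP/idP; rewrite !inE /= addr0.
    by rewrite -xsE; exact: measurable_xsection.
  by rewrite integral_indic// setIT.
have [v10'|v1N0] := eqVneq v1 0.
  have lX0 B : measurable B -> P (X @^-1` B) = \d_(0 : R) B.
    by move=> mB; rewrite lX// /normal_law v10' eqxx.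
  rewrite v10' add0r -lY//.
  pose z0 : measurableTypeR R := (0 : R).
  transitivity (\int[\d_z0]_x distribution P Y' (xsection D x))%E.
    by apply: eq_measure_integral => B mB _; exact: lX0.
  rewrite integral_dirac// diracT mul1e xsE; congr (P _).
  by apply/seteqP; split => w /=; rewrite add0r.
have v1p : 0 < v1 by rewrite lt_def v1N0.
have v2p : 0 < v2 by rewrite lt_def v2N0.
rewrite /normal_law gt_eqF ?addr_gt0//.
have := @normal_prob_convolution (Num.sqrt v1) (Num.sqrt v2) A.
rewrite !sqrtr_gt0 !sqr_sqrtr// => /(_ v1p v2p mA) <-.
transitivity (\int[normal_prob 0 (Num.sqrt v1)]_x distribution P Y' (xsection D x))%E.
  apply: eq_measure_integral => B mB _.
  by rewrite -[LHS]/(P (X @^-1` B)) lX// /normal_law (negbTE v1N0).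
apply: eq_integral => x _; rewrite -[LHS]/(P (Y @^-1` (xsection D x))) lY.
  by rewrite /normal_law (negbTE v2N0) xsE.
exact: measurable_xsection.
Qed.

End normal_convolution.

(** * Gaussian transforms and Gaussian vectors *)

Section gaussian_vectors.
Context {R : realType}.

(** The characteristic function of the standard normal law, which is real by symmetry. *)
Definition gauss_cos (s : R) : R := Ex (@N01 R) (fun x => cos (s * x)).

Lemma measurable_sinM (s : R) : measurable_fun setT (fun x : R => sin (s * x)).
Proof.
apply: (@measurableT_comp _ _ _ _ _ _ (@sin R)).
  exact: continuous_measurable_fun (@continuous_sin R).
exact: measurable_funM.
Qed.

Lemma integ_cos d (T : measurableType d) (P : probability T R) (X : T -> R) :
  measurable_fun setT X -> integ P (fun w => cos (X w)).
Proof.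
move=> mX; apply: (@integ_bounded _ _ _ _ _ 1); last by move=> w; exact: cos_max.
by apply: measurableT_comp => //; exact: continuous_measurable_fun (@continuous_cos R).
Qed.

Lemma integ_sin d (T : measurableType d) (P : probability T R) (X : T -> R) :
  measurable_fun setT X -> integ P (fun w => sin (X w)).
Proof.
move=> mX; apply: (@integ_bounded _ _ _ _ _ 1); last by move=> w; exact: sin_max.
by apply: measurableT_comp => //; exact: continuous_measurable_fun (@continuous_sin R).
Qed.

Lemma Ex_cos_add d (T : measurableType d) (P : probability T R) (X Y : T -> R) :
  measurable_fun setT X -> measurable_fun setT Y -> indep P X Y ->
  Ex P (fun w => cos (X w + Y w)) =
  Ex P (fun w => cos (X w)) * Ex P (fun w => cos (Y w)) -
  Ex P (fun w => sin (X w)) * Ex P (fun w => sin (Y w)).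
Proof.
move=> mX mY XY.
have mc : measurable_fun setT (@cos R) by exact: continuous_measurable_fun (@continuous_cos R).
have ms : measurable_fun setT (@sin R) by exact: continuous_measurable_fun (@continuous_sin R).
have [i1 e1] := indep_integM mX mY mc mc XY (integ_cos P mX) (integ_cos P mY).
have [i2 e2] := indep_integM mX mY ms ms XY (integ_sin P mX) (integ_sin P mY).
rewrite -e1 -e2 -ExB//; congr (Ex P _); apply/funext => w; exact: cosD.
Qed.

Lemma Ex_sin_add d (T : measurableType d) (P : probability T R) (X Y : T -> R) :
  measurable_fun setT X -> measurable_fun setT Y -> indep P X Y ->
  Ex P (fun w => sin (X w + Y w)) =
  Ex P (fun w => sin (X w)) * Ex P (fun w => cos (Y w)) +
  Ex P (fun w => cos (X w)) * Ex P (fun w => sin (Y w)).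
Proof.
move=> mX mY XY.
have mc : measurable_fun setT (@cos R) by exact: continuous_measurable_fun (@continuous_cos R).
have ms : measurable_fun setT (@sin R) by exact: continuous_measurable_fun (@continuous_sin R).
have [i1 e1] := indep_integM mX mY ms mc XY (integ_sin P mX) (integ_cos P mY).
have [i2 e2] := indep_integM mX mY mc ms XY (integ_cos P mX) (integ_sin P mY).
rewrite -e1 -e2 -ExD//; congr (Ex P _); apply/funext => w; exact: sinD.
Qed.

Lemma gauss_sin0 (s : R) : Ex (@N01 R) (fun x => sin (s * x)) = 0.
Proof.
apply: normal_odd; first exact: measurable_sinM.
  by move=> x; rewrite mulrN sinN.
exact: (@integ_sin _ _ _ (fun x : measurableTypeR R => s * x) (measurable_funM _ _)).
Qed.

Lemma gauss_cosE d (T : measurableType d) (P : probability T R) (X : T -> R) (v : R) :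
  0 <= v -> measurable_fun setT X ->
  (forall B, measurable B -> P (X @^-1` B) = normal_law 0 v B) ->
  Ex P (fun w => cos (X w)) = gauss_cos (Num.sqrt v) /\ Ex P (fun w => sin (X w)) = 0.
Proof.
move=> v0 mX lX.
have mc : measurable_fun setT (@cos R) by exact: continuous_measurable_fun (@continuous_cos R).
have ms : measurable_fun setT (@sin R) by exact: continuous_measurable_fun (@continuous_sin R).
pose Y : measurableTypeR R -> R := fun x => Num.sqrt v * x.
have mY : measurable_fun setT Y by exact: measurable_funM.
have law B : measurable B -> P (X @^-1` B) = N01 (Y @^-1` B).
  by move=> mB; rewrite normal_law_scale// sqr_sqrtr// lX.
split.
- by have [_] := Ex_eq_law mX mY mc law (integ_cos _ mY).
- have [_] := Ex_eq_law mX mY ms law (integ_sin _ mY).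
  by move=> ->; exact: gauss_sin0.
Qed.

Lemma prod_fst d1 d2 (T1 : measurableType d1) (T2 : measurableType d2)
    (P1 : probability T1 R) (P2 : probability T2 R) (A : set T1) : measurable A ->
  (P1 \x P2)%E (fst @^-1` A) = P1 A.
Proof.
move=> mA; have -> : fst @^-1` A = A `*` [set: T2] by apply/seteqP; split => z //= [].
rewrite product_measure1E// -[RHS]mule1; congr (_ * _)%E; exact: probability_setT.
Qed.

Lemma prod_snd d1 d2 (T1 : measurableType d1) (T2 : measurableType d2)
    (P1 : probability T1 R) (P2 : probability T2 R) (A : set T2) : measurable A ->
  (P1 \x P2)%E (snd @^-1` A) = P2 A.
Proof.
move=> mA; have -> : snd @^-1` A = [set: T1] `*` A by apply/seteqP; split => z //= [].
rewrite product_measure1E// -[RHS]mul1e; congr (_ * _)%E; exact: probability_setT.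
Qed.

Lemma indep_fst_snd d1 d2 (T1 : measurableType d1) (T2 : measurableType d2)
    (P1 : probability T1 R) (P2 : probability T2 R) (F : T1 -> R) (G : T2 -> R) :
  measurable_fun setT F -> measurable_fun setT G ->
  indep (P1 \x P2)%E (fun z => F z.1) (fun z => G z.2).
Proof.
move=> mF mG A B mA mB.
have mFA : measurable (F @^-1` A) by rewrite -[X in measurable X]setTI; exact: mF.
have mGB : measurable (G @^-1` B) by rewrite -[X in measurable X]setTI; exact: mG.
have e1 := prod_fst P1 P2 mFA; have e2 := prod_snd P1 P2 mGB.
transitivity (P1 (F @^-1` A) * P2 (G @^-1` B))%E.
  exact: (@product_measure1E _ _ _ _ _ P1 P2 _ _ mFA mGB).
by rewrite -e1 -e2.
Qed.

(** For independent standard normal X and Y on a product space, sX + tY is normal of variance s^2 +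
    t^2, and the sine terms of the addition formula vanish. *)
Lemma gauss_cosM (s t : R) :
  gauss_cos s * gauss_cos t = gauss_cos (Num.sqrt (s ^+ 2 + t ^+ 2)).
Proof.
pose Q : probability _ R := (@N01 R \x @N01 R)%E.
pose X : measurableTypeR R * measurableTypeR R -> R := fun z => s * z.1.
pose Y : measurableTypeR R * measurableTypeR R -> R := fun z => t * z.2.
have mX : measurable_fun setT X by apply: measurable_funM => //; exact: measurable_fst.
have mY : measurable_fun setT Y by apply: measurable_funM => //; exact: measurable_snd.
have ms c : measurable_fun setT (fun x : measurableTypeR R => c * x : R).
  exact: measurable_funM.
have lX B : measurable B -> Q (X @^-1` B) = normal_law 0 (s ^+ 2) B.
  move=> mB; rewrite -normal_law_scale//.
  rewrite -(@prod_fst _ _ _ _ (@N01 R) (@N01 R))//.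
  by rewrite -[X in measurable X]setTI; exact: ms.
have lY B : measurable B -> Q (Y @^-1` B) = normal_law 0 (t ^+ 2) B.
  move=> mB; rewrite -normal_law_scale//.
  rewrite -(@prod_snd _ _ _ _ (@N01 R) (@N01 R))//.
  by rewrite -[X in measurable X]setTI; exact: ms.
have XY : indep Q X Y by exact: (@indep_fst_snd _ _ _ _ (@N01 R) (@N01 R) _ _ (ms s) (ms t)).
have mXY : measurable_fun setT (fun w => X w + Y w) by exact: measurable_funD.
have [<- _] := gauss_cosE (addr_ge0 (sqr_ge0 s) (sqr_ge0 t)) mXY
  (fun B mB => normal_law_add mX mY XY (sqr_ge0 s) (sqr_ge0 t) lX lY mB).
rewrite Ex_cos_add//.
have [-> ->] := gauss_cosE (sqr_ge0 s) mX lX.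
have [-> ->] := gauss_cosE (sqr_ge0 t) mY lY.
have sgn u : gauss_cos (Num.sqrt (u ^+ 2)) = gauss_cos u.
  rewrite sqrtr_sqr /gauss_cos; congr (Ex _ _); apply/funext => x.
  have [u0|u0] := leP 0 u; first by rewrite ger0_norm.
  by rewrite ltr0_norm// mulNr cosN.
by rewrite !sgn mulr0 subr0.
Qed.

(** By induction on the columns of [B]: a further column b adds Z b, with Z standard normal on a new
    factor of the probability space, and b b' to the covariance. *)
Lemma exists_normal_vector n m (B : 'M[R]_(m, n)) :
  exists (d' : measure_display) (Omega' : measurableType d')
    (Q : probability Omega' R) (N : Omega' -> 'cV[R]_m),
    normal_vector Q N 0 (B *m B^T).
Proof.
elim: n B => [|n IHn] B.
  exists _, (measurableTypeR R), (@N01 R), (fun=> 0); split.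
    by move=> j; under eq_fun do rewrite mxE; exact: measurable_cst.
  move=> a A mA; rewrite thinmx0 mul0mx mul0mx.
  have dot0 : dotv a 0 = 0 by rewrite /dotv mulmx0 mxE.
  rewrite dot0 /normal_law eqxx diracE.
  have [A0|A0] := boolP (0 \in A).
    rewrite (_ : [set _ | _] = setT) ?probability_setT//.
    by apply/seteqP; split => // w _ /=; exact/set_mem.
  rewrite (_ : [set _ | _] = set0) ?measure0//.
  by apply/seteqP; split => // w /= h; move: A0; rewrite mem_set.
have [b [B' ->]] : exists (b : 'cV[R]_m) (B' : 'M[R]_(m, n)), B = row_mx b B'.
  by exists (lsubmx (B : 'M[R]_(m, 1 + n))), (rsubmx (B : 'M[R]_(m, 1 + n))); rewrite hsubmxK.
have [d' [T [Q [N [mN lN]]]]] := IHn B'.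
pose Q' : probability _ R := (@N01 R \x Q)%E.
pose N' : measurableTypeR R * T -> 'cV[R]_m := fun z => (z.1 : R) *: b + N z.2.
exists _, (measurableTypeR R * T)%type, Q', N'; split.
  move=> j; rewrite /N'; under eq_fun do rewrite !mxE.
  apply: measurable_funD; first by apply: measurable_funM => //; exact: measurable_fst.
  exact: (measurableT_comp (mN j) (@measurable_snd _ _ _ _)).
move=> a A mA.
have dotD u v : dotv a (u + v) = dotv a u + dotv a v by rewrite /dotv mulmxDr mxE.
have dotZ c v : dotv a (c *: v) = c * dotv a v by rewrite /dotv -scalemxAr mxE.
have dotE v : dotv a v = \sum_j a j 0 * v j 0.
  by rewrite /dotv mxE; apply: eq_bigr => j _; rewrite mxE.
pose X : measurableTypeR R * T -> R := fun z => dotv a b * z.1.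
pose Y : measurableTypeR R * T -> R := fun z => dotv a (N z.2).
have mdN : measurable_fun setT (fun w => dotv a (N w)).
  under eq_fun do rewrite dotE.
  by apply: measurable_sum => j; apply: measurable_funM => //; exact: mN.
have ms : measurable_fun setT (fun x : measurableTypeR R => dotv a b * x : R).
  exact: measurable_funM.
have mX : measurable_fun setT X by apply: measurable_funM => //; exact: measurable_fst.
have mY : measurable_fun setT Y by exact: (measurableT_comp mdN (@measurable_snd _ _ (measurableTypeR R) T)).
have dotv0 : dotv a (0 : 'cV[R]_m) = 0 by rewrite /dotv mulmx0 mxE.
have v2E : dotv a (B' *m B'^T *m a) = dotv (B'^T *m a) (B'^T *m a).
  by rewrite /dotv trmx_mul trmxK !mulmxA.
have v20 : 0 <= dotv a (B' *m B'^T *m a).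
  rewrite v2E /dotv mxE; apply: sumr_ge0 => i _; rewrite [X in X * _]mxE -expr2; exact: sqr_ge0.
have lX D : measurable D -> Q' (X @^-1` D) = normal_law 0 (dotv a b ^+ 2) D.
  move=> mD; rewrite -normal_law_scale//.
  rewrite -(@prod_fst _ _ _ _ (@N01 R) Q)//.
  by rewrite -[X in measurable X]setTI; exact: ms.
have lY D : measurable D -> Q' (Y @^-1` D) = normal_law 0 (dotv a (B' *m B'^T *m a)) D.
  move=> mD; rewrite -[X in normal_law X]dotv0 -lN//.
  rewrite -(@prod_snd _ _ _ _ (@N01 R) Q)//.
  by rewrite -[X in measurable X]setTI; exact: mdN.
have XY : indep Q' X Y by exact: (@indep_fst_snd _ _ _ _ (@N01 R) Q _ _ ms mdN).
have -> : [set w | A (dotv a (N' w))] = (fun w => X w + Y w) @^-1` A.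
  by apply/seteqP; split => w /=; rewrite dotD dotZ mulrC.
rewrite (normal_law_add mX mY XY (sqr_ge0 _) v20 lX lY mA) dotv0; congr (normal_law _ _ _).
have -> : row_mx b B' *m (row_mx b B')^T = b *m b^T + B' *m B'^T :> 'M[R]_m.
  exact: (etrans (congr1 (mulmx _) (@tr_row_mx R m 1 n b B')) (@mul_row_col R m 1 n m b B' _ _)).
rewrite mulmxDl dotD; congr (_ + _).
have sc (M : 'M[R]_1) : M = (M 0 0)%:M by rewrite [LHS]mx11_scalar.
have ba : (b^T *m a) 0 0 = dotv a b.
  by rewrite /dotv !mxE; apply: eq_bigr => j _; rewrite !mxE mulrC.
by rewrite -mulmxA [b^T *m a]sc ba mul_mx_scalar dotZ expr2.
Qed.

End gaussian_vectors.

(** * Central limit theorem for weighted sums *)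

Section trigonometric_expansion.
Context {R : realType}.
Implicit Types x y : R.

(** The mean value theorem gains one power of |y|; iterated, it gives the Taylor bounds for sine and
    cosine, with 1 in place of the factorials. *)
Lemma derive_bound (f f' : R -> R) (K : R) n (y : R) : f 0 = 0 ->
  (forall x, is_derive x (1 : R) f (f' x)) ->
  (forall x, `|f' x| <= K * `|x| ^+ n) -> `|f y| <= K * `|y| ^+ n.+1.
Proof.
move=> f0 df f'b.
have K0 : 0 <= K by have := f'b 1; rewrite normr1 expr1n mulr1; apply: le_trans.
have cf a b : {within `[a, b], continuous f}.
  by apply: derivable_within_continuous => x _; apply: (@ex_derive _ _ _ _ _ _ _ (df x)).
have goal c : `|c| <= `|y| -> `|f y - f 0| = `|f' c| * `|y| -> `|f y| <= K * `|y| ^+ n.+1.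
  move=> cy; rewrite f0 subr0 => ->; rewrite exprSr mulrA ler_wpM2r//.
  by rewrite (le_trans (f'b c))// ler_wpM2l// lerXn2r ?nnegrE.
have [y0|y0|->] := ltgtP y 0; last by rewrite f0 normr0 expr0n mulr0.
- have [|c] := @MVT _ f f' y 0 y0; first exact: cf.
  rewrite in_itv/= => /andP[c1 c2] e; apply: (goal c).
    by rewrite !ltr0_norm// lerN2 ltW.
  by rewrite distrC e normrM sub0r normrN.
- have [|c] := @MVT _ f f' 0 y y0; first exact: cf.
  rewrite in_itv/= => /andP[c1 c2] e; apply: (goal c).
    by rewrite !gtr0_norm// ltW.
  by rewrite e normrM subr0.
Qed.

Lemma norm_sin_le y : `|sin y| <= `|y|.
Proof.
have := @derive_bound (@sin R) (@cos R) 1 0 y (@sin0 R).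
rewrite mul1r expr1; apply.
by move=> x; rewrite expr0 mulr1 cos_max.
Qed.

Lemma norm_cosB1_le y : `|cos y - 1| <= `|y| ^+ 2.
Proof.
have := @derive_bound (fun y => cos y - 1) (fun y => - sin y) 1 1 y.
rewrite mul1r; apply; first by rewrite cos0 subrr.
  by move=> x; apply: is_derive_eq; rewrite /GRing.scale/= ?mulr1 ?subr0 ?oppr0 ?addr0.
by move=> x; rewrite mul1r expr1 normrN norm_sin_le.
Qed.

Lemma norm_sinBid_le y : `|sin y - y| <= `|y| ^+ 3.
Proof.
have := @derive_bound (fun y => sin y - y) (fun y => cos y - 1) 1 2 y.
rewrite mul1r; apply; first by rewrite sin0 subrr.
by move=> x; rewrite mul1r norm_cosB1_le.
Qed.

Lemma norm_cos_taylor y : `|cos y - 1 + 2^-1 * y ^+ 2| <= `|y| ^+ 4.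
Proof.
have := @derive_bound (fun y => cos y - 1 + 2^-1 * y ^+ 2) (fun y => - (sin y - y)) 1 3 y.
rewrite mul1r; apply; first by rewrite cos0 subrr expr0n mulr0 addr0.
  by move=> x; apply: is_derive_eq; rewrite /GRing.scale/=; field.
by move=> x; rewrite mul1r normrN norm_sinBid_le.
Qed.

Lemma cos_lipschitz x y : `|cos x - cos y| <= `|x - y|.
Proof.
have := @derive_bound (fun z => cos (y + z) - cos y) (fun z => - sin (y + z)) 1 0 (x - y).
rewrite mul1r expr1 (addrC y (x - y)) subrK; apply; first by rewrite addr0 subrr.
  move=> z.
  have d2 : is_derive z (1 : R) (fun z : R => cos (y + z)) (- sin (y + z) * (0 + 1)).
    apply: (@is_derive1_comp _ (@cos R) (fun z : R => y + z)).
  by apply: is_derive_eq; rewrite add0r mulr1 subr0.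
by move=> z; rewrite expr0 mulr1 normrN sin_max.
Qed.

(** The cubic bound for small y and a quadratic one for large y, merged into the form that
    [Ex_min_small] accepts when only a second moment is available. *)
Lemma sin_expansion y : `|sin y - y| <= 2 * (y ^+ 2 * Num.min 1 `|y|).
Proof.
have y2 : y ^+ 2 = `|y| ^+ 2 by rewrite real_normK ?num_real.
rewrite y2; have := normr_ge0 y; have [y1|y1] := leP `|y| 1 => y0.
  rewrite (le_trans (norm_sinBid_le y))// -exprSr.
  by rewrite ler_peMl// ?exprn_ge0// ler1n.
rewrite mulr1 (le_trans (ler_normB _ _))//.
have := norm_sin_le y; nra.
Qed.

Lemma cos_expansion y :
  `|cos y - 1 + 2^-1 * y ^+ 2| <= 2 * (y ^+ 2 * Num.min 1 `|y|).
Proof.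
have y2 : y ^+ 2 = `|y| ^+ 2 by rewrite real_normK ?num_real.
have := normr_ge0 y; have [y1|y1] := leP `|y| 1 => y0.
  rewrite (le_trans (norm_cos_taylor y))// y2 -exprSr.
  apply: (@le_trans _ _ (`|y| ^+ 3)).
    by rewrite exprSr ler_piMr// exprn_ge0.
  by rewrite ler_peMl// ?exprn_ge0// ler1n.
rewrite mulr1 (le_trans (ler_normD _ _))//.
have := norm_cosB1_le y; rewrite y2 normrM [`|2^-1|]ger0_norm// normrX normr_id.
by have := sqr_ge0 `|y|; lra.
Qed.

(** The remainder c^2 X^2 min(1, |c X|) is o(c^2) in mean with two moments only. It is applied to
    the score and to a Gaussian of the same variance. *)
Lemma Ex_trig_expansion d (T : measurableType d) (P : probability T R) (X : T -> R) (e : R) :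
  measurable_fun setT X -> integ P (fun w => X w ^+ 2) -> Ex P X = 0 -> 0 < e ->
  exists2 delta, 0 < delta & forall c, `|c| <= delta ->
    `|Ex P (fun w => cos (c * X w)) - 1 + 2^-1 * c ^+ 2 * Ex P (fun w => X w ^+ 2)|
      <= e * c ^+ 2 /\
    `|Ex P (fun w => sin (c * X w))| <= e * c ^+ 2.
Proof.
move=> mX iX2 EX0 e0.
have mXn : measurable_fun setT (fun w => `|X w|) by exact: measurableT_comp.
have iX : integ P X.
  apply: (@integ_le _ _ _ _ _ (fun w => 1 + X w ^+ 2)) => //.
    by move=> w; rewrite ler_norml; nra.
  by apply: integD => //; exact: integ_cst.
have [delta delta0 hd] := Ex_min_small iX2 (fun w => sqr_ge0 (X w)) mXn
  (fun w => normr_ge0 (X w)) (divr_gt0 e0 (ltr0n _ 2)).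
exists delta => // c cd.
have mcX : measurable_fun setT (fun w => c * X w) by exact: measurable_funM.
have icos := integ_cos P mcX; have isin := integ_sin P mcX.
pose g w := X w ^+ 2 * Num.min 1 (`|c| * `|X w|).
have ig : integ P g.
  apply: (integ_le _ _ iX2).
    apply: measurable_funM; first exact: measurable_funX.
    by apply: measurable_minr => //; exact: measurable_funM.
  move=> w; rewrite ger0_norm ?ler_piMr ?sqr_ge0 ?ge_min ?lexx//.
  by rewrite mulr_ge0 ?sqr_ge0// le_min ler01 mulr_ge0.
have Eg : 2 * c ^+ 2 * Ex P g <= e * c ^+ 2.
  have := hd `|c|; rewrite normr_ge0 => /(_ cd); rewrite -/(Ex P g) => h.
  have := sqr_ge0 c; nra.
have pt (F : T -> R) : integ P F -> (forall w, `|F w| <= 2 * c ^+ 2 * g w) ->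
    `|Ex P F| <= e * c ^+ 2.
  move=> iF Fg; apply: le_trans Eg; rewrite -ExZ//.
  apply: (le_trans (Ex_norm_le iF)); apply: Ex_le => //; first exact: integ_norm.
  exact: integZ.
have cg w : 2 * ((c * X w) ^+ 2 * Num.min 1 `|c * X w|) = 2 * c ^+ 2 * g w.
  by rewrite /g normrM exprMn !mulrA.
split.
- have -> : Ex P (fun w => cos (c * X w)) - 1 + 2^-1 * c ^+ 2 * Ex P (fun w => X w ^+ 2) =
      Ex P (fun w => cos (c * X w) - 1 + 2^-1 * c ^+ 2 * X w ^+ 2).
    rewrite ExD ?ExB ?Ex_cst ?ExZ//; [exact: integ_cst|apply: integB => //; exact: integ_cst|].
    exact: integZ.
  apply: pt; last first.
    by move=> w; rewrite -cg -mulrA -exprMn cos_expansion.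
  by apply: integD; [apply: integB => //; exact: integ_cst|exact: integZ].
- have -> : Ex P (fun w => sin (c * X w)) = Ex P (fun w => sin (c * X w) - c * X w).
    by rewrite ExB ?ExZ ?EX0 ?mulr0 ?subr0//; exact: integZ.
  apply: pt; last by move=> w; rewrite -cg sin_expansion.
  by apply: integB => //; exact: integZ.
Qed.

End trigonometric_expansion.

Section scalar_clt.
Context {R : realType}.

Lemma gauss_cos_lipschitz (s t : R) :
  `|gauss_cos s - gauss_cos t| <= `|s - t| * Ex (@N01 R) (fun x : measurableTypeR R => `|x : R|).
Proof.
have mM (c : R) : measurable_fun setT (fun x : measurableTypeR R => c * x : R).
  exact: measurable_funM.
have ic c := @integ_cos _ _ _ (@N01 R) _ (mM c).
have [i2 _] := @normal_second_moment R.
have i1 : integ (@N01 R) (fun x : measurableTypeR R => `|x : R|).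
  apply: (@integ_le _ _ _ _ _ (fun x : measurableTypeR R => 1 + (x : R) ^+ 2)).
  - exact: measurableT_comp.
  - by move=> x; rewrite normr_id ler_norml; have := sqr_ge0 (x : R); nra.
  - by apply: integD => //; exact: integ_cst.
rewrite /gauss_cos -ExB// -ExZ//.
apply: (le_trans (Ex_norm_le (integB (ic s) (ic t)))).
apply: Ex_le; [exact/integ_norm/integB|exact: integZ|].
by move=> x; rewrite (le_trans (cos_lipschitz _ _))// -mulrBl normrM.
Qed.

Lemma continuous_gauss_cos : continuous (@gauss_cos R).
Proof.
move=> s; apply/cvgrPdist_le => /= e e0.
set K := Ex (@N01 R) (fun x : measurableTypeR R => `|x : R|).
have K0 : 0 <= K by exact: Ex_ge0.
near=> t.
apply: (le_trans (gauss_cos_lipschitz s t)); rewrite -/K.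
apply: (@le_trans _ _ (`|s - t| * (K + 1))); first by rewrite ler_wpM2l// lerDl.
rewrite -ler_pdivlMr; last by rewrite ltr_wpDl.
near: t; exists (e / (K + 1)) => /=; first by rewrite divr_gt0// ltr_wpDl.
by move=> t /= /ltW.
Unshelve. all: by end_near. Qed.

Lemma indep_comp d (T : measurableType d) (P : probability T R) (X Y : T -> R) (g : R -> R) :
  measurable_fun setT g -> indep P X Y -> indep P X (g \o Y).
Proof.
move=> mg XY A B mA mB; apply: (XY A (g @^-1` B) mA).
by rewrite -[X in measurable X]setTI; exact: mg.
Qed.

Context d (T : measurableType d) (P : probability T R).
Variables (eps : nat -> {RV P >-> R}) (h : R -> R).
Hypothesis eps_indep : mutually_independent eps.
Hypothesis mh : measurable_fun setT h.

(* The pair (E cos S, E sin S) is the characteristic function of S; it is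
   multiplied by the factors of the summands, just as the Gaussian one is. *)
Lemma trig_sum_bound (sigma : R) (c : nat -> R) n :
  let S w := \sum_(i < n) c i * h (eps i w) in
  `|Ex P (fun w => cos (S w)) - gauss_cos (sigma * Num.sqrt (\sum_(i < n) c i ^+ 2))| +
  `|Ex P (fun w => sin (S w))| <=
  2 * \sum_(i < n) (`|Ex P (fun w => cos (c i * h (eps i w))) - gauss_cos (sigma * c i)| +
                `|Ex P (fun w => sin (c i * h (eps i w)))|).
Proof.
elim: n => [|n IHn] /=.
  under eq_fun do rewrite big_ord0 cos0.
  under [X in _ + `|Ex P X|]eq_fun do rewrite big_ord0 sin0.
  rewrite !big_ord0 !Ex_cst sqrtr0 mulr0 /gauss_cos.
  under eq_fun do rewrite mul0r cos0.
  by rewrite Ex_cst subrr normr0 mulr0 addr0.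
set S := fun w => \sum_(i < n) c i * h (eps i w).
pose A w := c n * h (eps n w).
have mA : measurable_fun setT A.
  by apply: measurable_funM => //; exact: measurableT_comp.
have mS : measurable_fun setT S.
  by apply: measurable_sum => i; apply: measurable_funM => //; exact: measurableT_comp.
have SA : indep P S A.
  apply: (@indep_comp _ _ P S (eps n) (fun x => c n * h x)); first exact: measurable_funM.
  by apply: (@indep_sum _ _ _ P eps eps_indep n (fun i x => c i * h x)) => i; exact: measurable_funM.
under eq_fun do rewrite big_ord_recr.
under [X in _ + `|Ex P X|]eq_fun do rewrite big_ord_recr.
rewrite Ex_cos_add// Ex_sin_add// !big_ord_recr /=.
have -> : gauss_cos (sigma * Num.sqrt (\sum_(i < n) c i ^+ 2 + c n ^+ 2)) =
    gauss_cos (sigma * Num.sqrt (\sum_(i < n) c i ^+ 2)) * gauss_cos (sigma * c n).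
  rewrite gauss_cosM !exprMn sqr_sqrtr; last by apply: sumr_ge0 => i _; exact: sqr_ge0.
  rewrite -mulrDr sqrtrM ?sqr_ge0// sqrtr_sqr.
  have [s0|s0] := leP 0 sigma; first by rewrite ger0_norm.
  rewrite ltr0_norm// /gauss_cos; congr (Ex _ _); apply/funext => x.
  by rewrite -[LHS]cosN !mulNr.
move: IHn; rewrite /= -/(S _); set G := gauss_cos (sigma * Num.sqrt _).
have -> : Ex P (fun w => cos (\sum_(i < n) c i * h (eps i w))) = Ex P (fun w => cos (S w)) by [].
set C := Ex P (fun w => cos (S w)); set D := Ex P (fun w => sin (S w)).
rewrite -/A; set a := Ex P (fun w => cos (A w)); set b := Ex P (fun w => sin (A w)).
set g := gauss_cos (sigma * c n); set r := \sum_(i < n) _.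
have bd (F : T -> R) : measurable_fun setT F -> (forall w, `|F w| <= 1) -> `|Ex P F| <= 1.
  move=> mF F1; have iF := integ_bounded P mF F1.
  rewrite -[leRHS](Ex_cst P 1) (le_trans (Ex_norm_le iF))// Ex_le//; last exact: integ_cst.
  exact: integ_norm.
have mcosS := integ_measurable (integ_cos P mS).
have msinS := integ_measurable (integ_sin P mS).
have C1 : `|C| <= 1 by apply: bd => // w; exact: cos_max.
have D1 : `|D| <= 1 by apply: bd => // w; exact: sin_max.
have g1 : `|g| <= 1.
  have mg : measurable_fun setT (fun x : measurableTypeR R => sigma * c n * x : R).
    exact: measurable_funM.
  have ig := integ_cos (@N01 R) mg.
  rewrite -[leRHS](Ex_cst (@N01 R) 1) (le_trans (Ex_norm_le ig))// Ex_le//.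
  - exact: integ_norm.
  - exact: integ_cst.
  - by move=> x; exact: cos_max.
move=> IHn.
have e1 : C * a - D * b - G * g = (C - G) * g + C * (a - g) - D * b by ring.
have e2 : D * a + C * b = D * g + D * (a - g) + C * b by ring.
rewrite e1 e2.
have t1 : `|(C - G) * g + C * (a - g) - D * b| <= `|C - G| + `|a - g| + `|b|.
  apply: (le_trans (ler_normB _ _)); rewrite lerD//; last first.
    by rewrite normrM ler_piMl.
  by apply: (le_trans (ler_normD _ _)); rewrite !normrM lerD// ?ler_piMr ?ler_piMl.
have t2 : `|D * g + D * (a - g) + C * b| <= `|D| + `|a - g| + `|b|.
  apply: (le_trans (ler_normD _ _)); rewrite lerD//; last first.
    by rewrite normrM ler_piMl.
  by apply: (le_trans (ler_normD _ _)); rewrite !normrM lerD// ?ler_piMr ?ler_piMl.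
move: t1 t2 IHn; lra.
Qed.

Variable e : {RV P >-> R}.
Hypothesis eps_id : identically_distributed eps e.
Hypothesis ih2 : integ P (fun w => h (e w) ^+ 2).
Hypothesis Eh0 : Ex P (fun w => h (e w)) = 0.

(** Each summand and its Gaussian counterpart share their first two moments, so their transforms
    differ by a small multiple of the squared weight; these errors add up to a small multiple of the
    convergent sum of squares. Uniform smallness of the weights plays the part of Lindeberg's
    condition. *)
Theorem trig_clt (c : nat -> nat -> R) (v : R) :
  \sum_(t < n) c n t ^+ 2 @[n --> \oo] --> v ->
  (forall delta, 0 < delta ->
    \forall n \near \oo, forall t, (t < n)%N -> `|c n t| <= delta) ->
  let S n w := \sum_(t < n) c n t * h (eps t w) in
  let sigma := Num.sqrt (Ex P (fun w => h (e w) ^+ 2)) in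
  Ex P (fun w => cos (S n w)) @[n --> \oo] --> gauss_cos (sigma * Num.sqrt v) /\
  Ex P (fun w => sin (S n w)) @[n --> \oo] --> (0 : R).
Proof.
move=> cv cmax S sigma; set s2 := Ex P (fun w => h (e w) ^+ 2) in sigma *.
have s20 : 0 <= s2 by apply: Ex_ge0 => w; exact: sqr_ge0.
have sig2 : sigma ^+ 2 = s2 by rewrite sqr_sqrtr.
have law i (g : R -> R) : measurable_fun setT g -> integ P (fun w => g (e w)) ->
    Ex P (fun w => g (eps i w)) = Ex P (fun w => g (e w)).
  move=> mg ig.
  by have [_] := @Ex_eq_law _ _ _ _ _ _ _ P P (eps i) e g (@measurable_funPT _ _ _ _ _)
    (@measurable_funPT _ _ _ _ _) mg (eps_id i) ig.
have mhe : measurable_fun setT (fun w => h (e w)) by exact: measurableT_comp.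
pose X (x : measurableTypeR R) : R := sigma * x.
have [i2 E2] := @normal_second_moment R.
have X2E : (fun x => X x ^+ 2) = (fun x : measurableTypeR R => s2 * (x : R) ^+ 2).
  by apply/funext => x; rewrite /X exprMn sig2.
have mX : measurable_fun setT X by exact: measurable_funM.
have iX2 : integ (@N01 R) (fun x => X x ^+ 2) by rewrite X2E; exact: integZ.
have EX2 : Ex (@N01 R) (fun x => X x ^+ 2) = s2 by rewrite X2E ExZ// E2 mulr1.
have EX : Ex (@N01 R) X = 0.
  apply: normal_odd => //; first by move=> x; rewrite /X mulrN.
  apply: (@integ_le _ _ _ _ _ (fun x => 1 + X x ^+ 2)) => //.
    by move=> x; rewrite ler_norml; have := sqr_ge0 (X x); nra.
  by apply: integD => //; exact: integ_cst.
have key (e0 : R) : 0 < e0 -> \forall n \near \oo,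
    `|Ex P (fun w => cos (S n w)) - gauss_cos (sigma * Num.sqrt (\sum_(t < n) c n t ^+ 2))| +
    `|Ex P (fun w => sin (S n w))| <= e0.
  move=> e00; have v1 : 0 < `|v| + 1 by rewrite ltr_wpDl.
  (* The 6 is the 2 of [trig_sum_bound] times 3 errors per summand: two from cosines and one from a
     sine. *)
  pose e1 := e0 / (6 * (`|v| + 1)).
  have e10 : 0 < e1 by rewrite divr_gt0// mulr_gt0.
  have [d1 d10 h1] := Ex_trig_expansion mhe ih2 Eh0 e10.
  have [d2 d20 h2] := Ex_trig_expansion mX iX2 EX e10.
  have d0 : 0 < Num.min d1 d2 by rewrite lt_min d10.
  near=> n.
  have cn : forall t, (t < n)%N -> `|c n t| <= Num.min d1 d2 by near: n; exact: cmax.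
  have sn : \sum_(t < n) c n t ^+ 2 <= `|v| + 1.
    have : `|v - \sum_(t < n) c n t ^+ 2| <= 1.
      by near: n; move/cvgrPdist_le: cv; apply.
    by rewrite ler_norml => /andP[+ _]; have := ler_norm v; lra.
  apply: (le_trans (trig_sum_bound sigma (c n) n)).
  apply: (@le_trans _ _ (2 * \sum_(t < n) (3 * e1 * c n t ^+ 2))).
    rewrite ler_pM2l//; apply: ler_sum => t _.
    have := cn t (ltn_ord t); rewrite le_min => /andP[t1 t2].
    have [a1 a2] := h1 _ t1; have [b1 _] := h2 _ t2.
    rewrite EX2 in b1.
    rewrite (law t (fun x => cos (c n t * h x))); last 2 first.
    - by apply: measurableT_comp; [exact: continuous_measurable_fun (@continuous_cos R)|exact: measurable_funM].
    - by apply: integ_cos; exact: measurable_funM.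
    rewrite (law t (fun x => sin (c n t * h x))); last 2 first.
    - by apply: measurableT_comp; [exact: continuous_measurable_fun (@continuous_sin R)|exact: measurable_funM].
    - by apply: integ_sin; exact: measurable_funM.
    have gE : Ex (@N01 R) (fun x => cos (c n t * X x)) = gauss_cos (sigma * c n t).
      by congr (Ex _ _); apply/funext => x; rewrite /X mulrA [c n t * _]mulrC.
    rewrite gE in b1; move: a1 a2 b1; rewrite -/s2.
    move: (Ex P _) (gauss_cos _) (`|Ex P _|) => x y z.
    rewrite !ler_norml => /andP[x1 x2] z1 /andP[y1 y2].
    have : `|x - y| <= 2 * (e1 * c n t ^+ 2) by rewrite ler_norml; lra.
    lra.
  rewrite -mulr_sumr; have := ler_wpM2l (_ : 0 <= 2 * (3 * e1)) sn.
  move=> /(_ _)/le_trans; rewrite -!mulrA; apply; first by rewrite !mulr_ge0// ltW.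
  by rewrite /e1 le_eqVlt; apply/orP; left; apply/eqP; field; rewrite gt_eqF.
split.
- have gc : gauss_cos (sigma * Num.sqrt (\sum_(t < n) c n t ^+ 2)) @[n --> \oo]
      --> gauss_cos (sigma * Num.sqrt v).
    apply: (cvg_comp (fun n => sigma * Num.sqrt (\sum_(t < n) c n t ^+ 2)) (@gauss_cos R));
      last exact: continuous_gauss_cos.
    apply: cvgMr; apply: (cvg_comp _ (@Num.sqrt R) cv); exact: sqrt_continuous.
  apply/cvgrPdist_le => /= e0 e00; near=> n.
  have n1 : `|gauss_cos (sigma * Num.sqrt v) -
      gauss_cos (sigma * Num.sqrt (\sum_(t < n) c n t ^+ 2))| <= e0 / 2.
    by near: n; move/cvgrPdist_le: gc; apply; rewrite divr_gt0.
  have n2 : `|Ex P (fun w => cos (S n w)) - gauss_cos (sigma * Num.sqrt (\sum_(t < n) c n t ^+ 2))| +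
      `|Ex P (fun w => sin (S n w))| <= e0 / 2 by near: n; apply: key; rewrite divr_gt0.
  rewrite (le_trans (ler_distD (gauss_cos (sigma * Num.sqrt (\sum_(t < n) c n t ^+ 2))) _ _))//.
  rewrite [X in _ + X]distrC; have := normr_ge0 (Ex P (fun w => sin (S n w))).
  by move: n1 n2; lra.
- apply/cvgrPdist_le => /= e0 e00; near=> n; rewrite sub0r normrN.
  have n2 : `|Ex P (fun w => cos (S n w)) - gauss_cos (sigma * Num.sqrt (\sum_(t < n) c n t ^+ 2))| +
      `|Ex P (fun w => sin (S n w))| <= e0 by near: n; exact: key.
  apply: le_trans n2; exact: ler_wpDl.
Unshelve. all: by end_near. Qed.

End scalar_clt.

(** * Weak convergence from characteristic functions *)

Section trigonometric_polynomials.
Context {R : realType} {m : nat}.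
Implicit Types (f : 'cV[R]_m -> R) (a z : 'cV[R]_m).

Lemma dotvE a z : dotv a z = \sum_j a j 0 * z j 0.
Proof. by rewrite /dotv mxE; apply: eq_bigr => j _; rewrite mxE. Qed.

Lemma dotvDl a b z : dotv (a + b) z = dotv a z + dotv b z.
Proof. by rewrite /dotv raddfD /= mulmxDl mxE. Qed.

Lemma dotvNl a z : dotv (- a) z = - dotv a z.
Proof. by rewrite /dotv raddfN /= mulNmx mxE. Qed.

Lemma dotvDr a y z : dotv a (y + z) = dotv a y + dotv a z.
Proof. by rewrite /dotv mulmxDr mxE. Qed.

Lemma dotvNr a z : dotv a (- z) = - dotv a z.
Proof. by rewrite /dotv mulmxN mxE. Qed.

Lemma dotvZr (c : R) a z : dotv a (c *: z) = c * dotv a z.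
Proof. by rewrite /dotv -scalemxAr mxE. Qed.

Lemma dotv_delta (c : R) j z : dotv (c *: delta_mx j 0) z = c * z j 0.
Proof.
rewrite dotvE (bigD1 j)//= big1 ?addr0.
  by rewrite !mxE !eqxx mulr1.
by move=> i ij; rewrite !mxE (negbTE ij) mulr0 mul0r.
Qed.

(** The phase [c] makes sines available and keeps the class closed under products, by the
    product-to-sum formula. *)
Inductive trig_poly : ('cV[R]_m -> R) -> Prop :=
| trig_poly_cos (w c : R) a : trig_poly (fun z => w * cos (dotv a z + c))
| trig_polyD f (g : 'cV[R]_m -> R) : trig_poly f -> trig_poly g -> trig_poly (fun z => f z + g z).

Lemma trig_poly_cst (c : R) : trig_poly (fun=> c).
Proof.
have := trig_poly_cos c 0 0; congr trig_poly; apply/funext => z.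
by rewrite /dotv trmx0 mul0mx mxE addr0 cos0 mulr1.
Qed.

Lemma trig_polyM f (g : 'cV[R]_m -> R) : trig_poly f -> trig_poly g -> trig_poly (fun z => f z * g z).
Proof.
elim=> [w c a|f1 f2 _ IH1 _ IH2] tg; last first.
  have := trig_polyD (IH1 tg) (IH2 tg); congr trig_poly; apply/funext => z.
  by rewrite mulrDl.
elim: tg => [w' c' a'|g1 g2 _ IH1 _ IH2]; last first.
  have := trig_polyD IH1 IH2; congr trig_poly; apply/funext => z.
  by rewrite mulrDr.
have := trig_polyD (trig_poly_cos (w * w' / 2) (c + c') (a + a'))
  (trig_poly_cos (w * w' / 2) (c - c') (a - a')).
congr trig_poly; apply/funext => z.
have -> : dotv (a + a') z + (c + c') = (dotv a z + c) + (dotv a' z + c').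
  by rewrite dotvDl; ring.
have -> : dotv (a - a') z + (c - c') = (dotv a z + c) - (dotv a' z + c').
  by rewrite dotvDl dotvNl; ring.
by rewrite cosB cosD; field.
Qed.

Lemma trig_poly_sin (w : R) j : trig_poly (fun z => sin (w * z j 0)).
Proof.
have := trig_poly_cos 1 (- (pi / 2)) (w *: delta_mx j 0); congr trig_poly.
by apply/funext => z; rewrite dotv_delta mul1r cosBpihalf.
Qed.

Lemma measurable_trig_poly d (T : measurableType d) (Z : T -> 'cV[R]_m) f :
  random_vector Z -> trig_poly f -> measurable_fun setT (f \o Z).
Proof.
move=> mZ; elim=> [w c a|f1 f2 _ IH1 _ IH2]; last exact: measurable_funD.
apply: measurable_funM => //.
apply: (@measurableT_comp _ _ _ _ _ _ (@cos R)).
  exact: continuous_measurable_fun (@continuous_cos R).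
apply: measurable_funD => //; rewrite /comp.
under eq_fun do rewrite dotvE.
by apply: measurable_sum => j; apply: measurable_funM => //; exact: mZ.
Qed.

(* [bernstein s t g k] averages [g] over the random walk started at [k] that, for
   each coordinate [j] listed in [s], increments coordinate [j] with probability
   [t j]; it is the Bernstein polynomial of [g] without binomial coefficients. *)
Fixpoint bernstein (s : seq 'I_m) (t : 'I_m -> R) (g : ('I_m -> nat) -> R)
    (k : 'I_m -> nat) : R :=
  if s is j :: s' then
    (1 - t j) * bernstein s' t g k +
    t j * bernstein s' t g (fun i => k i + (i == j))%N
  else g k.

Lemma bernstein_bound s t g (M : R) k : (forall j, 0 <= t j <= 1) ->
  (forall l, `|g l| <= M) -> `|bernstein s t g k| <= M.
Proof.
move=> t01 gM; elim: s k => [|j s IH] k //=.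
have /andP[t0 t1] := t01 j; apply: (le_trans (ler_normD _ _)).
rewrite !normrM ger0_norm ?subr_ge0// (ger0_norm t0).
have := IH k; have := IH (fun i => k i + (i == j))%N; nra.
Qed.

Lemma bernstein_trig s (u : R) g k :
  trig_poly (fun z => bernstein s (fun j => 2^-1 * (1 + sin (u * z j 0))) g k).
Proof.
elim: s k => [|j s IH] k /=; first exact: trig_poly_cst.
have tt : trig_poly (fun z => 2^-1 * (1 + sin (u * z j 0))).
  apply: trig_polyM; first exact: trig_poly_cst.
  by apply: trig_polyD; [exact: trig_poly_cst|exact: trig_poly_sin].
have tt' : trig_poly (fun z => 1 - 2^-1 * (1 + sin (u * z j 0))).
  have := trig_polyD (trig_poly_cst 1) (trig_polyM (trig_poly_cst (- 1)) tt).
  by congr trig_poly; apply/funext => z; rewrite mulN1r.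
by apply: trig_polyD; exact: trig_polyM.
Qed.

(* The quadratic potential below is exactly preserved by one step of the walk:
   this is the variance computation for the Bernstein polynomials. *)
Lemma bernstein_approx s t g (c e K : R) (N : nat) k : (forall j, 0 <= t j <= 1) ->
  0 <= K ->
  (forall l, `|g l - c| <= e + K * \sum_j ((l j)%:R - N%:R * t j) ^+ 2) ->
  `|bernstein s t g k - c| <= e + K * \sum_j
     (((k j)%:R + (count_mem j s)%:R * t j - N%:R * t j) ^+ 2 +
      (count_mem j s)%:R * (t j * (1 - t j))).
Proof.
move=> t01 K0 gc; elim: s k => [|j s IH] k /=.
  apply: (le_trans (gc k)); rewrite lerD2l ler_wpM2l//.
  by apply: ler_sum => i _; rewrite !mul0r !addr0.
have /andP[t0 t1] := t01 j.
have -> : (1 - t j) * bernstein s t g k +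
    t j * bernstein s t g (fun i => k i + (i == j))%N - c =
    (1 - t j) * (bernstein s t g k - c) +
    t j * (bernstein s t g (fun i => k i + (i == j))%N - c) by ring.
apply: (le_trans (ler_normD _ _)).
rewrite !normrM ger0_norm ?subr_ge0// (ger0_norm t0).
have h1 := ler_wpM2l (_ : 0 <= 1 - t j) (IH k).
have h2 := ler_wpM2l t0 (IH (fun i => k i + (i == j))%N).
apply: (le_trans (lerD (h1 _) h2)); first by rewrite subr_ge0.
set S1 := \sum_j0 _; set S2 := \sum_j0 _; set S3 := \sum_j0 _.
suff -> : S3 = (1 - t j) * S1 + t j * S2.
  by rewrite le_eqVlt; apply/orP; left; apply/eqP; ring.
rewrite /S1 /S2 /S3 !mulr_sumr -big_split /=; apply: eq_bigr => i _.
have [->|ij] := eqVneq i j.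
  by rewrite !natrD /=; ring.
by rewrite add0n addn0; ring.
Qed.

End trigonometric_polynomials.

(** Uniform continuity at the points of K, with the second point y free to leave K: the grid points
    visited by the Bernstein walk may lie outside the compact set. *)
Lemma compact_continuous_modulus (R : realType) (X : pseudoMetricType R)
    (K : set X) (f : X -> R) (e : R) : compact K ->
  (forall x, K x -> {for x, continuous f}) -> 0 < e ->
  exists2 r : R, 0 < r & forall x y, K x -> ball x r y -> `|f y - f x| <= e.
Proof.
move=> /compact_near_coveringP cK cf e0.
have e20 : 0 < e / 2 by rewrite divr_gt0.
have := @cK R (0^'+) (fun r x => forall y, ball x r y -> `|f y - f x| <= e) _.
case.
  move=> x Kx; have /cvgrPdist_lt/(_ _ e20)/nbhs_ballP[r /= r0 hr] := cf x Kx.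
  have r20 : 0 < r / 2 by rewrite divr_gt0.
  exists (ball x (r / 2), [set s | s <= r / 2]).
    by split => /=; [exact: nbhsx_ballx|exact: nbhs_right_le].
  move=> [x' s] /= [xx' sr] y x'y.
  have h1 : `|f x - f x'| < e / 2.
    by apply: hr; apply: le_ball xx'; rewrite ler_pdivrMr// ler_peMr ?ler1n// ltW.
  have h2 : `|f x - f y| < e / 2.
    apply: hr; rewrite [r]splitr; apply: ball_triangle xx' _.
    exact: le_ball x'y.
  rewrite distrC (le_trans (ler_distD (f x) _ _))//.
  by rewrite [`|f x' - _|]distrC [e]splitr lerD// ltW.
move=> r /= r0 hr.
by exists (r / 2); [rewrite divr_gt0|move=> x y Kx; apply: (hr (r / 2)) => //=;
  rewrite ?sub0r ?normrN ?ger0_norm ?ltr_pdivrMr ?ltr_pMr ?ltr1n ?divr_gt0 ?divr_ge0// ltW].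
Qed.

Lemma cvg_close (R : realType) (u v w : nat -> R) (l C : R) :
  (forall n, `|u n - v n| <= C * w n) -> v @ \oo --> l -> w @ \oo --> (0 : R) ->
  u @ \oo --> l.
Proof.
move=> uv cv cw; apply: (@cvg_sub0 _ _ _ _ _ u v) => //.
apply/norm_cvg0P; apply: (@squeeze_cvgr _ _ _ _ (fun=> 0) (fun n => C * w n)).
- by apply: nearW => n; rewrite normr_ge0 uv.
- exact: cvg_cst.
- by rewrite -[X in _ --> X](mulr0 C); apply: cvgMr.
Qed.

Section convergence_in_distribution.
Context {R : realType} {m : nat}.
Implicit Types (f p : 'cV[R]_m -> R) (z : 'cV[R]_m).

Lemma compact_box (L : R) : compact [set z : 'cV[R]_m | forall j, `|z j 0| <= L].
Proof.
have c1 : compact [set v : 'rV[R]_m | forall j, `[- L, L]%classic (v ord0 j)].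
  by apply: (@rV_compact R m (fun=> `[- L, L]%classic)) => j; exact: segment_compact.
have ct : continuous (fun v : 'rV[R]_m => v^T).
  move=> v s /nbhs_ballP[e e0 es]; apply/nbhs_ballP; exists e => // w [_ vw].
  by apply: es; split => // i j; rewrite !mxE; exact: vw.
have -> : [set z : 'cV[R]_m | forall j, `|z j 0| <= L] =
    (fun v : 'rV[R]_m => v^T) @` [set v : 'rV[R]_m | forall j, `[- L, L]%classic (v ord0 j)].
  apply/seteqP; split => [z zL|_ [v vL <-] j] /=.
    exists z^T; last by rewrite trmxK.
    by move=> j; rewrite mxE /= in_itv/= -ler_norml.
  by have := vL j; rewrite mxE /= in_itv/= -ler_norml.
by apply: continuous_compact => //; apply: continuous_subspaceT => v; exact: ct.
Qed.

(** Maps the whole line into [0, 1], as Bernstein weights require. The scale 2L keeps the sine of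
    points of [-L, L] strictly inside (-1, 1), where [asin] is continuous. *)
Let tfun (L x : R) : R := 2^-1 * (1 + sin ((2 * L)^-1 * x)).
Let tinv (L s : R) : R := asin (2 * s - 1) * (2 * L).

Let tfun_itv (L x : R) : 0 < L -> `|x| <= L ->
  tinv L (tfun L x) = x /\ -1 < 2 * tfun L x - 1 < 1.
Proof.
move=> L0 xL; rewrite /tinv /tfun.
have -> : 2 * (2^-1 * (1 + sin ((2 * L)^-1 * x))) - 1 = sin ((2 * L)^-1 * x) by field.
have y2 : `|(2 * L)^-1 * x| <= 2^-1.
  rewrite normrM gtr0_norm ?invr_gt0 ?mulr_gt0// invfM -mulrA.
  by rewrite ler_piMr// mulrC ler_pdivrMr// mul1r.
split.
  rewrite sinK; first by field; rewrite gt_eqF.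
  rewrite in_itv/= -ler_norml (le_trans y2)//.
  by have := @pihalf_ge1 R; lra.
rewrite -ltr_norml (le_lt_trans (norm_sin_le _))// (le_lt_trans y2)//; lra.
Qed.

(** Bernstein approximation of f as a function of the variables [tfun L (z j 0)]. The approximant
    averages values of f whatever z is, hence the bound M outside the box too. *)
Theorem trig_approx f (M L e : R) : continuous f -> (forall z, `|f z| <= M) ->
  0 < L -> 0 < e ->
  exists p, [/\ trig_poly p, forall z, `|p z| <= M &
    forall z, (forall j, `|z j 0| <= L) -> `|f z - p z| <= e].
Proof.
move=> cf fM L0 e0; have e20 : 0 < e / 2 by rewrite divr_gt0.
have M0 : 0 <= M by exact: le_trans (normr_ge0 (f 0)) (fM 0).
have [r r0 hr] := compact_continuous_modulus (@compact_box L) (fun z _ => cf z) e20.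
pose K1 : set R := tfun L @` `[- L, L]%classic.
have cK1 : compact K1.
  apply: continuous_compact; last exact: segment_compact.
  apply: continuous_subspaceT => x; apply: cvgMr; apply: cvgD; first exact: cvg_cst.
  apply: (cvg_comp (fun y => (2 * L)^-1 * y) (@sin R)); last exact: continuous_sin.
  by apply: cvgMr; exact: cvg_id.
have cG s : K1 s -> {for s, continuous (tinv L)}.
  move=> [x]; rewrite /= in_itv/= -ler_norml => xL <-.
  have [_ t1] := tfun_itv L0 xL.
  apply: cvgMl; apply: (cvg_comp (fun y => 2 * y - 1) (@asin R)); last first.
    exact: continuous_asin.
  by apply: cvgB; [apply: cvgMr; exact: cvg_id|exact: cvg_cst].
have [delta d0 hd] := compact_continuous_modulus cK1 cG (divr_gt0 r0 (ltr0n _ 2)).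
(* The variance term of [bernstein_approx] is at most N per coordinate; with N > X its contribution
   stays below e/2. *)
pose X := 4 * M * m%:R / (delta ^+ 2 * e).
pose N := (Num.bound X).+1.
have N0 : 0 < N%:R :> R by rewrite ltr0n.
have X0 : 0 <= X by rewrite divr_ge0 ?mulr_ge0// ltW// exprn_gt0.
have NX : X < N%:R.
  by rewrite (lt_trans (archi_boundP X0))// ltr_nat.
have [s hs] : exists s : seq 'I_m, forall j, count_mem j s = N.
  elim: (N) => [|n [s hs]]; first by exists [::].
  exists (enum 'I_m ++ s) => j.
  by rewrite count_cat hs count_uniq_mem ?enum_uniq// mem_enum add1n.
pose g (l : 'I_m -> nat) := f (\col_j tinv L ((l j)%:R / N%:R)).
pose p z := bernstein s (fun j => tfun L (z j 0)) g (fun=> 0%N).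
exists p; split.
- exact: bernstein_trig.
- move=> z; apply: bernstein_bound => [j|l]; last exact: fM.
  rewrite /tfun; have := sin_geN1 ((2 * L)^-1 * z j 0); have := sin_le1 ((2 * L)^-1 * z j 0).
  by move=> h1 h2; apply/andP; split; lra.
move=> z zL; rewrite distrC.
pose K := 2 * M / (delta * N%:R) ^+ 2.
have K0 : 0 <= K by rewrite divr_ge0 ?mulr_ge0// ltW.
have t01 j : 0 <= tfun L (z j 0) <= 1.
  rewrite /tfun; have := sin_geN1 ((2 * L)^-1 * z j 0); have := sin_le1 ((2 * L)^-1 * z j 0).
  by move=> h1 h2; apply/andP; split; lra.
(* Chebyshev: where some l_j / N is off by at least delta, the trivial bound 2M is charged to the
   quadratic potential. *)
have key l : `|g l - f z| <= e / 2 + K * \sum_j ((l j)%:R - N%:R * tfun L (z j 0)) ^+ 2.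
  have [/forallP h|/forallPn[j]] :=
      boolP [forall j, `|(l j)%:R / N%:R - tfun L (z j 0)| < delta].
    rewrite -[leLHS]addr0 lerD//; last by rewrite mulr_ge0// sumr_ge0// => j _; exact: sqr_ge0.
    apply: hr => //; split => // j k; rewrite ord1 mxE.
    have [e1 _] := tfun_itv L0 (zL j).
    rewrite -{1}e1 /ball /= distrC (le_lt_trans (hd _ _ _ _))//.
    - by exists (z j 0) => //=; rewrite in_itv/= -ler_norml.
    - by rewrite /ball /= distrC; exact: h.
    - by rewrite ltr_pdivrMr// ltr_pMr// ltr1n.
  rewrite -leNgt => hj.
  have sq : (delta * N%:R) ^+ 2 <= ((l j)%:R - N%:R * tfun L (z j 0)) ^+ 2.
    rewrite -[leRHS]real_normK ?num_real// lerXn2r ?nnegrE//; first by rewrite mulr_ge0// ltW.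
    have -> : (l j)%:R - N%:R * tfun L (z j 0) = ((l j)%:R / N%:R - tfun L (z j 0)) * N%:R.
      by field; rewrite gt_eqF.
    by rewrite normrM (gtr0_norm N0) ler_pM2r.
  have dN : 0 < (delta * N%:R) ^+ 2 by rewrite exprn_gt0// mulr_gt0.
  apply: (@le_trans _ _ (2 * M)).
    apply: (le_trans (ler_normB _ _)).
    by rewrite mulr_natl mulr2n lerD// fM.
  apply: (@le_trans _ _ (K * ((l j)%:R - N%:R * tfun L (z j 0)) ^+ 2)).
    rewrite -[leLHS](@divfK _ ((delta * N%:R) ^+ 2)) ?gt_eqF//.
    by rewrite ler_wpM2l.
  rewrite ler_wpDl ?(ltW e20)// ler_wpM2l//.
  by rewrite (bigD1 j)//= lerDl sumr_ge0// => i _; exact: sqr_ge0.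
apply: (le_trans (bernstein_approx s (fun=> 0%N) t01 K0 key)).
rewrite [leRHS]splitr lerD2l.
apply: (@le_trans _ _ (K * \sum_(j < m) N%:R)).
  rewrite ler_wpM2l//; apply: ler_sum => j _; rewrite hs add0r subrr expr0n add0r.
  have /andP[h1 h2] := t01 j; rewrite ler_piMr// ?ltW//; nra.
rewrite sumr_const card_ord -[_ *+ m]mulr_natr.
have -> : K * (N%:R * m%:R) = X / N%:R * (e / 2).
  by rewrite /K /X; field; rewrite !gt_eqF.
by rewrite ler_piMl ?(ltW e20)// ler_pdivrMr// mul1r ltW.
Qed.

(** Measurability is given for the coordinates only, so [f] composed with [Z] is reached as a
    pointwise limit of trigonometric polynomials, accurate to 1/(n + 1) on the box of radius n +
    1. *)
Lemma measurable_continuous_rv d (T : measurableType d) (Z : T -> 'cV[R]_m) f (M : R) :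
  random_vector Z -> continuous f -> (forall z, `|f z| <= M) ->
  measurable_fun setT (fun w => f (Z w)).
Proof.
move=> mZ cf fM.
have n0 n : 0 < n.+1%:R :> R by [].
have n0' n : 0 < n.+1%:R^-1 :> R by rewrite invr_gt0.
pose p n := projT1 (cid (trig_approx cf fM (n0 n) (n0' n))).
have pP n := projT2 (cid (trig_approx cf fM (n0 n) (n0' n))).
apply: (@measurable_fun_cvg _ _ _ _ (fun n w => p n (Z w))) => //.
  by move=> n; have [+ _ _] := pP n; exact: measurable_trig_poly.
move=> w _; apply/cvgrPdist_le => e e0; near=> n.
have [_ _] := pP n; rewrite -/(p n) => /(_ (Z w)) h; apply: (le_trans (h _)).
  move=> j; apply: (@le_trans _ _ (\sum_j `|Z w j 0|)).
    by rewrite (bigD1 j)//= lerDl sumr_ge0.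
  apply: (@le_trans _ _ n%:R); last by rewrite ler_nat.
  by near: n; exact: nbhs_infty_ger.
apply: ltW; near: n; exact: (near_infty_natSinv_lt (PosNum e0)).
Unshelve. all: by end_near. Qed.

Definition nrm z : R := \sum_j `|z j 0|.

Lemma nrm_ge0 z : 0 <= nrm z. Proof. exact: sumr_ge0. Qed.

Lemma nrmD y z : nrm (y + z) <= nrm y + nrm z.
Proof. by rewrite /nrm -big_split ler_sum// => j _; rewrite mxE ler_normD. Qed.

Lemma le_nrm z j : `|z j 0| <= nrm z.
Proof. by rewrite /nrm (bigD1 j)//= lerDl sumr_ge0. Qed.

Lemma dotv_nrm a z : `|dotv a z| <= nrm a * nrm z.
Proof.
rewrite dotvE (le_trans (ler_norm_sum _ _ _))// /nrm mulr_suml ler_sum// => j _.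
by rewrite normrM ler_wpM2l// le_nrm.
Qed.

Lemma measurable_nrm d (T : measurableType d) (Z : T -> 'cV[R]_m) :
  random_vector Z -> measurable_fun setT (fun w => nrm (Z w)).
Proof. by move=> mZ; apply: measurable_sum => j; apply: measurableT_comp => //; exact: mZ. Qed.

Lemma measurable_dotv d (T : measurableType d) (Z : T -> 'cV[R]_m) a :
  random_vector Z -> measurable_fun setT (fun w => dotv a (Z w)).
Proof.
move=> mZ; under eq_fun do rewrite dotvE.
by apply: measurable_sum => j; apply: measurable_funM => //; exact: mZ.
Qed.

Context d (T : measurableType d) (P : probability T R)
        d' (T' : measurableType d') (Q : probability T' R).
Variables (Z zeta : nat -> T -> 'cV[R]_m) (N : T' -> 'cV[R]_m).
Hypothesis mZ : forall n, random_vector (Z n).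
Hypothesis mzeta : forall n, random_vector (zeta n).
Hypothesis mN : random_vector N.
Hypothesis cvg_cos : forall a,
  Ex P (fun w => cos (dotv a (zeta n w))) @[n --> \oo] --> Ex Q (fun w => cos (dotv a (N w))).
Hypothesis cvg_sin : forall a,
  Ex P (fun w => sin (dotv a (zeta n w))) @[n --> \oo] --> Ex Q (fun w => sin (dotv a (N w))).
Hypothesis zeta_tight : exists B : R, \forall n \near \oo,
  integ P (fun w => nrm (zeta n w)) /\ Ex P (fun w => nrm (zeta n w)) <= B.
Hypothesis slutsky :
  Ex P (fun w => Num.min 1 (nrm (Z n w - zeta n w))) @[n --> \oo] --> (0 : R).

Let mdiff n : random_vector (fun w => Z n w - zeta n w).
Proof.
move=> j; under eq_fun do rewrite !mxE.
by apply: measurable_funB; [exact: mZ|exact: mzeta].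
Qed.

Let imin (L : R) (Y : T -> 'cV[R]_m) : random_vector Y -> 0 <= L ->
  integ P (fun w => Num.min 1 (L * nrm (Y w))).
Proof.
move=> mY L0; apply: (@integ_bounded _ _ _ _ _ 1).
  by apply: measurable_minr => //; apply: measurable_funM => //; exact: measurable_nrm.
by move=> w; rewrite ger0_norm ?ge_min ?lexx// le_min ler01 mulr_ge0 ?nrm_ge0.
Qed.

(** A cosine changes by at most 2 and by at most [nrm a] times the displacement, hence by (2 + nrm
    a) min(1, displacement), whose mean vanishes by [slutsky]. *)
Let cvg_trig p : trig_poly p ->
  Ex P (fun w => p (Z n w)) @[n --> \oo] --> Ex Q (fun w => p (N w)).
Proof.
elim=> [w0 c a|p1 p2 t1 IH1 t2 IH2]; last first.
  have ip p' d0 (T0 : measurableType d0) (P0 : probability T0 R) (Y : T0 -> 'cV[R]_m) :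
      random_vector Y -> trig_poly p' -> integ P0 (fun w => p' (Y w)).
    move=> mY tp'; have mp := measurable_trig_poly mY tp'.
    have [M hM] : exists M, forall z, `|p' z| <= M.
      elim: tp' {mp} => [w0 c a|q1 q2 _ [M1 h1] _ [M2 h2]].
        by exists `|w0| => z; rewrite normrM ler_piMr// cos_max.
      by exists (M1 + M2) => z; rewrite (le_trans (ler_normD _ _))// lerD.
    by apply: (@integ_bounded _ _ _ _ _ M) => // w; exact: hM.
  rewrite ExD; [|exact: ip..].
  have -> : (fun n => Ex P (fun w => p1 (Z n w) + p2 (Z n w))) =
      (fun n => Ex P (fun w => p1 (Z n w)) + Ex P (fun w => p2 (Z n w))).
    by apply/funext => n; rewrite ExD//; exact: ip.
  exact: cvgD.
have e1 d0 (T0 : measurableType d0) (P0 : probability T0 R) (Y : T0 -> 'cV[R]_m) :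
    random_vector Y -> Ex P0 (fun w => w0 * cos (dotv a (Y w) + c)) =
    w0 * (cos c * Ex P0 (fun w => cos (dotv a (Y w))) -
          sin c * Ex P0 (fun w => sin (dotv a (Y w)))).
  move=> mY; have mdY := measurable_dotv a mY.
  have ic := integ_cos P0 mdY; have isn := integ_sin P0 mdY.
  rewrite -!ExZ// -ExB ?integZ// -ExZ; last by apply: integB; exact: integZ.
  by congr (Ex _ _); apply/funext => w; rewrite cosD; ring.
rewrite e1//.
have h : w0 * (cos c * Ex P (fun w => cos (dotv a (zeta n w))) -
     sin c * Ex P (fun w => sin (dotv a (zeta n w)))) @[n --> \oo] -->
   w0 * (cos c * Ex Q (fun w => cos (dotv a (N w))) -
     sin c * Ex Q (fun w => sin (dotv a (N w)))).
  by apply: cvgMr; apply: cvgB; apply: cvgMr; [exact: cvg_cos|exact: cvg_sin].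
apply: (cvg_close (v := fun n => w0 * (cos c * Ex P (fun w => cos (dotv a (zeta n w))) -
     sin c * Ex P (fun w => sin (dotv a (zeta n w))))) _ h slutsky (C := `|w0| * (2 + nrm a))).
move=> n; rewrite -e1//.
have icos Y : random_vector Y -> integ P (fun w => w0 * cos (dotv a (Y w) + c)).
  move=> mY; apply: integZ; apply: integ_cos; apply: measurable_funD => //.
  exact: measurable_dotv.
have im := @imin 1 _ (mdiff n) ler01.
rewrite -ExB; [|exact: icos..].
apply: (le_trans (Ex_norm_le (integB (icos _ (mZ n)) (icos _ (mzeta n))))).
have -> : (fun w => Num.min 1 (nrm (Z n w - zeta n w))) =
    (fun w => Num.min 1 (1 * nrm (Z n w - zeta n w))) by apply/funext => w; rewrite mul1r.
rewrite -ExZ//; apply: Ex_le.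
- by apply: integ_norm; apply: integB; exact: icos.
- exact: integZ.
move=> w; rewrite -mulrBr normrM -mulrA ler_wpM2l// mul1r.
have := nrm_ge0 (Z n w - zeta n w); have := nrm_ge0 a.
have [h1|h1] := leP 1 (nrm (Z n w - zeta n w)) => a0 d0.
  rewrite mulr1 (@le_trans _ _ 2)//; last by lra.
  rewrite (le_trans (ler_normB _ _))//; have := cos_max (dotv a (Z n w) + c).
  by have := cos_max (dotv a (zeta n w) + c); lra.
rewrite (le_trans (cos_lipschitz _ _))//.
have -> : dotv a (Z n w) + c - (dotv a (zeta n w) + c) = dotv a (Z n w - zeta n w).
  by rewrite dotvDr dotvNr; ring.
by rewrite (le_trans (dotv_nrm _ _))// ler_wpM2r//; lra.
Qed.

(** On the box of radius L, f is replaced by a trigonometric polynomial. Off it both are bounded by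
    M, so the replacement costs at most 2M times the mean of min(1, nrm / L), which is small for N
    and, through [zeta], for [Z n]. *)
Theorem cvg_in_distribution_trig : cvg_in_distribution P Z Q N.
Proof.
move=> f cf [M fM]; rewrite unlock.
have M0 : 0 <= M by exact: le_trans (normr_ge0 (f 0)) (fM 0).
have if_ d0 (T0 : measurableType d0) (P0 : probability T0 R) (Y : T0 -> 'cV[R]_m) :
    random_vector Y -> integ P0 (fun w => f (Y w)).
  move=> mY; have mf := measurable_continuous_rv mY cf fM.
  exact: (@integ_bounded _ _ _ P0 (fun w => f (Y w)) M mf (fun w => fM (Y w))).
under eq_fun do rewrite -EFin_Ex ?if_//.
rewrite -EFin_Ex ?if_//; apply/cvg_EFin; first exact: nearW.
rewrite /comp /=; apply/cvgrPdist_le => /= e e0.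
have [B hB] := zeta_tight.
pose e1 := e / (24 * (M + 1)).
have e10 : 0 < e1 by rewrite divr_gt0// mulr_gt0// ltr_wpDl.
have [del del0 hdel] := Ex_min_small (integ_cst Q 1) (fun=> ler01) (measurable_nrm mN)
  (fun w => nrm_ge0 (N w)) e10.
(* One summand for each demand: L^-1 <= 1, L^-1 <= del for the tail of N, and L^-1 |B| <= e1 for the
   mean of [nrm zeta]. *)
pose L := 1 + del^-1 + `|B| / e1.
have idel : 0 < (del : R)^-1 by rewrite invr_gt0.
have Be1 : 0 <= `|B| / e1 by rewrite divr_ge0 ?(ltW e10).
have L1 : 1 <= L by rewrite /L; lra.
have L0 : 0 < L by exact: lt_le_trans L1.
have Ldel : 0 <= L^-1 <= del.
  rewrite invr_ge0 (ltW L0)/= -[leRHS]invrK lef_pV2 ?posrE ?invr_gt0//.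
  by rewrite /L; lra.
have LB : L^-1 * `|B| <= e1.
  rewrite mulrC ler_pdivrMr// mulrC -ler_pdivrMr// /L; lra.
have e80 : 0 < e / 8 by rewrite divr_gt0.
have [p [tp pM fp]] := trig_approx cf fM L0 e80.
have ip d0 (T0 : measurableType d0) (P0 : probability T0 R) (Y : T0 -> 'cV[R]_m) :
    random_vector Y -> integ P0 (fun w => p (Y w)).
  move=> mY; apply: (@integ_bounded _ _ _ _ _ M) => //; exact: measurable_trig_poly.
have iL d0 (T0 : measurableType d0) (P0 : probability T0 R) (Y : T0 -> 'cV[R]_m) :
    random_vector Y -> integ P0 (fun w => Num.min 1 (L^-1 * nrm (Y w))).
  move=> mY; apply: (@integ_bounded _ _ _ _ _ 1).
    by apply: measurable_minr => //; apply: measurable_funM => //; exact: measurable_nrm.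
  move=> w; rewrite ger0_norm ?ge_min ?lexx// le_min ler01 mulr_ge0 ?nrm_ge0// invr_ge0 ltW//.
have diff d0 (T0 : measurableType d0) (P0 : probability T0 R) (Y : T0 -> 'cV[R]_m) :
    random_vector Y -> `|Ex P0 (fun w => f (Y w)) - Ex P0 (fun w => p (Y w))| <=
      e / 8 + 2 * M * Ex P0 (fun w => Num.min 1 (L^-1 * nrm (Y w))).
  move=> mY; rewrite -ExB; [|exact: if_|exact: ip].
  apply: (le_trans (Ex_norm_le (integB (if_ _ _ _ _ mY) (ip _ _ _ _ mY)))).
  rewrite -ExZ; last exact: iL.
  rewrite -[X in X + _](Ex_cst P0) -ExD; [|exact: integ_cst|exact/integZ/iL].
  apply: Ex_le.
  - by apply: integ_norm; apply: integB; [exact: if_|exact: ip].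
  - by apply: integD; [exact: integ_cst|exact/integZ/iL].
  move=> w; have [h|h] := leP 1 (L^-1 * nrm (Y w)).
    rewrite mulr1 (le_trans (ler_normB _ _))//.
    by have := fM (Y w); have := pM (Y w); lra.
  rewrite (le_trans (fp _ _))//.
    move=> j; rewrite (le_trans (le_nrm _ j))//.
    by move: h; rewrite mulrC ltr_pdivrMr// mul1r => /ltW.
  by rewrite lerDl !mulr_ge0 ?nrm_ge0// invr_ge0 ltW.
have NL : Ex Q (fun w => Num.min 1 (L^-1 * nrm (N w))) <= e1.
  have := hdel _ Ldel; congr (_ <= _); congr (Ex _ _); apply/funext => w; exact: mul1r.
near=> n.
have ZL : Ex P (fun w => Num.min 1 (L^-1 * nrm (Z n w))) <= 2 * e1.
  have [iz zB] : integ P (fun w => nrm (zeta n w)) /\ Ex P (fun w => nrm (zeta n w)) <= B.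
    by near: n.
  have s1 : Ex P (fun w => Num.min 1 (nrm (Z n w - zeta n w))) <= e1.
    have : `|0 - Ex P (fun w => Num.min 1 (nrm (Z n w - zeta n w)))| <= e1.
      by near: n; move/cvgrPdist_le: slutsky; apply.
    by rewrite sub0r normrN; apply: le_trans; exact: ler_norm.
  have im : integ P (fun w => Num.min 1 (nrm (Z n w - zeta n w))).
    have := @imin 1 _ (mdiff n) ler01; congr integ; apply/funext => w; by rewrite mul1r.
  apply: (@le_trans _ _ (Ex P (fun w => Num.min 1 (nrm (Z n w - zeta n w)) +
      L^-1 * nrm (zeta n w)))).
    apply: Ex_le; [exact: iL|by apply: integD => //; exact: integZ|].
    move=> w; have Li : L^-1 <= 1 by rewrite invf_le1.
    have Li0 : 0 <= L^-1 by rewrite invr_ge0 ltW.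
    have d0 := nrm_ge0 (Z n w - zeta n w); have z0 := nrm_ge0 (zeta n w).
    have Zd : nrm (Z n w) <= nrm (Z n w - zeta n w) + nrm (zeta n w).
      by rewrite -{1}[Z n w](subrK (zeta n w)) nrmD.
    rewrite ge_min; have [h1|h1] := leP 1 (nrm (Z n w - zeta n w)).
      by rewrite lerDl mulr_ge0.
    apply/orP; right; apply: (le_trans (ler_wpM2l Li0 Zd)).
    by rewrite mulrDr lerD2r ler_piMl.
  rewrite ExD//; last exact: integZ.
  rewrite ExZ// mulr_natl mulr2n lerD// (le_trans _ LB)// ler_wpM2l//.
    by rewrite invr_ge0 ltW.
  by rewrite (le_trans zB)// ler_norm.
have pn : `|Ex Q (fun w => p (N w)) - Ex P (fun w => p (Z n w))| <= e / 4.
  near: n; have := cvg_trig tp => /cvgrPdist_le; apply.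
  by rewrite divr_gt0.
have dN := diff _ _ Q N mN; have dZ := diff _ _ P (Z n) (mZ n).
have Me : M * e1 <= e / 24.
  have -> : M * e1 = e / 24 * (M / (M + 1)) by rewrite /e1; field; rewrite gt_eqF// ltr_wpDl.
  by rewrite ler_piMr ?divr_ge0 ?(ltW e0)// ler_pdivrMr ?ltr_wpDl// mul1r lerDl.
have h1 : `|Ex Q (fun w => f (N w)) - Ex Q (fun w => p (N w))| <= e / 8 + 2 * (M * e1).
  by apply: (le_trans dN); rewrite lerD2l -mulrA ler_pM2l// ler_wpM2l.
have h2 : `|Ex P (fun w => f (Z n w)) - Ex P (fun w => p (Z n w))| <= e / 8 + 4 * (M * e1).
  apply: (le_trans dZ); rewrite lerD2l -mulrA.
  have := ler_wpM2l M0 ZL; move: (M * Ex P _) => u; lra.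
move: h1 h2 pn; rewrite !ler_norml; lra.
Unshelve. all: by end_near. Qed.

End convergence_in_distribution.

(** * Positive definite matrices *)

Section positive_definite.
Context {R : realType}.

Lemma dotvZl m (a : R) (u v : 'cV[R]_m) : dotv (a *: u) v = a * dotv u v.
Proof. by rewrite /dotv linearZ /= -scalemxAl mxE. Qed.

Lemma dotvC m (u v : 'cV[R]_m) : dotv u v = dotv v u.
Proof. by rewrite !dotvE; apply: eq_bigr => i _; rewrite mulrC. Qed.

Lemma dotv_mull m n (A : 'M[R]_(m, n)) u v : dotv (A *m u) v = dotv u (A^T *m v).
Proof. by rewrite /dotv trmx_mul mulmxA. Qed.

Lemma dotv_ge0 m (u : 'cV[R]_m) : 0 <= dotv u u.
Proof. by rewrite dotvE sumr_ge0// => i _; rewrite -expr2 sqr_ge0. Qed.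

Lemma dotv_col_mx m n (u u' : 'cV[R]_m) (v v' : 'cV[R]_n) :
  dotv (col_mx u v) (col_mx u' v') = dotv u u' + dotv v v'.
Proof. by rewrite /dotv tr_col_mx mul_row_col mxE. Qed.

Lemma posdef_unitmx m (C : 'M[R]_m) : posdefmx C -> C \in unitmx.
Proof.
move=> [sC pC]; rewrite unitmxE unitfE; apply/negP => /det0P[v v0 vC].
have : v^T != 0 by apply: contra v0 => /eqP h; rewrite -[v]trmxK h linear0.
move=> /pC; rewrite -{1}sC -trmx_mul vC linear0 /dotv mulmx0 mxE ltxx.
by [].
Qed.

Lemma posdef_invmx m (C : 'M[R]_m) : posdefmx C -> posdefmx (invmx C).
Proof.
move=> hC; have uC := posdef_unitmx hC; case: hC => sC pC; split.
  by rewrite trmx_inv sC.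
move=> v v0; pose u := invmx C *m v.
have Cu : C *m u = v by rewrite mulmxA mulmxV// mul1mx.
rewrite -/u -{1}Cu dotvC; apply: pC; apply: contra v0 => /eqP h.
by rewrite -Cu h mulmx0.
Qed.

(** Elimination of the first coordinate: the Schur complement is again positive definite, and its
    factor completes that of C. *)
Lemma cholesky m (C : 'M[R]_m) : posdefmx C -> exists B : 'M[R]_m, C = B *m B^T.
Proof.
elim: m C => [|m IH] C; first by move=> _; exists 0; rewrite mul0mx [C]flatmx0.
move: C; rewrite -[m.+1]/(1 + m)%N => C.
rewrite -[C]submxK; set c := ulsubmx C; set r := ursubmx C.
set l := dlsubmx C; set D := drsubmx C => -[sC pC].
have [_ lr rl sD] : [/\ c^T = c, l^T = r, r^T = l & D^T = D].
  by move: sC; rewrite tr_block_mx => /eq_block_mx.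
have c1 : c = (c 0 0)%:M by rewrite [LHS]mx11_scalar.
have c0 : 0 < c 0 0.
  have := pC (col_mx 1%:M 0).
  rewrite mul_block_col !mulmx0 !addr0 !mulmx1 dotv_col_mx.
  rewrite /dotv trmx0 mul0mx [X in _ + X]mxE trmx1 mul1mx addr0; apply.
  rewrite -(col_mx0 R 1 m 1); apply/eqP => /eq_col_mx[/matrixP/(_ 0 0)/eqP].
  by rewrite !mxE eqxx oner_eq0.
move: (c 0 0) c0 c1 => g g0 c1; rewrite {}c1 in sC pC *.
have [L hL] : exists L : 'M[R]_m, D - g^-1 *: (l *m r) = L *m L^T.
  apply: IH; split.
    by rewrite linearB /= linearZ /= trmx_mul lr rl sD.
  (* This first coordinate cancels the first block of the product by C, so the form of C at (u, v)
     is that of the Schur complement at v. *)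
  move=> v v0; pose u := - g^-1 *: (r *m v).
  have := pC (col_mx u v).
  rewrite mul_block_col dotv_col_mx.
  have -> : g%:M *m u + r *m v = 0.
    by rewrite mul_scalar_mx scalerA mulrN divff ?gt_eqF// scaleN1r addNr.
  have -> : l *m u + D *m v = (D - g^-1 *: (l *m r)) *m v.
    by rewrite /u -scalemxAr scaleNr mulmxBl -scalemxAl mulmxA addrC.
  rewrite {1}/dotv mulmx0 mxE add0r; apply.
  by apply: contra v0 => /eqP h; move: h; rewrite -col_mx0 => /eq_col_mx[_ ->].
pose s := Num.sqrt g; have s0 : s != 0 by rewrite gt_eqF// sqrtr_gt0.
have ss : s * s = g by rewrite -expr2 sqr_sqrtr// ltW.
exists (block_mx s%:M 0 (s^-1 *: l) L).
rewrite tr_block_mx mulmx_block tr_scalar_mx trmx0 linearZ /= lr.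
rewrite !mul0mx !mulmx0 !addr0 -!scalemxAl -!scalemxAr !mul_scalar_mx.
rewrite mul_mx_scalar !scalerA mulVf// !scale1r scale_scalar_mx ss.
by rewrite -hL -invfM ss addrC subrK.
Qed.

Lemma nrm_mulmx m n (A : 'M[R]_(m, n)) (u : 'cV[R]_n) :
  nrm (A *m u) <= (\sum_i \sum_j `|A i j|) * nrm u.
Proof.
rewrite /nrm mulr_suml ler_sum// => i _; rewrite mxE (le_trans (ler_norm_sum _ _ _))//.
by rewrite mulr_suml ler_sum// => j _; rewrite normrM ler_wpM2l// le_nrm.
Qed.

(** Cauchy-Schwarz against the vector of ones, from Lagrange's identity. *)
Lemma nrm_sqr m (u : 'cV[R]_m) : nrm u ^+ 2 <= m%:R * dotv u u.
Proof.
have h : 0 <= \sum_i \sum_j (`|u i 0| - `|u j 0|) ^+ 2.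
  by apply: sumr_ge0 => i _; apply: sumr_ge0 => j _; exact: sqr_ge0.
suff e : \sum_i \sum_j (`|u i 0| - `|u j 0|) ^+ 2 = 2 * (m%:R * dotv u u - nrm u ^+ 2).
  by move: h; rewrite e pmulr_rge0// subr_ge0.
have du : dotv u u = \sum_j `|u j 0| ^+ 2.
  by rewrite dotvE; apply: eq_bigr => j _; rewrite -expr2 real_normK ?num_real.
transitivity (\sum_(i < m) (m%:R * `|u i 0| ^+ 2 + dotv u u - 2 * `|u i 0| * nrm u)).
  apply: eq_bigr => i _; under eq_bigr do rewrite sqrrB.
  rewrite 2!big_split/= sumr_const card_ord -[_ *+ m]mulr_natl -du sumrN.
  rewrite sumrMnl -mulr_sumr -/(nrm u) -mulr_natl; ring.
rewrite 2!big_split/= -mulr_sumr -du sumr_const card_ord -[_ *+ m]mulr_natl.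
rewrite sumrN -mulr_suml -mulr_sumr -/(nrm u); ring.
Qed.

(** With C = B B', the form is the squared length of B' u, and u is recovered from B' u by a bounded
    inverse. The added ones keep K positive in every dimension, including 0. *)
Lemma posdef_coercive m (C : 'M[R]_m) : posdefmx C ->
  exists2 l : R, 0 < l & forall u, l * nrm u ^+ 2 <= dotv u (C *m u).
Proof.
move=> hC; have [B hB] := cholesky hC.
have uB : B^T \in unitmx.
  by have := posdef_unitmx hC; rewrite hB unitmx_mul => /andP[].
pose A := invmx B^T; pose c := \sum_i \sum_j `|A i j|.
have c0 : 0 <= c by apply: sumr_ge0 => i _; exact: sumr_ge0.
pose K := (c ^+ 2 + 1) * (m%:R + 1).
have K0 : 0 < K by rewrite mulr_gt0// ltr_wpDl// sqr_ge0.
exists K^-1; first by rewrite invr_gt0.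
move=> u; rewrite mulrC ler_pdivrMr// hB -mulmxA dotvC dotv_mull.
set v := B^T *m u; have -> : u = A *m v by rewrite /v mulmxA mulVmx// mul1mx.
have dv := dotv_ge0 v.
apply: (@le_trans _ _ (c ^+ 2 * nrm v ^+ 2)).
  by rewrite -exprMn lerXn2r ?nnegrE ?mulr_ge0 ?nrm_ge0// nrm_mulmx.
apply: (@le_trans _ _ (c ^+ 2 * (m%:R * dotv v v))).
  by rewrite ler_wpM2l ?sqr_ge0 ?nrm_sqr.
rewrite mulrCA mulrA mulrC ler_wpM2l// /K.
have := sqr_ge0 c; have : 0 <= m%:R :> R by [].
by move: (m%:R) (c ^+ 2) => a b; nra.
Qed.

End positive_definite.

(** * Laws of large numbers for weighted sums *)

(** Stands in for Cauchy-Schwarz when a bound on a second moment is turned into one on a first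
    moment; [a] is a free scale. *)
Lemma norm_le_amgm (R : realFieldType) (a x : R) : 0 < a -> `|x| <= a + a^-1 * x ^+ 2.
Proof.
move=> a0; rewrite -(ler_pM2l a0) mulrDr mulVKf ?gt_eqF// -[x ^+ 2]real_normK ?num_real//.
by move: (`|x|) => y; have := sqr_ge0 (a - y); nra.
Qed.

Section weighted_sums.
Context d (T : measurableType d) (R : realType) (P : probability T R).
Variables (eps : nat -> {RV P >-> R}) (e : {RV P >-> R}).
Hypothesis eps_indep : mutually_independent eps.
Hypothesis eps_id : identically_distributed eps e.
Implicit Types (f h : R -> R).

Lemma Ex_eps f i : measurable_fun setT f -> integ P (fun w => f (e w)) ->
  integ P (fun w => f (eps i w)) /\
  Ex P (fun w => f (eps i w)) = Ex P (fun w => f (e w)).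
Proof.
move=> mf; exact: (@Ex_eq_law _ _ _ _ _ _ _ P P (eps i) e f (@measurable_funPT _ _ _ _ _)
  (@measurable_funPT _ _ _ _ _) mf (eps_id i)).
Qed.

Lemma weighted_sum_variance h (c : nat -> R) n : measurable_fun setT h ->
  integ P (fun w => h (e w)) -> integ P (fun w => h (e w) ^+ 2) ->
  Ex P (fun w => h (e w)) = 0 ->
  let S w := \sum_(t < n) c t * h (eps t w) in
  integ P (fun w => S w ^+ 2) /\
  Ex P (fun w => S w ^+ 2) = (\sum_(t < n) c t ^+ 2) * Ex P (fun w => h (e w) ^+ 2).
Proof.
move=> mh ih ih2 h0; elim: n => [|n [IHi IHe]] /=.
  under eq_fun do rewrite big_ord0 expr0n.
  by rewrite Ex_cst big_ord0 mul0r; split; first exact: integ_cst.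
set S := fun w => \sum_(t < n) c t * h (eps t w) in IHi IHe.
have iS : integ P S by apply: integ_sum => i; apply: integZ; exact: (Ex_eps _ mh ih).1.
have SE : indep P S (eps n).
  by apply: (@indep_sum _ _ _ P eps eps_indep n (fun i x => c i * h x)) => i; exact: measurable_funM.
have [iSh ESh] := @indep_integM _ _ _ P _ _ _ _ S (eps n) id h (integ_measurable iS)
  (@measurable_funPT _ _ _ _ _) (@measurable_id _ _ _) mh SE iS (Ex_eps n mh ih).1.
have [ih2n Eh2n] := @Ex_eps (fun x => h x ^+ 2) n (measurable_funX _ mh) ih2.
have E w : (\sum_(t < n.+1) c t * h (eps t w)) ^+ 2 =
    S w ^+ 2 + (2 * c n) * (S w * h (eps n w)) + c n ^+ 2 * (h (eps n w) ^+ 2).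
  by rewrite big_ord_recr /= -/(S w); ring.
rewrite (funext E); split.
  by apply: integD; [apply: integD => //; exact: integZ|exact: integZ].
rewrite ExD; [|by apply: integD => //; exact: integZ|exact: integZ].
rewrite ExD//; last exact: integZ.
rewrite !ExZ// ESh (Ex_eps n mh ih).2 h0 mulr0 mulr0 addr0 IHe Eh2n.
by rewrite big_ord_recr /= mulrDl.
Qed.

(** Convergence in mean with one moment of f. The soft truncation f = g + r leaves g bounded by
    1/del, so that its weighted sum has small variance, and r with mean at most e1. *)
Lemma weighted_lln f (c : nat -> nat -> R) (B : R) : measurable_fun setT f ->
  (forall s, 0 <= f s) -> integ P (fun w => f (e w)) ->
  (\forall n \near \oo, \sum_(t < n) `|c n t| <= B) ->
  (forall delta, 0 < delta ->
    \forall n \near \oo, forall t, (t < n)%N -> `|c n t| <= delta) ->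
  Ex P (fun w => `|\sum_(t < n) c n t * (f (eps t w) - Ex P (fun w => f (e w)))|)
    @[n --> \oo] --> (0 : R).
Proof.
move=> mf f0 iff cB cmax; apply/cvgrPdist_le => /= e0 e00.
have mfe := integ_measurable iff.
pose e1 := e0 / (2 * `|B| + 2).
have B2 : 0 < 2 * `|B| + 2 by rewrite ltr_wpDl// mulr_ge0.
have e10 : 0 < e1 by rewrite divr_gt0.
have [del del0 hdel] := Ex_min_small iff (fun w => f0 (e w)) mfe (fun w => f0 (e w)) e10.
pose r s := f s * Num.min 1 ((del : R) * f s).
pose g s := f s - r s.
have m1 s : 0 <= Num.min 1 ((del : R) * f s) <= 1.
  by rewrite le_min ler01 mulr_ge0 ?(ltW del0)// ge_min lexx.
have r0 s : 0 <= r s by have /andP[h _] := m1 s; rewrite mulr_ge0.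
have rf s : r s <= f s by have /andP[_ h] := m1 s; rewrite ler_piMr.
have g0 s : 0 <= g s by rewrite subr_ge0.
have gdel s : g s <= (del : R)^-1.
  rewrite /g /r; have [h|h] := leP 1 ((del : R) * f s).
    by rewrite mulr1 subrr invr_ge0 ltW.
  rewrite (@le_trans _ _ (f s))//.
    by rewrite gerBl mulr_ge0// mulr_ge0// ltW.
  by rewrite -[leRHS]mul1r ler_pdivlMr// mulrC ltW.
have mr : measurable_fun setT r.
  by apply: measurable_funM => //; apply: measurable_minr => //; exact: measurable_funM.
have mg : measurable_fun setT g by exact: measurable_funB.
have ir : integ P (fun w => r (e w)).
  by apply: (integ_le _ _ iff); [exact: measurableT_comp|move=> w; rewrite ger0_norm].
have ig : integ P (fun w => g (e w)) by exact: integB.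
have Er : 0 <= Ex P (fun w => r (e w)) <= e1.
  by rewrite Ex_ge0//=; apply: hdel; rewrite lexx ltW.
set Eg := Ex P (fun w => g (e w)).
have Eg0 : 0 <= Eg <= (del : R)^-1.
  by rewrite Ex_ge0//= -(Ex_cst P (del^-1)) Ex_le//; exact: integ_cst.
pose h s := g s - Eg.
have hb s : `|h s| <= (del : R)^-1.
  rewrite ler_norml /h; have := g0 s; have := gdel s; have /andP[] := Eg0; lra.
have mh : measurable_fun setT h by exact: measurable_funB.
have ih : integ P (fun w => h (e w)) by apply: integB => //; exact: integ_cst.
have ih2 : integ P (fun w => h (e w) ^+ 2).
  apply: (@integ_bounded _ _ _ _ _ ((del : R)^-1 ^+ 2)).
    by apply: measurable_funX; exact: measurableT_comp.
  by move=> w; rewrite normrX lerXn2r ?nnegrE ?invr_ge0// ltW.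
have Eh0 : Ex P (fun w => h (e w)) = 0.
  by rewrite ExB//; [rewrite Ex_cst subrr|exact: integ_cst].
have Eh2 : Ex P (fun w => h (e w) ^+ 2) <= (del : R)^-1 ^+ 2.
  rewrite -[leRHS](Ex_cst P) Ex_le//; first exact: integ_cst.
  move=> w; rewrite -[leLHS]real_normK ?num_real//.
  by rewrite lerXn2r ?nnegrE ?invr_ge0// ltW.
(* Makes the variance of the bounded part at most e1^2: the squared weights sum to at most eta0 |B|
   and the summands are bounded by 1/del. *)
pose eta0 := (e1 * (del : R)) ^+ 2 / (`|B| + 1).
have B1 : 0 < `|B| + 1 by rewrite ltr_wpDl.
have eta00 : 0 < eta0 by rewrite divr_gt0// exprn_gt0// mulr_gt0.
near=> n.
have cn : forall t, (t < n)%N -> `|c n t| <= eta0 by near: n; exact: cmax.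
have cBn : \sum_(t < n) `|c n t| <= `|B|.
  by apply: (@le_trans _ _ B); [near: n|exact: ler_norm].
set S := fun w => \sum_(t < n) c n t * h (eps t w).
have [iS2 ES2] := weighted_sum_variance (c n) n mh ih ih2 Eh0.
rewrite -/S in iS2 ES2.
have c2 : \sum_(t < n) c n t ^+ 2 <= eta0 * `|B|.
  apply: (@le_trans _ _ (\sum_(t < n) (eta0 * `|c n t|))).
    apply: ler_sum => t _; rewrite -[leLHS]real_normK ?num_real// expr2.
    by rewrite ler_wpM2r// cn.
  by rewrite -mulr_sumr ler_pM2l.
have iS : integ P S by apply: integ_sum => i; apply: integZ; exact: (Ex_eps _ mh ih).1.
have ES : Ex P (fun w => `|S w|) <= e1 + e1.
  apply: (@le_trans _ _ (Ex P (fun w => e1 + e1^-1 * S w ^+ 2))).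
    apply: Ex_le; first exact: integ_norm.
      by apply: integD; [exact: integ_cst|exact: integZ].
    by move=> w; exact: norm_le_amgm.
  rewrite ExD; [|exact: integ_cst|exact: integZ].
  rewrite Ex_cst ExZ// lerD2l ler_pdivrMl// ES2.
  apply: (@le_trans _ _ ((eta0 * `|B|) * (del : R)^-1 ^+ 2)).
    apply: ler_pM => //; last by apply: Ex_ge0 => w; exact: sqr_ge0.
    by apply: sumr_ge0 => t _; exact: sqr_ge0.
  have -> : eta0 * `|B| * (del : R)^-1 ^+ 2 = e1 ^+ 2 * (`|B| / (`|B| + 1)).
    by rewrite /eta0; field; rewrite !gt_eqF.
  rewrite -expr2 ler_piMr ?sqr_ge0// ler_pdivrMr// mul1r lerDl ler01.
  by [].
set Er' := Ex P (fun w => r (e w)) in Er *.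
have irt t : integ P (fun w => `|r (eps t w) - Er'|).
  apply: integ_norm; apply: integB; [exact: (Ex_eps _ mr ir).1|exact: integ_cst].
have Ert t : Ex P (fun w => `|r (eps t w) - Er'|) <= 2 * e1.
  apply: (@le_trans _ _ (Ex P (fun w => r (eps t w) + Er'))).
    apply: Ex_le => //.
      by apply: integD; [exact: (Ex_eps _ mr ir).1|exact: integ_cst].
    move=> w; apply: (le_trans (ler_normB _ _)).
    by have /andP[h1 _] := Er; rewrite !ger0_norm.
  rewrite ExD; [|exact: (Ex_eps _ mr ir).1|exact: integ_cst].
  by rewrite Ex_cst (Ex_eps _ mr ir).2; have /andP[_] := Er; rewrite -/Er'; lra.
have Ef : Ex P (fun w => f (e w)) = Eg + Er'.
  rewrite -ExD//; congr (Ex P _); apply/funext => w; rewrite /g; ring.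
have fE s : f s - Ex P (fun w => f (e w)) = h s + (r s - Er') by rewrite Ef /h /g; ring.
rewrite sub0r normrN ger0_norm; last exact: Ex_ge0.
have iF : integ P (fun w => \sum_(t < n) c n t * (f (eps t w) - Ex P (fun w => f (e w)))).
  apply: integ_sum => t; apply: integZ; apply: integB; last exact: integ_cst.
  exact: (Ex_eps _ mf iff).1.
have iR : integ P (fun w => \sum_(t < n) `|c n t| * `|r (eps t w) - Er'|).
  by apply: integ_sum => t; exact: integZ.
apply: (@le_trans _ _ (Ex P (fun w => `|S w| + \sum_(t < n) `|c n t| * `|r (eps t w) - Er'|))).
  apply: Ex_le; first exact: integ_norm.
    by apply: integD => //; exact: integ_norm.
  move=> w; under eq_bigr do rewrite fE mulrDr.
  rewrite big_split /= (le_trans (ler_normD _ _))// lerD2l.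
  by rewrite (le_trans (ler_norm_sum _ _ _))// ler_sum// => t _; rewrite normrM.
rewrite ExD//; last exact: integ_norm.
rewrite Ex_sum; last by move=> t; exact: integZ.
apply: (@le_trans _ _ (e1 + e1 + \sum_(t < n) `|c n t| * (2 * e1))).
  by rewrite lerD// ler_sum// => t _; rewrite ExZ// ler_wpM2l.
rewrite -mulr_suml (@le_trans _ _ (e1 + e1 + `|B| * (2 * e1)))//.
  by rewrite lerD2l ler_wpM2r// mulr_ge0// ltW.
rewrite (_ : _ + _ = e1 * (2 * `|B| + 2)); last by ring.
by rewrite /e1 divfK// gt_eqF.
Unshelve. all: by end_near. Qed.

End weighted_sums.

(** * Minimization of a convex loss *)

Section scaled_sequences.
Context {R : realType}.
Variables (z : nat -> R) (g : R).
Hypothesis zg : N%:R^-1 * \sum_(t < N) z t ^+ 2 @[N --> \oo] --> g.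

Lemma scaled_sqr_bounded :
  \forall N \near \oo, \sum_(t < N) (z t / Num.sqrt N%:R) ^+ 2 <= g + 1.
Proof.
near=> N.
have : `|g - N%:R^-1 * \sum_(t < N) z t ^+ 2| <= 1.
  by near: N; move/cvgrPdist_le: zg; apply.
rewrite ler_norml => /andP[+ _].
under [in X in _ -> X]eq_bigr do rewrite expr_div_n sqr_sqrtr ?ler0n// mulrC.
by rewrite -mulr_sumr; lra.
Unshelve. all: by end_near. Qed.

(* The last term of the average is z_N^2/(N+1) = a_(N+1) - N/(N+1) a_N,
   where a_N is the average: it vanishes in the limit. *)
Lemma scaled_vanish (delta : R) : 0 < delta ->
  \forall N \near \oo, forall t, (t < N)%N -> `|z t / Num.sqrt N%:R| <= delta.
Proof.
move=> d0; pose a N : R := N%:R^-1 * \sum_(t < N) z t ^+ 2.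
have zE N : z N ^+ 2 = N.+1%:R * a N.+1 - N%:R * a N.
  rewrite /a; case: N => [|N].
    by rewrite mul0r subr0 big_ord_recr big_ord0 /= add0r invr1 !mul1r.
  rewrite !mulVKf ?pnatr_eq0//.
  by rewrite big_ord_recr /= addrAC subrr add0r.
have [N0 hN0] : exists N0, forall t, (N0 <= t)%N -> z t ^+ 2 <= delta ^+ 2 * t.+1%:R.
  have e0 : 0 < delta ^+ 2 / 4 by rewrite divr_gt0// exprn_gt0.
  have [N1 _ h1] : \forall N \near \oo, `|g - a N| <= delta ^+ 2 / 4.
    by move/cvgrPdist_le: zg; apply.
  pose N2 := (Num.bound (2 * `|g| / delta ^+ 2)).
  exists (maxn N1 N2) => t; rewrite geq_max => /andP[t1 t2].
  have := h1 t t1; have := h1 t.+1 (leqW t1).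
  have gt : 2 * `|g| <= delta ^+ 2 * t%:R.
    rewrite [leRHS]mulrC -ler_pdivrMr ?exprn_gt0// ltW//.
    apply: lt_le_trans (archi_boundP _) _; first by apply: divr_ge0; [exact: mulr_ge0|exact: sqr_ge0].
    by rewrite ler_nat.
  rewrite zE -[t.+1%:R]natr1; have t0 : 0 <= t%:R :> R by [].
  have ng := ler_norm g.
  move: (a t.+1) (a t) (t%:R) t0 gt => x y T T0 gt.
  rewrite !ler_norml => /andP[x1 x2] /andP[y1 y2].
  have q1 : T * x <= T * (g + delta ^+ 2 / 4) by apply: ler_wpM2l => //; lra.
  have q2 : T * (g - delta ^+ 2 / 4) <= T * y by apply: ler_wpM2l => //; lra.
  by nra.
(* The terms before N0 are each at most Q, which delta^2 N exceeds for large N. *)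
pose Q := \sum_(t < N0) z t ^+ 2.
have Q0 : 0 <= Q by apply: sumr_ge0 => t _; exact: sqr_ge0.
near=> N => t tN.
have QN : Q <= delta ^+ 2 * N%:R.
  rewrite mulrC -ler_pdivrMr ?exprn_gt0//.
  near: N; exact: nbhs_infty_ger.
have N0' : 0 < Num.sqrt N%:R :> R.
  by rewrite sqrtr_gt0 ltr0n; exact: leq_ltn_trans tN.
suff : z t ^+ 2 <= (delta * Num.sqrt N%:R) ^+ 2.
  rewrite normrM normfV (gtr0_norm N0') ler_pdivrMr// -[z t ^+ 2]real_normK ?num_real//.
  by rewrite ler_sqr ?nnegrE// mulr_ge0 ?ltW.
rewrite exprMn sqr_sqrtr//; have [h|h] := leqP N0 t.
  by rewrite (le_trans (hN0 _ h))// ler_wpM2l ?sqr_ge0// ler_nat.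
apply: le_trans QN; rewrite /Q (bigD1 (Ordinal h))//= lerDl.
by apply: sumr_ge0 => i _; exact: sqr_ge0.
Unshelve. all: by end_near. Qed.

End scaled_sequences.

Section convex_minimization.
Context {R : realType} {n : nat}.
Implicit Types (u v th : 'cV[R]_n).

(* A convex D that is uniformly Delta-close to a quadratic on a ball around
   its minimizer zeta exceeds D zeta on the sphere of radius delta about zeta,
   hence, by convexity, also outside that sphere. *)
Lemma argmin_near (D : 'cV[R]_n -> R) (H : 'M[R]_n) (l M delta Delta : R)
    (W zeta that : 'cV[R]_n) :
  (forall a u v, 0 <= a <= 1 -> D (u + a *: (v - u)) <= D u + a * (D v - D u)) ->
  H^T = H -> (forall u, l * nrm u ^+ 2 <= dotv u (H *m u)) -> H *m zeta = W ->
  (forall th, nrm th <= M ->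
    `|D th - (2^-1 * dotv th (H *m th) - dotv th W)| <= Delta) ->
  D that <= D zeta -> 0 < delta <= 1 -> nrm zeta <= M - 1 ->
  4 * Delta < l * delta ^+ 2 -> nrm (that - zeta) <= delta.
Proof.
move=> cD sH cH Hz DD that_min /andP[d0 d1] zM lD; rewrite leNgt; apply/negP => far.
pose r := nrm (that - zeta); pose a := delta / r.
have r0 : 0 < r by exact: lt_trans far.
have a01 : 0 <= a <= 1 by rewrite divr_ge0 ?(ltW d0) ?(ltW r0)//= ler_pdivrMr// mul1r ltW.
pose u := a *: (that - zeta).
have nZ (c : R) v : nrm (c *: v) = `|c| * nrm v.
  by rewrite /nrm mulr_sumr; apply: eq_bigr => i _; rewrite mxE normrM.
have nu : nrm u = delta.
  by rewrite nZ ger0_norm; [rewrite -/r divfK ?gt_eqF|case/andP: a01].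
have h1 := DD zeta; have h2 := DD (zeta + u).
have {}h1 : `|D zeta - (2^-1 * dotv zeta (H *m zeta) - dotv zeta W)| <= Delta.
  by apply: h1; lra.
have {}h2 : `|D (zeta + u) - (2^-1 * dotv (zeta + u) (H *m (zeta + u)) - dotv (zeta + u) W)| <= Delta.
  by apply: h2; rewrite (le_trans (nrmD _ _))// nu; lra.
have h3 : D (zeta + u) <= D zeta.
  by apply: (le_trans (cD a zeta that a01)); case/andP: a01 => a0 _; nra.
have e1 : dotv (zeta + u) (H *m (zeta + u)) =
    dotv zeta (H *m zeta) + 2 * dotv u W + dotv u (H *m u).
  rewrite mulmxDr !dotvDl !dotvDr [dotv zeta (H *m u)]dotvC dotv_mull sH Hz; ring.
have e2 : dotv (zeta + u) W = dotv zeta W + dotv u W by rewrite dotvDl.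
have h4 := cH u; rewrite nu in h4.
move: h1 h2; rewrite e1 e2 !ler_norml => /andP[h11 h12] /andP[h21 h22].
clear e1 e2 sH Hz; lra.
Qed.

End convex_minimization.

Section composite_expansion.
Context {R : realType} {n K : nat}.
Variables (p : R) (tau : 'I_K -> R).
Hypotheses (p12 : 1 < p <= 2) (tau01 : forall k, 0 < tau k < 1).
Variables (N : nat) (s : 'I_K -> nat -> R) (u : 'I_K -> nat -> 'cV[R]_n).
Implicit Types th : 'cV[R]_n.

Definition loss_diff th := \sum_k \sum_(t < N)
  (eta (tau k) p (s k t - dotv (u k t) th) - eta (tau k) p (s k t)).

Definition score := \sum_k \sum_(t < N) phi (tau k) p (s k t) *: u k t.

Definition hessian := \sum_k \sum_(t < N)
  psiR (tau k) p (s k t) *: (u k t *m (u k t)^T).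

Let p1 : 1 < p. Proof. by case/andP: p12. Qed.

(** The tangent at the intermediate residual lies below both end values; the weights a and 1 - a
    cancel its slope. *)
Lemma loss_diff_convex a th th' : 0 <= a <= 1 ->
  loss_diff (th + a *: (th' - th)) <=
  loss_diff th + a * (loss_diff th' - loss_diff th).
Proof.
move=> /andP[a0 a1]; rewrite /loss_diff -sumrB mulr_sumr -big_split /=.
apply: ler_sum => k _; rewrite -sumrB mulr_sumr -big_split /=.
apply: ler_sum => t _.
have -> : dotv (u k t) (th + a *: (th' - th)) =
    dotv (u k t) th + a * (dotv (u k t) th' - dotv (u k t) th).
  by rewrite dotvDr dotvZr dotvDr dotvNr.
move: (dotv _ th) (dotv _ th') => x y.
set m := s k t - (x + a * (y - x)).
have h1 := eta_ge_tangent m (s k t - x) (tau01 k) p1.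
have h2 := eta_ge_tangent m (s k t - y) (tau01 k) p1.
have e1 : s k t - x - m = a * (y - x) by rewrite /m; ring.
have e2 : s k t - y - m = - ((1 - a) * (y - x)) by rewrite /m; ring.
rewrite e1 in h1; rewrite e2 in h2.
have := ler_wpM2l a0 h2; have := ler_wpM2l (_ : 0 <= 1 - a) h1.
rewrite subr_ge0 => /(_ a1).
move: (eta _ _ _) (eta _ _ _) (eta _ _ _) (eta _ _ _) (phi _ _ _) => A B C E F.
lra.
Qed.

Lemma rho_le x (d d' : R) : d <= d' -> rho p x d <= rho p x d'.
Proof.
move=> dd; rewrite /rho ler_wpM2l ?powR_ge0// le_min ge_min lexx /= ge_min.
by rewrite ler_wpM2r ?orbT// invr_ge0.
Qed.

(** The error bound depends on [th] through M only: this is the uniformity on a ball that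
    [argmin_near] asks for. *)
Lemma loss_diff_expansion (M : R) th : nrm th <= M ->
  (forall k t, (t < N)%N -> s k t != 0 \/ (p = 2 /\ tau k = 2^-1)) ->
  `|loss_diff th - (2^-1 * dotv th (hessian *m th) - dotv th score)| <=
  \sum_k \sum_(t < N) 40 * (M * nrm (u k t)) ^+ 2 * rho p (s k t) (M * nrm (u k t)).
Proof.
move=> thM s0.
have e1 : dotv th (hessian *m th) =
    \sum_k \sum_(t < N) psiR (tau k) p (s k t) * dotv (u k t) th ^+ 2.
  rewrite /hessian mulmx_suml /dotv mulmx_sumr summxE; apply: eq_bigr => k _.
  rewrite mulmx_suml mulmx_sumr summxE; apply: eq_bigr => t _.
  rewrite -scalemxAl -scalemxAr mxE; congr (_ * _).
  have -> : th^T *m (u k t *m (u k t)^T *m th) = (th^T *m u k t) *m ((u k t)^T *m th).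
    by rewrite !mulmxA.
  rewrite [th^T *m u k t]mx11_scalar mul_scalar_mx mxE expr2; congr (_ * _).
  by rewrite -/(dotv th _) dotvC.
have e2 : dotv th score = \sum_k \sum_(t < N) phi (tau k) p (s k t) * dotv (u k t) th.
  rewrite /score /dotv mulmx_sumr summxE; apply: eq_bigr => k _.
  rewrite mulmx_sumr summxE; apply: eq_bigr => t _.
  by rewrite -scalemxAr mxE -/(dotv th _) dotvC.
rewrite e1 e2 /loss_diff mulr_sumr -!sumrB (le_trans (ler_norm_sum _ _ _))// ler_sum// => k _.
rewrite mulr_sumr -!sumrB (le_trans (ler_norm_sum _ _ _))// ler_sum// => t _.
set h := dotv (u k t) th.
have hM : `|h| <= M * nrm (u k t).
  rewrite (le_trans (dotv_nrm _ _))// mulrC ler_wpM2r// nrm_ge0.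
  by [].
have -> : eta (tau k) p (s k t - h) - eta (tau k) p (s k t) -
    (2^-1 * (psiR (tau k) p (s k t) * h ^+ 2) - phi (tau k) p (s k t) * h) =
    taylor_rem (tau k) p (s k t) h - 2^-1 * psiR (tau k) p (s k t) * h ^+ 2.
  by rewrite /taylor_rem; ring.
apply: le_trans (taylor_rem_bound _ (tau01 k) p12 (s0 k t (ltn_ord t))) _.
have M0 : 0 <= M * nrm (u k t) by exact: le_trans hM.
have r0 x y : 0 <= y -> 0 <= rho p x y.
  by move=> y0; rewrite /rho mulr_ge0 ?powR_ge0// le_min ler01 divr_ge0.
apply: ler_pM => //.
- by rewrite mulr_ge0// sqr_ge0.
- exact: r0.
- by rewrite ler_pM2l// -[leLHS]real_normK ?num_real// ler_sqr ?nnegrE.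
- exact: rho_le.
Qed.

End composite_expansion.

(** * Measurability of the loss, its derivatives and the remainder modulus *)

Section measurability.
Context {R : realType}.

Lemma measurable_weight tau : measurable_fun setT (@weight R tau).
Proof.
have -> : @weight R tau = fun s => if s < 0 then `|tau - 1| else `|tau|.
  by apply/funext => s; rewrite /weight; case: ltP => _; rewrite ?subr0.
by apply: measurable_fun_ifT => //; exact: measurable_fun_ltr.
Qed.

Lemma measurable_norm_powR (q : R) : measurable_fun setT (fun s : R => `|s| `^ q).
Proof. by apply: (measurableT_comp (measurable_powR q)). Qed.

Lemma measurable_eta tau (p : R) : measurable_fun setT (eta tau p).
Proof.
by apply: measurable_funM; [exact: measurable_weight|exact: measurable_norm_powR].
Qed.

Lemma measurable_phi tau (p : R) : measurable_fun setT (phi tau p).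
Proof.
apply: measurable_funM.
  apply: measurable_funM; last exact: measurable_norm_powR.
  by apply: measurable_funM => //; exact: measurable_weight.
have -> : @Num.sg R = fun s => if s < 0 then -1 else if 0 < s then 1 else 0.
  by apply/funext => s; case: sgrP.
apply: measurable_fun_ifT => //; first exact: measurable_fun_ltr.
by apply: measurable_fun_ifT => //; exact: measurable_fun_ltr.
Qed.

Lemma measurable_psiR tau (p : R) : measurable_fun setT (psiR tau p).
Proof.
apply: measurable_funM; last exact: measurable_norm_powR.
by apply: measurable_funM => //; exact: measurable_weight.
Qed.

(** Reduced to the real power with exponent -1, which also takes the value 0 at 0; inversion itself
    is not continuous there. *)
Lemma measurable_invr : measurable_fun setT (@GRing.inv R).
Proof.
have -> : @GRing.inv R = fun s => if s < 0 then - `|s| `^ (-1) else `|s| `^ (-1).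
  apply/funext => s; have [s0|s0] := ltP s 0.
    by rewrite powR_inv1// ltr0_norm// invrN opprK.
  by rewrite powR_inv1// ger0_norm.
apply: measurable_fun_ifT; first exact: measurable_fun_ltr.
  by apply: measurableT_comp => //; exact: measurable_norm_powR.
exact: measurable_norm_powR.
Qed.

Lemma measurable_rho (p delta : R) : measurable_fun setT (fun s => rho p s delta).
Proof.
apply: measurable_funM; first exact: measurable_norm_powR.
apply: measurable_minr => //; apply: measurable_funM => //.
by apply: (measurableT_comp measurable_invr).
Qed.

Lemma integ_psiR d (T : measurableType d) (P : probability T R) (X : T -> R) tau p :
  measurable_fun setT X -> 0 < tau < 1 -> 1 < p ->
  integ P (fun w => `|X w| `^ (p - 2)) -> integ P (fun w => psiR tau p (X w)).
Proof.
move=> mX t01 p1 iX; apply: (integ_le _ _ (integZ (p * (p - 1)) iX)).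
  exact: (measurableT_comp (measurable_psiR _ _) mX).
by move=> w; rewrite ger0_norm ?psiR_ge0// psiR_le.
Qed.

End measurability.

(** * Linear expansion of the minimizer for a general scaled design *)

Section m_estimation.
Context d (T : measurableType d) (R : realType) (P : probability T R) {n K : nat}.
Variables (eps : nat -> {RV P >-> R}) (e : {RV P >-> R}).
Hypothesis eps_indep : mutually_independent eps.
Hypothesis eps_id : identically_distributed eps e.
Variables (p : R) (tau b : 'I_K -> R).
Hypotheses (p12 : 1 < p <= 2) (tau01 : forall k, 0 < tau k < 1).
Hypothesis iphi : forall k, integ P (fun w => phi (tau k) p (e w - b k)).
Hypothesis iphi2 : forall k, integ P (fun w => phi (tau k) p (e w - b k) ^+ 2).
Hypothesis Ephi : forall k, Ex P (fun w => phi (tau k) p (e w - b k)) = 0.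
Hypothesis ipow : forall k, integ P (fun w => `|e w - b k| `^ (p - 2)).
Hypothesis atom : forall k,
  (p = 2 /\ tau k = 2^-1) \/ P [set w | e w = b k] = 0%E.
Variables (z : 'I_K -> nat -> 'cV[R]_n) (G : 'I_K -> 'M[R]_n).
Hypothesis zG : forall k i j,
  N%:R^-1 * \sum_(t < N) (z k t i 0 * z k t j 0) @[N --> \oo] --> G k i j.

Let s w (k : 'I_K) t := eps t w - b k.
Let u N k t := (Num.sqrt N%:R)^-1 *: z k t.
Let W N w := score p tau N (s w) (u N).
Let psibar k := Ex P (fun w => psiR (tau k) p (e w - b k)).
Let H := \sum_k psibar k *: G k.
Hypothesis H_pd : posdefmx H.
Let p1 : 1 < p. Proof. by case/andP: p12. Qed.

Let uE N k t i : u N k t i 0 = z k t i 0 / Num.sqrt N%:R.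
Proof. by rewrite mxE mulrC. Qed.

Let zG2 k i : N%:R^-1 * \sum_(t < N) z k t i 0 ^+ 2 @[N --> \oo] --> G k i i.
Proof. by under eq_fun do under eq_bigr do rewrite expr2; exact: zG. Qed.

Let u2_bounded : exists B, \forall N \near \oo, forall k i, \sum_(t < N) u N k t i 0 ^+ 2 <= B.
Proof.
exists (\sum_k \sum_i (`|G k i i| + 1)).
have h : \forall N \near \oo, forall k i, \sum_(t < N) u N k t i 0 ^+ 2 <= G k i i + 1.
  apply: filter_forall => k; apply: filter_forall => i.
  apply: filterS (@scaled_sqr_bounded _ (fun t => z k t i 0) _ (@zG2 k i)) => N.
  by under [in X in _ -> X]eq_bigr do rewrite uE.
apply: filterS h => N h k i; apply: (le_trans (h k i)).
rewrite (bigD1 k)//= (bigD1 i)//= -addrA ler_wpDr ?lerD2r ?ler_norm//.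
rewrite addr_ge0// sumr_ge0// => j _; rewrite ?addr_ge0//.
by apply: sumr_ge0 => l _; rewrite addr_ge0.
Qed.

Let u_vanish (delta : R) : 0 < delta ->
  \forall N \near \oo, forall k i t, (t < N)%N -> `|u N k t i 0| <= delta.
Proof.
move=> d0; apply: filter_forall => k; apply: filter_forall => i.
apply: filterS (@scaled_vanish _ (fun t => z k t i 0) _ (@zG2 k i) _ d0) => N h t tN.
by rewrite uE; exact: h.
Qed.

Let shifted (F : R -> R) k t : measurable_fun setT F ->
  integ P (fun w => F (e w - b k)) ->
  integ P (fun w => F (s w k t)) /\ Ex P (fun w => F (s w k t)) = Ex P (fun w => F (e w - b k)).
Proof.
move=> mF iF; have mF' : measurable_fun setT (fun x : R => F (x - b k)).
  by apply: (measurableT_comp mF); exact: measurable_funB.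
exact: (Ex_eps eps_id t mF' iF).
Qed.

Let ipsi k : integ P (fun w => psiR (tau k) p (e w - b k)).
Proof. by apply: integ_psiR => //; exact: measurable_funB. Qed.

Let mphi k : measurable_fun setT (fun x : R => phi (tau k) p (x - b k)).
Proof. by apply: (measurableT_comp (measurable_phi _ _)); exact: measurable_funB. Qed.

Let W_component N w i : W N w i 0 = \sum_k \sum_(t < N) u N k t i 0 * phi (tau k) p (s w k t).
Proof.
rewrite /W /score summxE; apply: eq_bigr => k _; rewrite summxE; apply: eq_bigr => t _.
by rewrite mxE mulrC.
Qed.

Lemma integ_score N i : integ P (fun w => W N w i 0).
Proof.
under eq_fun do rewrite W_component.
apply: integ_sum => k; apply: integ_sum => t; apply: integZ.
exact: (shifted t (measurable_phi _ _) (iphi k)).1.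
Qed.

(** Each component is a finite sum of weighted sums of bounded variance; |x| <= 1 + x^2 turns this
    into bounded first moments. *)
Lemma score_tight : exists B, \forall N \near \oo,
  integ P (fun w => nrm (W N w)) /\ Ex P (fun w => nrm (W N w)) <= B.
Proof.
have [B hB] := u2_bounded.
exists (\sum_(i < n) \sum_k (1 + B * Ex P (fun w => phi (tau k) p (e w - b k) ^+ 2))).
apply: filterS hB => N hB; have iW : integ P (fun w => nrm (W N w)).
  by apply: integ_sum => i; apply: integ_norm; exact: integ_score.
split => //.
have S2 k i := weighted_sum_variance eps_indep eps_id (fun t => u N k t i 0) N
  (mphi k) (iphi k) (iphi2 k) (Ephi k).
rewrite [leLHS]Ex_sum; last by move=> i; apply: integ_norm; exact: integ_score.
apply: ler_sum => i _.
apply: (@le_trans _ _ (Ex P (fun w => \sum_k (1 +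
    (\sum_(t < N) u N k t i 0 * phi (tau k) p (s w k t)) ^+ 2)))).
  apply: Ex_le.
  - by apply: integ_norm; exact: integ_score.
  - by apply: integ_sum => k; apply: integD; [exact: integ_cst|exact: (S2 k i).1].
  move=> w; rewrite W_component (le_trans (ler_norm_sum _ _ _))// ler_sum// => k _.
  by rewrite (le_trans (norm_le_amgm _ ltr01))// invr1 mul1r.
rewrite Ex_sum; last by move=> k; apply: integD; [exact: integ_cst|exact: (S2 k i).1].
apply: ler_sum => k _; rewrite ExD; [|exact: integ_cst|exact: (S2 k i).1].
rewrite Ex_cst lerD2l (S2 k i).2 ler_wpM2r//.
by apply: Ex_ge0 => w; exact: sqr_ge0.
Qed.

Let hess N w := hessian p tau N (s w) (u N).

Let hess_component N w i j : hess N w i j =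
  \sum_k \sum_(t < N) (u N k t i 0 * u N k t j 0) * psiR (tau k) p (s w k t).
Proof.
rewrite /hess /hessian summxE; apply: eq_bigr => k _; rewrite summxE; apply: eq_bigr => t _.
rewrite [LHS]mxE mulrC; congr (_ * _); rewrite [LHS]mxE big_ord_recl big_ord0 addr0.
by congr (_ * _); rewrite [LHS]mxE.
Qed.

Let integ_psi_s k t : integ P (fun w => psiR (tau k) p (s w k t)).
Proof. exact: (shifted t (measurable_psiR _ _) (ipsi k)).1. Qed.

Let hess_err N w := \sum_i \sum_j `|hess N w i j - H i j|.

Let integ_hess_err N : integ P (hess_err N).
Proof.
apply: integ_sum => i; apply: integ_sum => j; apply: integ_norm.
apply: integB; last exact: integ_cst.
under eq_fun do rewrite hess_component.
by apply: integ_sum => k; apply: integ_sum => t; apply: integZ; exact: integ_psi_s.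
Qed.

(** Entrywise, the error splits into a weighted sum of centered values of [psiR], small by
    [weighted_lln], and [psibar] times the error of the Gram average. *)
Lemma hessian_small (e0 : R) : 0 < e0 ->
  \forall N \near \oo, Ex P (hess_err N) <= e0.
Proof.
move=> e00; have psi0 k : 0 <= psibar k by apply: Ex_ge0 => w; exact: psiR_ge0 (tau01 k) p1.
pose S := \sum_(i < n) \sum_(j < n) \sum_k (1 + psibar k).
have S0 : 0 <= S.
  by do 3![apply: sumr_ge0 => ? _]; rewrite addr_ge0.
pose e1 := e0 / (S + 1).
have e10 : 0 < e1 by rewrite divr_gt0// ltr_wpDl.
have [B hB] := u2_bounded.
pose c k i j N t := u N k t i 0 * u N k t j 0.
have cB k i j : \forall N \near \oo, \sum_(t < N) `|c k i j N t| <= B + B.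
  apply: filterS hB => N h.
  apply: le_trans (lerD (h k i) (h k j)); rewrite -big_split ler_sum// => t _ /=.
  rewrite normrM -[u N k t i 0 ^+ 2]real_normK ?num_real// -[u N k t j 0 ^+ 2]real_normK ?num_real//.
  by move: (`|_|) (`|_|) => x y; have := sqr_ge0 (x - y); have := sqr_ge0 (x + y); nra.
have cv k i j delta : 0 < delta ->
    \forall N \near \oo, forall t, (t < N)%N -> `|c k i j N t| <= delta.
  (* A weight is a product of two entries: one factor is bounded by 1, the other by delta. *)
  move=> d0; have d1 : 0 < Num.min 1 delta by rewrite lt_min ltr01.
  apply: filterS (u_vanish d1) => N h t tN.
  have := h k i t tN; have := h k j t tN; rewrite !le_min => /andP[y1 yd] /andP[x1 xd].
  by rewrite normrM -[delta]mul1r ler_pM.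
have cA k i j : \forall N \near \oo, Ex P (fun w =>
    `|\sum_(t < N) c k i j N t * (psiR (tau k) p (s w k t) - psibar k)|) <= e1.
  have mpsi : measurable_fun setT (fun x : R => psiR (tau k) p (x - b k)).
    by apply: (measurableT_comp (measurable_psiR _ _)); exact: measurable_funB.
  have /cvgrPdist_le/(_ _ e10) := @weighted_lln _ _ _ P eps e eps_indep eps_id
    (fun x : R => psiR (tau k) p (x - b k)) (c k i j) _ mpsi
    (fun x => psiR_ge0 _ (tau01 k) p1) (ipsi k) (cB k i j) (cv k i j).
  apply: filterS => N; rewrite sub0r normrN; apply: le_trans; exact: ler_norm.
have cG k i j : \forall N \near \oo, `|\sum_(t < N) c k i j N t - G k i j| <= e1.
  have /cvgrPdist_le/(_ _ e10) := @zG k i j.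
  apply: filterS => N; rewrite distrC; congr (`|_ - _| <= _).
  rewrite mulr_sumr; apply: eq_bigr => t _; rewrite /c !uE.
  have -> : (N%:R : R)^-1 = (Num.sqrt N%:R)^-1 * (Num.sqrt N%:R)^-1.
    by rewrite -invfM -expr2 sqr_sqrtr.
  by ring.
have : \forall N \near \oo, forall k i j,
    Ex P (fun w => `|\sum_(t < N) c k i j N t * (psiR (tau k) p (s w k t) - psibar k)|) <= e1 /\
    `|\sum_(t < N) c k i j N t - G k i j| <= e1.
  apply: filter_forall => k; apply: filter_forall => i; apply: filter_forall => j.
  exact: filterI (cA k i j) (cG k i j).
apply: filterS => N h.
have iA k i j : integ P (fun w =>
    `|\sum_(t < N) c k i j N t * (psiR (tau k) p (s w k t) - psibar k)|).
  apply: integ_norm; apply: integ_sum => t; apply: integZ; apply: integB => //.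
  exact: integ_cst.
have iAB k i j : integ P (fun w =>
    `|\sum_(t < N) c k i j N t * (psiR (tau k) p (s w k t) - psibar k)| +
    psibar k * `|\sum_(t < N) c k i j N t - G k i j|).
  by apply: integD; [exact: iA|exact: integ_cst].
apply: (@le_trans _ _ (Ex P (fun w => \sum_i \sum_j \sum_k
    (`|\sum_(t < N) c k i j N t * (psiR (tau k) p (s w k t) - psibar k)| +
     psibar k * `|\sum_(t < N) c k i j N t - G k i j|)))).
  apply: Ex_le => //.
    by apply: integ_sum => i; apply: integ_sum => j; apply: integ_sum => k; exact: iAB.
  move=> w; apply: ler_sum => i _; apply: ler_sum => j _.
  rewrite hess_component /H summxE -sumrB (le_trans (ler_norm_sum _ _ _))// ler_sum// => k _.
  rewrite mxE.
  have -> : \sum_(t < N) u N k t i 0 * u N k t j 0 * psiR (tau k) p (s w k t) -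
      psibar k * G k i j =
      \sum_(t < N) c k i j N t * (psiR (tau k) p (s w k t) - psibar k) +
      psibar k * (\sum_(t < N) c k i j N t - G k i j).
    under [X in _ = X + _]eq_bigr do rewrite mulrBr.
    by rewrite sumrB -mulr_suml mulrBr /c; ring.
  by rewrite (le_trans (ler_normD _ _))// lerD2l normrM ger0_norm.
rewrite Ex_sum; last first.
  by move=> i; apply: integ_sum => j; apply: integ_sum => k; exact: iAB.
apply: (@le_trans _ _ (\sum_(i < n) \sum_(j < n) \sum_k (1 + psibar k) * e1)).
  apply: ler_sum => i _; rewrite Ex_sum; last first.
    by move=> j; apply: integ_sum => k; exact: iAB.
  apply: ler_sum => j _; rewrite Ex_sum; last by move=> k; exact: iAB.
  apply: ler_sum => k _; rewrite ExD//; last exact: integ_cst.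
  have [h1 h2] := h k i j.
  by rewrite Ex_cst mulrDl mul1r lerD// ler_wpM2l.
rewrite (_ : \sum_(i < n) _ = S * e1); last first.
  rewrite mulr_suml; apply: eq_bigr => i _; rewrite mulr_suml; apply: eq_bigr => j _.
  by rewrite mulr_suml.
by rewrite /e1 mulrCA ler_piMr ?(ltW e00)// ler_pdivrMr ?ltr_wpDl// mul1r lerDl.
Qed.

Let remainder (M : R) N w := \sum_k \sum_(t < N)
  40 * (M * nrm (u N k t)) ^+ 2 * rho p (s w k t) (M * nrm (u N k t)).

Let integ_rho k (x : R) : 0 <= x -> integ P (fun w => rho p (e w - b k) x).
Proof.
move=> x0; apply: (integ_le _ _ (ipow k)).
  by apply: (measurableT_comp (measurable_rho _ _)); exact: measurable_funB.
move=> w; rewrite /rho ger0_norm; last first.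
  by rewrite mulr_ge0 ?powR_ge0// le_min ler01 divr_ge0.
by rewrite ler_piMr ?powR_ge0// ge_min lexx.
Qed.

Let Mu_ge0 M N k t : 0 <= M -> 0 <= M * nrm (u N k t).
Proof. by move=> M0; rewrite mulr_ge0// nrm_ge0. Qed.

Let integ_remainder M N : 0 <= M -> integ P (remainder M N).
Proof.
move=> M0; apply: integ_sum => k; apply: integ_sum => t; apply: integZ.
apply: (shifted t (measurable_rho _ _) (integ_rho k _)).1; exact: Mu_ge0.
Qed.

(** The squared steps have a bounded sum, while each step tends to 0 uniformly, which drives the
    mean of [rho] below any e1. *)
Lemma remainder_small (M e0 : R) : 0 < M -> 0 < e0 ->
  \forall N \near \oo, Ex P (remainder M N) <= e0.
Proof.
move=> M0 e00; have [B hB] := u2_bounded.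
pose S := K%:R * (40 * M ^+ 2 * (n%:R * (n%:R * `|B|))).
have S0 : 0 <= S.
  by apply: mulr_ge0 => //; apply: mulr_ge0; [apply: mulr_ge0 => //; exact: sqr_ge0|rewrite !mulr_ge0].
pose e1 := e0 / (S + 1).
have e10 : 0 < e1 by rewrite divr_gt0// ltr_wpDl.
have hrho k : exists2 delta : R, 0 < delta &
    forall x, 0 <= x <= delta -> Ex P (fun w => rho p (e w - b k) x) <= e1.
  have mk : measurable_fun setT (fun w => `|e w - b k|^-1).
    apply: (measurableT_comp measurable_invr); apply: measurableT_comp => //.
    exact: measurable_funB.
  have [|delta d0 hd] := Ex_min_small (ipow k) (fun w => powR_ge0 _ _) mk _ e10.
    by move=> w; rewrite invr_ge0.
  by exists delta => // x /hd.
have {hrho} [delta d0 hd] : exists2 delta : R, 0 < delta & forall k x, 0 <= x <= delta ->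
    Ex P (fun w => rho p (e w - b k) x) <= e1.
  pose dl k := projT1 (cid2 (hrho k)).
  have dlP k : 0 < dl k by rewrite /dl; case: cid2.
  exists (\big[Num.min/1]_k dl k).
    by elim/big_ind: _ => // x y x0 y0; rewrite lt_min x0.
  move=> k x /andP[x0 xd].
  have : x <= dl k by apply: le_trans xd _; exact: bigmin_le.
  by rewrite /dl; case: cid2 => /= y _ hy xy; apply: hy; rewrite x0.
(* Entries of this size keep the step M nrm(u) within delta; n + 1 rather than n covers dimension
   0. *)
have d1 : 0 < delta / (M * (n%:R + 1)).
  by rewrite divr_gt0// mulr_gt0// ltr_wpDl.
near=> N.
have uN : forall k i t, (t < N)%N -> `|u N k t i 0| <= delta / (M * (n%:R + 1)).
  by near: N; exact: u_vanish.
have uB : forall k i, \sum_(t < N) u N k t i 0 ^+ 2 <= B by near: N.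
rewrite /remainder Ex_sum; last first.
  move=> k; apply: integ_sum => t; apply: integZ.
  by apply: (shifted t (measurable_rho _ _) (integ_rho k _)).1; apply: Mu_ge0; exact: ltW.
apply: (@le_trans _ _ (\sum_(k < K) (40 * M ^+ 2 * (n%:R * (n%:R * `|B|)) * e1))).
  apply: ler_sum => k _; rewrite Ex_sum; last first.
    move=> t; apply: integZ.
    by apply: (shifted t (measurable_rho _ _) (integ_rho k _)).1; apply: Mu_ge0; exact: ltW.
  apply: (@le_trans _ _ (\sum_(t < N) (40 * (M * nrm (u N k t)) ^+ 2 * e1))).
    apply: ler_sum => t _.
    have [ir Er] := shifted t (measurable_rho _ _) (integ_rho k (Mu_ge0 N k t (ltW M0))).
    rewrite ExZ// Er ler_wpM2l//; first by apply: mulr_ge0 => //; exact: sqr_ge0.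
    apply: hd; rewrite Mu_ge0 ?(ltW M0)//= mulrC -ler_pdivlMr//.
    apply: (@le_trans _ _ (\sum_(i < n) delta / (M * (n%:R + 1)))).
      by apply: ler_sum => i _; exact: uN.
    rewrite sumr_const card_ord -[leLHS]mulr_natl.
    have -> : n%:R * (delta / (M * (n%:R + 1))) = delta / M * (n%:R / (n%:R + 1)).
      by field; rewrite !gt_eqF// ltr_wpDl.
    by rewrite ler_piMr ?divr_ge0 ?(ltW d0) ?(ltW M0)// ler_pdivrMr ?ltr_wpDl// mul1r lerDl.
  rewrite -mulr_suml ler_wpM2r ?(ltW e10)//.
  under eq_bigr do rewrite exprMn mulrA.
  rewrite -mulr_sumr ler_wpM2l//; first by apply: mulr_ge0 => //; exact: sqr_ge0.
  apply: (@le_trans _ _ (\sum_(t < N) n%:R * \sum_i u N k t i 0 ^+ 2)).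
    apply: ler_sum => t _; apply: (le_trans (nrm_sqr _)); rewrite dotvE.
    by under eq_bigr do rewrite -expr2.
  rewrite -mulr_sumr ler_wpM2l// exchange_big /=.
  apply: (@le_trans _ _ (\sum_(i < n) `|B|)).
    by apply: ler_sum => i _; rewrite (le_trans (uB k i))// ler_norm.
  by rewrite sumr_const card_ord -[leLHS]mulr_natl.
rewrite sumr_const card_ord -[leLHS]mulr_natl mulrA -/S.
by rewrite /e1 mulrCA ler_piMr ?(ltW e00)// ler_pdivrMr ?ltr_wpDl// mul1r lerDl.
Unshelve. all: by end_near. Qed.

(* chi marks the points where the second-order expansion of the loss fails. *)
Let chi k : R -> R :=
  if `[< p = 2 /\ tau k = 2^-1 >] then fun=> 0 else \1_[set 0].

Let chi_ge0 k x : 0 <= chi k x.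
Proof. by rewrite /chi; case: asboolP => // _; rewrite indicE. Qed.

Let chiP k x : (x != 0 \/ (p = 2 /\ tau k = 2^-1)) \/ chi k x = 1.
Proof.
rewrite /chi; case: asboolP => h; first by left; right.
have [->|x0] := eqVneq x 0; last by left; left.
by right; rewrite indicE mem_set.
Qed.

Let chi0 k t : integ P (fun w => chi k (s w k t)) /\ Ex P (fun w => chi k (s w k t)) = 0.
Proof.
have mchi : measurable_fun setT (chi k).
  by rewrite /chi; case: asboolP => _ //; exact: measurable_indic.
have ichi : integ P (fun w => chi k (e w - b k)).
  apply: (@integ_bounded _ _ _ _ _ 1).
    by apply: (measurableT_comp mchi); exact: measurable_funB.
  move=> w; rewrite ger0_norm// /chi; case: asboolP => _; first exact: ler01.
  by rewrite indicE; case: (_ \in _); rewrite ?ler01.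
have [i1 ->] := shifted t mchi ichi; split => //.
have [h|P0] := atom k.
  by rewrite /chi asboolT// Ex_cst.
apply/eqP; rewrite eq_le Ex_ge0// andbT -[leRHS](Ex_cst P 0).
apply: Ex_le_ae => //; first exact: integ_cst.
exists [set w | e w = b k]; split => //.
  have -> : [set w | e w = b k] = e @^-1` [set b k] by [].
  exact: measurable_funPTI.
move=> w /= hw; apply: contrapT => ew; apply: hw.
rewrite /chi; case: asboolP => // _; rewrite indicE memNset//= => /eqP.
by rewrite subr_eq0 => /eqP.
Qed.

Let zeta N w := invmx H *m W N w.

(** Each bad event makes one summand of the majorant reach 1, which bounds the truncated distance
    trivially: a residual at a point marked by [chi], a large [zeta], a large approximation error
    [Dl]. Off these events [argmin_near] gives delta. *)
Theorem argmin_expansion (that : nat -> T -> 'cV[R]_n) :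
  (forall N w th, loss_diff p tau N (s w) (u N) (that N w) <=
                  loss_diff p tau N (s w) (u N) th) ->
  forall e0 : R, 0 < e0 -> \forall N \near \oo,
    exists2 g, integ P g /\ Ex P g <= e0 &
      forall w, Num.min 1 (nrm (that N w - zeta N w)) <= g w.
Proof.
move=> that_min e0 e00; have [B hB] := score_tight.
have [l l0 hl] := posdef_coercive H_pd; have uH := posdef_unitmx H_pd.
pose C0 := \sum_i \sum_j `|invmx H i j|.
have C00 : 0 <= C0 by do 2![apply: sumr_ge0 => ? _].
pose delta := Num.min 1 (e0 / 4).
have d0 : 0 < delta by rewrite lt_min ltr01 divr_gt0.
have d1 : delta <= 1 by rewrite ge_min lexx.
have de : delta <= e0 / 4 by rewrite ge_min lexx orbT.
(* Markov: the mean of [nrm zeta] is at most C0 |B|, so that of M'^-1 nrm(zeta) is at most e0/4. *)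
pose M' := 4 * (C0 * `|B|) / e0 + 1.
have CB0 : 0 <= C0 * `|B| by rewrite mulr_ge0.
have M'0 : 0 < M' by rewrite ltr_wpDl// divr_ge0 ?(ltW e00)// mulr_ge0.
pose M := M' + 1; have M0 : 0 < M by rewrite addr_gt0.
have ld0 : 0 < l * delta ^+ 2 by rewrite mulr_gt0// exprn_gt0.
(* With this factor, kap Dl < 1 implies the condition 4 Dl < l delta^2 of [argmin_near]. The two
   thresholds below bound the mean of each part of kap Dl by e0/8. *)
pose kap := 8 / (l * delta ^+ 2); have k0 : 0 < kap by rewrite divr_gt0.
have e20 : 0 < e0 / (8 * kap) by rewrite divr_gt0// mulr_gt0.
have e30 : 0 < e0 / (4 * kap * M ^+ 2).
  by rewrite divr_gt0//; apply: mulr_gt0; [rewrite mulr_gt0|rewrite exprn_gt0].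
apply: filterS (filterI hB (filterI (remainder_small M0 e20) (hessian_small e30))).
move=> N [[iW EW] [Er Eh]].
have mzeta i : integ P (fun w => zeta N w i 0).
  rewrite /zeta; under eq_fun do rewrite mxE.
  by apply: integ_sum => j; apply: integZ; exact: integ_score.
have izeta : integ P (fun w => nrm (zeta N w)).
  by apply: integ_sum => i; apply: integ_norm.
have Ezeta : Ex P (fun w => nrm (zeta N w)) <= C0 * `|B|.
  apply: (@le_trans _ _ (Ex P (fun w => C0 * nrm (W N w)))).
    by apply: Ex_le => //; [exact: integZ|move=> w; exact: nrm_mulmx].
  by rewrite ExZ// ler_wpM2l// (le_trans EW)// ler_norm.
have ir := integ_remainder N (ltW M0); have ih := integ_hess_err N.
pose Dl w := remainder M N w + 2^-1 * M ^+ 2 * hess_err N w.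
have iD : integ P Dl by apply: integD => //; exact: integZ.
pose X w := \sum_k \sum_(t < N) chi k (s w k t).
have iX : integ P X by apply: integ_sum => k; apply: integ_sum => t; exact: (chi0 k t).1.
have EX : Ex P X = 0.
  rewrite Ex_sum; last by move=> k; apply: integ_sum => t; exact: (chi0 k t).1.
  apply: big1 => k _; rewrite Ex_sum; last by move=> t; exact: (chi0 k t).1.
  by apply: big1 => t _; exact: (chi0 k t).2.
have h0 w : 0 <= hess_err N w by do 2![apply: sumr_ge0 => ? _].
have r0 w : 0 <= remainder M N w.
  apply: sumr_ge0 => k _; apply: sumr_ge0 => t _; apply: mulr_ge0.
    by apply: mulr_ge0 => //; exact: sqr_ge0.
  by rewrite /rho mulr_ge0 ?powR_ge0// le_min ler01 divr_ge0// Mu_ge0// ltW.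
have D0 w : 0 <= Dl w.
  by apply: addr_ge0 => //; apply: mulr_ge0 => //; apply: mulr_ge0 => //; exact: sqr_ge0.
have X0 w : 0 <= X w by do 2![apply: sumr_ge0 => ? _].
exists (fun w => delta + kap * Dl w + (M'^-1 * nrm (zeta N w) + X w)).
  have iA : integ P (fun w => delta + kap * Dl w).
    by apply: integD; [exact: integ_cst|exact: integZ].
  have iB : integ P (fun w => M'^-1 * nrm (zeta N w) + X w).
    by apply: integD => //; exact: integZ.
  split; first exact: integD.
  rewrite ExD// ExD; [|exact: integ_cst|exact: integZ].
  rewrite Ex_cst ExZ// ExD//; last exact: integZ.
  rewrite ExD//; last exact: integZ.
  rewrite !ExZ// EX addr0.
  have b1 : kap * Ex P (remainder M N) <= e0 / 8.
    apply: (le_trans (ler_wpM2l (ltW k0) Er)).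
    by rewrite le_eqVlt; apply/orP; left; apply/eqP; field; rewrite gt_eqF.
  have b2 : kap * (2^-1 * M ^+ 2 * Ex P (hess_err N)) <= e0 / 8.
    have km : 0 <= kap * (2^-1 * M ^+ 2).
      by apply: mulr_ge0; [exact: ltW|apply: mulr_ge0 => //; exact: sqr_ge0].
    rewrite mulrA; apply: (le_trans (ler_wpM2l km Eh)).
    by rewrite le_eqVlt; apply/orP; left; apply/eqP; field; rewrite !gt_eqF.
  have b3 : M'^-1 * Ex P (fun w => nrm (zeta N w)) <= e0 / 4.
    rewrite mulrC ler_pdivrMr// (le_trans Ezeta)// /M' mulrDr mulr1.
    have -> : e0 / 4 * (4 * (C0 * `|B|) / e0) = C0 * `|B| by field; rewrite gt_eqF.
    by rewrite lerDl divr_ge0// ltW.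
  rewrite mulrDr; lra.
move=> w.
have zM0 : 0 <= M'^-1 * nrm (zeta N w) by rewrite mulr_ge0 ?nrm_ge0// invr_ge0 ltW.
have kD0 : 0 <= kap * Dl w by rewrite mulr_ge0// ltW.
have [good|bad] := pselect (forall k t, (t < N)%N -> s w k t != 0 \/ (p = 2 /\ tau k = 2^-1)); last first.
  suff X1 : 1 <= X w by rewrite ge_min; apply/orP; left; have := X0 w; lra.
  apply: contrapT => X1; apply: bad => k t tN; have [//|c1] := chiP k (s w k t).
  exfalso; apply: X1; rewrite /X (bigD1 k)//= (bigD1 (Ordinal tN))//= c1 -addrA.
  rewrite lerDl addr_ge0//; last by do 2![apply: sumr_ge0 => ? _].
  by apply: sumr_ge0.
have [zM|zM] := leP (nrm (zeta N w)) M'; last first.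
  have : 1 <= M'^-1 * nrm (zeta N w) by rewrite mulrC ler_pdivlMr// mul1r ltW.
  by rewrite ge_min => h; apply/orP; left; have := X0 w; lra.
have [kD|kD] := leP 1 (kap * Dl w).
  by rewrite ge_min; apply/orP; left; have := X0 w; lra.
rewrite ge_min; apply/orP; right.
apply: (@le_trans _ _ delta); last by have := X0 w; lra.
have [sH _] := H_pd.
apply: (@argmin_near _ _ (loss_diff p tau N (s w) (u N)) H l M delta (Dl w) (W N w)) => //.
- by move=> a v v' a01; exact: loss_diff_convex.
- by rewrite mulmxA mulmxV// mul1mx.
- move=> th thM; rewrite [Dl w]/(remainder M N w + _).
  have e1 := loss_diff_expansion p12 tau01 (u N) thM good.
  have e2 : `|dotv th ((hess N w - H) *m th)| <= M ^+ 2 * hess_err N w.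
    apply: (le_trans (dotv_nrm _ _)); rewrite expr2 -mulrA ler_pM ?nrm_ge0//.
    apply: (le_trans (nrm_mulmx _ _)).
    have -> : \sum_i \sum_j `|(hess N w - H) i j| = hess_err N w.
      by do 2![apply: eq_bigr => ? _]; rewrite !mxE.
    by rewrite mulrC ler_wpM2r.
  rewrite mulmxBl dotvDr dotvNr in e2.
  apply: (@le_trans _ _ (remainder M N w + 2^-1 * (M ^+ 2 * hess_err N w))); last by rewrite mulrA.
  move: e1 e2; rewrite -/(hess N w) -/(W N w) -/(remainder M N w) !ler_norml.
  move: (loss_diff _ _ _ _ _ _) (dotv th (H *m th)) (dotv th (hess N w *m th)) (dotv th (W N w)).
  move=> a1 a2 a3 a4 /andP[? ?] /andP[? ?]; clear uH sH; lra.
- by rewrite d0.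
- by rewrite /M addrK.
- rewrite -(ltr_pM2l k0); apply: (@lt_le_trans _ _ 4).
    by rewrite mulrCA -[ltRHS]mulr1 ltr_pM2l.
  by rewrite /kap divfK ?gt_eqF// ler_nat.
Qed.

End m_estimation.

(** * Moments and first-order condition *)

Section moments.
Context {R : realType}.

(** The distance is at most twice the larger modulus, and 2^q <= 4. *)
Lemma powR_normB (q x y : R) : 0 <= q <= 2 ->
  `|x - y| `^ q <= 4 * (`|x| `^ q + `|y| `^ q).
Proof.
move=> /andP[q0 q2]; set m := Num.max `|x| `|y|.
have m0 : 0 <= m by rewrite le_max normr_ge0.
apply: (@le_trans _ _ ((2 * m) `^ q)).
  apply: ge0_ler_powR => //; rewrite ?nnegrE ?mulr_ge0//.
  by rewrite (le_trans (ler_normB _ _))// mulr_natl mulr2n lerD// le_max lexx ?orbT.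
rewrite powRM//; apply: ler_pM; rewrite ?powR_ge0//.
  have -> : 4 = 2 `^ 2 :> R by rewrite powR_mulrn// expr2 -natrM.
  by apply: ler_powR => //; rewrite ler1n.
by rewrite /m /Num.max; case: ifP => _; rewrite ?lerDl ?lerDr powR_ge0.
Qed.

Lemma norm_phi_le tau (p s : R) : 0 < tau < 1 -> 1 < p <= 2 ->
  `|phi tau p s| <= 2 * `|s| `^ (p - 1).
Proof.
move=> t01 /andP[p1 p2]; rewrite /phi normrM.
have w0 := weight_gt0 s t01; have w1 := weight_le1 s t01.
rewrite -[leRHS]mulr1; apply: ler_pM => //; last first.
  by have [->|s0] := eqVneq s 0; rewrite ?sgr0 ?normr0 ?ler01// normr_sg s0.
rewrite ger0_norm; last first.
  by rewrite mulr_ge0 ?powR_ge0// mulr_ge0 ?(ltW w0)//; lra.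
rewrite ler_wpM2r ?powR_ge0// -[leRHS]mulr1; apply: ler_pM => //; [lra|exact: ltW].
Qed.

Lemma phi_sqr_le tau (p s : R) : 0 < tau < 1 -> 1 < p <= 2 ->
  phi tau p s ^+ 2 <= 4 * `|s| `^ (2 * (p - 1)).
Proof.
move=> t01 p12; rewrite -real_normK ?num_real//.
have -> : 4 * `|s| `^ (2 * (p - 1)) = (2 * `|s| `^ (p - 1)) ^+ 2.
  by rewrite [2 * (p - 1)]mulrC powRrM powR_mulrn ?powR_ge0//; ring.
by rewrite ler_sqr ?nnegrE ?mulr_ge0 ?powR_ge0// norm_phi_le.
Qed.

End moments.

Section quantile_moments.
Context d (T : measurableType d) (R : realType) (P : probability T R).
Variables (e : {RV P >-> R}) (p tau b : R).
Hypotheses (p12 : 1 < p <= 2) (tau01 : 0 < tau < 1).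
Let p1 : 1 < p. Proof. by case/andP: p12. Qed.
Let p2 : p <= 2. Proof. by case/andP: p12. Qed.

Let me (c : R) : measurable_fun setT (fun w => e w - c).
Proof. exact: measurable_funB. Qed.

Let mset : measurable [set w | e w = b].
Proof. exact: (@measurable_funPTI _ _ _ _ e [set b]). Qed.

Section score_moments.
Hypothesis e_moment : ('E_P[fun w => (`|e w| `^ (2 * (p - 1)))%R] < +oo)%E.

Let ie : integ P (fun w => `|e w| `^ (2 * (p - 1))).
Proof.
apply/integrableP; split.
  by apply/measurable_EFinP; apply: (measurableT_comp (measurable_norm_powR _)).
move: e_moment; rewrite unlock; congr (_ < _)%E; apply: eq_integral => w _.
by rewrite gee0_abs// lee_fin powR_ge0.
Qed.

Lemma integ_phi_sqr c : integ P (fun w => phi tau p (e w - c) ^+ 2).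
Proof.
have q02 : 0 <= 2 * (p - 1) <= 2 by have /andP[? ?] := p12; apply/andP; split; lra.
have mphi := measurableT_comp (measurable_phi tau p) (me c).
apply: (@integ_le _ _ _ _ _ (fun w => 16 * `|e w| `^ (2 * (p - 1)) + 16 * `|c| `^ (2 * (p - 1)))).
- exact: measurable_funX.
- move=> w; rewrite ger0_norm ?sqr_ge0//; apply: (le_trans (phi_sqr_le _ tau01 p12)).
  by have := powR_normB (e w) c q02; lra.
- by apply: integD; [exact: integZ|exact: integ_cst].
Qed.

Lemma integ_phi c : integ P (fun w => phi tau p (e w - c)).
Proof.
apply: (@integ_le _ _ _ _ _ (fun w => 1 + phi tau p (e w - c) ^+ 2)).
- exact: (measurableT_comp (measurable_phi tau p) (me c)).
- by move=> w; rewrite (le_trans (norm_le_amgm _ ltr01))// invr1 mul1r.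
- by apply: integD; [exact: integ_cst|exact: integ_phi_sqr].
Qed.

(** Convexity places the difference between -c phi(e) and -c phi(e - c), which are integrable even
    where eta(e) is not. *)
Lemma integ_eta_diff c : integ P (fun w => eta tau p (e w - c) - eta tau p (e w)).
Proof.
have i0 : integ P (fun w => phi tau p (e w)).
  by have := integ_phi 0; under eq_fun do rewrite subr0.
apply: (@integ_le _ _ _ _ _ (fun w => `|c| * (`|phi tau p (e w)| + `|phi tau p (e w - c)|))).
- apply: measurable_funB; apply: (measurableT_comp (measurable_eta tau p)) => //.
- move=> w; have := eta_ge_tangent (e w) (e w - c) tau01 p1.
  have := eta_ge_tangent (e w - c) (e w) tau01 p1.
  have -> : e w - c - e w = - c by ring.
  have -> : e w - (e w - c) = c by ring.
  have h1 : `|phi tau p (e w) * c| <= `|c| * `|phi tau p (e w)| by rewrite normrM mulrC.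
  have h2 : `|phi tau p (e w - c) * c| <= `|c| * `|phi tau p (e w - c)| by rewrite normrM mulrC.
  move: h1 h2; rewrite mulrDr mulrN !ler_norml => /andP[? ?] /andP[? ?] ? ?.
  have := normr_ge0 c; have := normr_ge0 (phi tau p (e w)).
  have := normr_ge0 (phi tau p (e w - c)) => ? ? ?.
  have m1 : 0 <= `|c| * `|phi tau p (e w)| by exact: mulr_ge0.
  have m2 : 0 <= `|c| * `|phi tau p (e w - c)| by exact: mulr_ge0.
  by apply/andP; split; lra.
- by apply: integZ; apply: integD; apply: integ_norm => //; exact: integ_phi.
Qed.

End score_moments.

Section negative_moment.
Hypothesis e_negmoment : (\int[P]_w abs_pow (e w - b)%R (p - 2)%R < +oo)%E.

Let mabs_pow : measurable_fun setT (fun w => abs_pow (e w - b) (p - 2)).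
Proof.
apply: measurable_fun_ifT.
- apply: (@measurable_and _ _ setT (fun w => e w - b == 0) (fun=> p - 2 < 0)) => //.
  exact: measurable_fun_eqr.
- exact: measurable_cst.
- by apply/measurable_EFinP; exact: (measurableT_comp (measurable_norm_powR _) (me b)).
Qed.

Let abs_pow_ge (s q : R) : ((`|s| `^ q)%:E <= abs_pow s q)%E.
Proof. by rewrite /abs_pow; case: ifP => // _; rewrite leey. Qed.

Let abs_pow_ge0 (s q : R) : (0 <= abs_pow s q)%E.
Proof. by apply: le_trans (abs_pow_ge s q); rewrite lee_fin powR_ge0. Qed.

Lemma integ_pow : integ P (fun w => `|e w - b| `^ (p - 2)).
Proof.
apply/integrableP; split.
  by apply/measurable_EFinP; exact: (measurableT_comp (measurable_norm_powR _) (me b)).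
apply: le_lt_trans e_negmoment; apply: ge0_le_integral => //.
  apply: measurableT_comp => //; apply/measurable_EFinP.
  exact: (measurableT_comp (measurable_norm_powR _) (me b)).
by move=> w _; rewrite /= ger0_norm ?powR_ge0.
Qed.

(** For p < 2, [abs_pow] is infinite on this event, so a finite integral makes it null. *)
Lemma atomless : p < 2 -> P [set w | e w = b] = 0%E.
Proof.
move=> p2'; have ip : P.-integrable setT (fun w => abs_pow (e w - b) (p - 2)).
  apply/integrableP; split => //; apply: le_lt_trans e_negmoment.
  by apply: ge0_le_integral => //; [exact: measurableT_comp|move=> w _; rewrite gee0_abs].
have [A [mA A0 hA]] := integrable_ae measurableT ip.
apply: (@subset_measure0 _ _ _ P [set w | e w = b] A) => // w /= ew.
apply: hA => /= /(_ Logic.I); rewrite /abs_pow ew subrr eqxx /= subr_lt0 p2'.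
by [].
Qed.

Let nonatom : {ae P, forall w, p = 2 \/ e w - b != 0}.
Proof.
have [p2'|p2'] := ltP p 2; last first.
  by apply: aeW => w; left; apply/eqP; rewrite eq_le p2 p2'.
exists [set w | e w = b]; split.
- exact: mset.
- exact: atomless.
move=> w /= hw; apply: contrapT => ew; apply: hw; right.
by rewrite subr_eq0; apply/eqP.
Qed.

Let psiE s : p = 2 \/ s != 0 -> psi tau p s = (psiR tau p s)%:E.
Proof.
move=> h; rewrite /psi /psiR /abs_pow ifF ?EFinM//.
by case: h => [->|/negbTE->//]; rewrite subrr ltxx andbF.
Qed.

Let psiR_gt0 s : p = 2 \/ s != 0 -> 0 < psiR tau p s.
Proof.
move=> h; rewrite /psiR mulr_gt0//.
  by rewrite mulr_gt0 ?weight_gt0// mulr_gt0 ?subr_gt0// (lt_trans _ p1).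
case: h => [->|s0]; first by rewrite subrr powRr0.
by rewrite powR_gt0// normr_gt0.
Qed.

Let mpsiR : measurable_fun setT (fun w => psiR tau p (e w - b)).
Proof. exact: (measurableT_comp (measurable_psiR _ _) (me b)). Qed.

Let ipsiR : integ P (fun w => psiR tau p (e w - b)).
Proof. exact: (integ_psiR (me b) tau01 p1 integ_pow). Qed.

(** [psiR] is positive off a null set. This makes the limiting Hessian positive definite and the
    denominator of the covariance nonzero. *)
Lemma Ex_psiR_gt0 : 0 < Ex P (fun w => psiR tau p (e w - b)).
Proof.
rewrite lt_neqAle Ex_ge0 ?andbT; last by move=> w; exact: psiR_ge0.
rewrite eq_sym; apply/negP => /eqP E0.
have m := mpsiR; move/measurable_EFinP in m.
have : (\int[P]_w `|(psiR tau p (e w - b))%:E|)%E = 0%E.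
  under eq_integral do rewrite /= ger0_norm ?psiR_ge0//.
  by rewrite -EFin_Ex ?E0//; exact: ipsiR.
move/(ae_eq_integral_abs P measurableT m) => ae0.
have : {ae P, forall w, False}.
  apply: filterS2 nonatom ae0 => w h /(_ Logic.I) /= [] h0.
  by have := psiR_gt0 h; rewrite h0 ltxx.
move=> [A [mA A0 hA]].
have : (P setT <= P A)%E by apply: le_measure; rewrite ?inE// => w _; exact: hA.
by rewrite probability_setT A0 lee_fin ler10.
Qed.

Lemma fine_integral_psi :
  fine (\int[P]_w psi tau p (e w - b)%R)%E = Ex P (fun w => psiR tau p (e w - b)).
Proof.
have -> : (\int[P]_w psi tau p (e w - b)%R = \int[P]_w (psiR tau p (e w - b))%:E)%E.
  apply: ae_eq_integral => //.
  - apply: emeasurable_funM => //.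
    apply/measurable_EFinP; apply: measurable_funM => //.
    exact: (measurableT_comp (measurable_weight _) (me b)).
  - exact/measurable_EFinP.
  - by apply: filterS nonatom => w h _; exact: psiE.
by rewrite -EFin_Ex//; exact: ipsiR.
Qed.

Section first_order_condition.
Hypothesis e_moment : ('E_P[fun w => (`|e w| `^ (2 * (p - 1)))%R] < +oo)%E.
Hypothesis e_atom : (p = 2 /\ tau = 2^-1) \/ P [set w | e w = b] = 0%E.
Hypothesis e_quantile : Lp_quantile p tau e b.

(** Minimality gives h E0 <= E r_h for every h, and the second-order bound gives E r_h <= C h^2; a
    linear function below a quadratic one for all h has slope 0. *)
Lemma Ex_phi_quantile : Ex P (fun w => phi tau p (e w - b)) = 0.
Proof.
set E0 := Ex P _; have iphi := integ_phi e_moment b.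
pose r h w := taylor_rem tau p (e w - b) h.
have rE h w : r h w = (eta tau p (e w - (b + h)) - eta tau p (e w)) -
    (eta tau p (e w - b) - eta tau p (e w)) + h * phi tau p (e w - b).
  by rewrite /r /taylor_rem opprD addrA; ring.
have id h := integB (integ_eta_diff e_moment (b + h)) (integ_eta_diff e_moment b).
have ir h : integ P (r h).
  by rewrite (funext (rE h)); apply: integD => //; exact: integZ.
have lower h : h * E0 <= Ex P (r h).
  rewrite (funext (rE h)) ExD//; last exact: integZ.
  rewrite ExZ// lerDr ExB; try exact: integ_eta_diff.
  rewrite subr_ge0 -lee_fin !EFin_Ex; try exact: integ_eta_diff.
  by have := e_quantile (b + h); rewrite unlock.
pose g w := 2^-1 * psiR tau p (e w - b) + 40 * `|e w - b| `^ (p - 2).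
have ig : integ P g by apply: integD; apply: integZ; [exact: ipsiR|exact: integ_pow].
have g0 w : 0 <= g w by rewrite /g addr_ge0// mulr_ge0 ?powR_ge0 ?psiR_ge0.
have upper h : Ex P (r h) <= h ^+ 2 * Ex P g.
  rewrite -ExZ//; apply: Ex_le_ae => //; first exact: integZ.
  - by move=> w; exact: taylor_rem_ge0.
  - by move=> w; apply: mulr_ge0 => //; exact: sqr_ge0.
  have : {ae P, forall w, e w - b != 0 \/ (p = 2 /\ tau = 2^-1)}.
    case: e_atom => [h2|P0]; first by apply: aeW => w; right.
    exists [set w | e w = b]; split => //.
    move=> w /= hw; apply: contrapT => ew; apply: hw; left.
    by rewrite subr_eq0; apply/eqP.
  apply: filterS => w hw; have := taylor_rem_bound h tau01 p12 hw.
  have : 40 * h ^+ 2 * rho p (e w - b) `|h| <= 40 * h ^+ 2 * `|e w - b| `^ (p - 2).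
    rewrite ler_wpM2l//; first by apply: mulr_ge0 => //; exact: sqr_ge0.
    by rewrite /rho ler_piMr ?powR_ge0// ge_min lexx.
  rewrite -/(r h w) /g => h1; rewrite ler_norml => /andP[_ h2].
  by move: h1 h2; move: (psiR _ _ _) (_ `^ _) (r h w) (rho _ _ _) => a1 a2 a3 a4; lra.
set C := Ex P g in upper; have C0 : 0 <= C by exact: Ex_ge0.
(* At h = E0 / (C + 1) the two bounds read (C + 1) h^2 <= C h^2, so h = 0. *)
have := le_trans (lower (E0 / (C + 1))) (upper _).
have C1 : 0 < C + 1 by rewrite ltr_wpDl.
have -> : E0 / (C + 1) * E0 = (C + 1) * (E0 / (C + 1)) ^+ 2 by field; rewrite gt_eqF.
rewrite mulrC -subr_le0 -mulrBr [_ - C]addrAC subrr add0r mulr1.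
move=> h; have : (E0 / (C + 1)) ^+ 2 = 0 by apply/eqP; rewrite eq_le h sqr_ge0.
by move/eqP; rewrite sqrf_eq0 mulf_eq0 invr_eq0 (gt_eqF C1) orbF => /eqP.
Qed.

End first_order_condition.
End negative_moment.
End quantile_moments.

(** * The composite design *)

Section composite_design.
Context {R : realType}.

Lemma cvg_sum_seq I (r : seq I) (f : I -> nat -> R) (l : I -> R) :
  (forall i, f i n @[n --> \oo] --> l i) ->
  \sum_(i <- r) f i n @[n --> \oo] --> \sum_(i <- r) l i.
Proof.
move=> fl; elim: r => [|i r IH].
  by under eq_fun do rewrite big_nil; rewrite big_nil; exact: cvg_cst.
by under eq_fun do rewrite big_cons; rewrite big_cons; exact: cvgD.
Qed.

Lemma cvg_entry m n (A : nat -> 'M[R]_(m, n)) (B : 'M[R]_(m, n)) i j :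
  A N @[N --> \oo] --> B -> A N i j @[N --> \oo] --> B i j.
Proof. by move=> AB; exact: (cvg_comp A (fun M => M i j) AB (@coord_continuous R m n i j B)). Qed.

Lemma posdef_block m n (d : 'rV[R]_m) (c : R) (C : 'M[R]_n) :
  (forall k, 0 < d 0 k) -> 0 < c -> posdefmx C ->
  posdefmx (block_mx (diag_mx d) 0 0 (c *: C)).
Proof.
move=> d0 c0 [sC pC]; split.
  by rewrite tr_block_mx tr_diag_mx !trmx0 linearZ /= sC.
move=> v; rewrite -[v]vsubmxK; move: (usubmx v) (dsubmx v) => a g {v} v0.
rewrite mul_block_col !mul0mx addr0 add0r dotv_col_mx -scalemxAl dotvZr.
have da : dotv a (diag_mx d *m a) = \sum_k d 0 k * a k 0 ^+ 2.
  by rewrite dotvE; apply: eq_bigr => k _; rewrite mul_diag_mx mxE; ring.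
have t0 k : 0 <= d 0 k * a k 0 ^+ 2 by rewrite mulr_ge0 ?sqr_ge0// ltW.
have da0 : 0 <= dotv a (diag_mx d *m a) by rewrite da sumr_ge0.
have [g0|g0] := eqVneq g 0; last by rewrite ltr_wpDl// mulr_gt0// pC.
rewrite g0 mulmx0 /dotv mulmx0 [X in _ + _ * X]mxE mulr0 addr0 -/(dotv _ _) da.
have [k ak] : exists k, a k 0 != 0.
  apply: contrapT => h; case/negP: v0; apply/eqP; rewrite g0.
  have -> : a = 0.
    apply/matrixP => k j; rewrite ord1 mxE; apply/eqP; apply: contrapT => /negP ak.
    by apply: h; exists k.
  exact: col_mx0.
rewrite (bigD1 k)//= ltr_pwDl ?sumr_ge0//.
by rewrite mulr_gt0// lt0r sqr_ge0 andbT sqrf_eq0.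
Qed.

Lemma dsubmx_invmx_block m n (A : 'M[R]_m) (B : 'M[R]_n) (v : 'cV[R]_(m + n)) :
  block_mx A 0 0 B \in unitmx -> B \in unitmx ->
  dsubmx (invmx (block_mx A 0 0 B) *m v) = invmx B *m dsubmx v.
Proof.
move=> uH uB; set w := invmx _ *m v.
have -> : v = block_mx A 0 0 B *m w by rewrite mulmxA mulmxV// mul1mx.
rewrite -[w in RHS]vsubmxK mul_block_col !mul0mx add0r addr0 col_mxKd.
by rewrite mulmxA mulVmx// mul1mx.
Qed.

Context {m K : nat}.
Variable x : nat -> 'cV[R]_m.

(** The parameter stacks the K intercepts over beta; the unit vector selects the intercept of the
    k-th loss. *)
Definition clp_regressor (k : 'I_K) (t : nat) : 'cV[R]_(K + m) :=
  col_mx (delta_mx k 0) (x t).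

(** The off-diagonal blocks are averages of the predictors, which vanish by centering. *)
Lemma clp_gram_cvg (C : 'M[R]_m) k i j : centered x ->
  (N%:R^-1 *: ((design x N)^T *m design x N)) @[N --> \oo] --> C ->
  N%:R^-1 * \sum_(t < N) (clp_regressor k t i 0 * clp_regressor k t j 0)
    @[N --> \oo] --> block_mx (delta_mx k k) 0 0 C i j.
Proof.
move=> hx hXC.
have cx a l : N%:R^-1 * \sum_(t < N) a * x t l 0 @[N --> \oo] --> (0 : R).
  have h : (N%:R^-1 *: \sum_(t < N) x t) l 0 @[N --> \oo] --> (0 : R).
    have := @cvg_entry _ _ (fun N => N%:R^-1 *: \sum_(t < N) x t) 0 l 0 hx.
    by rewrite [X in _ --> X]mxE.
  have : a * (N%:R^-1 *: \sum_(t < N) x t) l 0 @[N --> \oo] --> a * 0 by apply: cvgMr; exact: h.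
  rewrite mulr0; apply: cvg_trans; apply: near_eq_cvg.
  by apply: nearW => N; rewrite /= mxE summxE -mulr_sumr; ring.
case: (split_ordP i) => i' ->; case: (split_ordP j) => j' ->;
  rewrite /clp_regressor ?(block_mxEul, block_mxEur, block_mxEdl, block_mxEdr).
(* This block is constant from N = 1 on; at N = 0 the average is 0 by convention. *)
- apply: cvg_near_cst; exists 1%N => // N /= N0.
  under eq_bigr do rewrite !col_mxEu !mxE eqxx !andbT.
  rewrite mxE sumr_const card_ord -[X in _ * X = _]mulr_natl mulKf.
    by rewrite -natrM mulnb.
  by rewrite pnatr_eq0 -lt0n.
- rewrite mxE; under eq_fun do under eq_bigr do rewrite col_mxEu col_mxEd.
  exact: cx.
- rewrite mxE; under eq_fun do under eq_bigr do rewrite col_mxEu col_mxEd mulrC.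
  exact: cx.
under eq_fun do under eq_bigr do rewrite !col_mxEd.
have := @cvg_entry _ _ _ _ i' j' hXC; apply: cvg_trans; apply: near_eq_cvg.
apply: nearW => N; rewrite /= !mxE; congr (_ * _); apply: eq_bigr => t _.
by rewrite !mxE.
Qed.

Lemma sum_clp_gram (psibar : 'I_K -> R) (C : 'M[R]_m) :
  \sum_k psibar k *: block_mx (delta_mx k k) 0 0 C =
  block_mx (diag_mx (\row_k psibar k)) 0 0 ((\sum_k psibar k) *: C).
Proof.
have -> : \sum_k psibar k *: block_mx (delta_mx k k) 0 0 C =
    block_mx (\sum_k psibar k *: delta_mx k k) 0 0 ((\sum_k psibar k) *: C).
  rewrite scaler_suml; elim/big_ind3: _ => //.
  - by rewrite block_mx0.
  - by move=> A1 B1 C1 A2 B2 C2 -> ->; rewrite add_block_mx !addr0.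
  - by move=> k _; rewrite scale_block_mx !scaler0.
congr (block_mx _ _ _ _); apply/matrixP => i j; rewrite summxE !mxE (bigD1 i)//= big1.
  by rewrite !mxE eqxx addr0 /= eq_sym; case: eqP => _; rewrite ?mulr1 ?mulr0.
by move=> k ki; rewrite !mxE eq_sym (negbTE ki) mulr0.
Qed.

Variables (p : R) (tau : 'I_K -> R).

Lemma loss_diff_clp N (e : nat -> R) (y : nat -> R) (b0 : 'I_K -> R) (beta0 : 'cV[R]_m)
    (b : 'I_K -> R) (beta : 'cV[R]_m) :
  (forall t, y t = dotv (x t) beta0 + e t) ->
  loss_diff p tau N (fun k t => e t - b0 k)
    (fun k t => (Num.sqrt N%:R)^-1 *: clp_regressor k t)
    (Num.sqrt N%:R *: col_mx (\col_k (b k - b0 k)) (beta - beta0)) =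
  clp_loss N p tau x y b beta - clp_loss N p tau x y b0 beta0.
Proof.
move=> hy; rewrite /loss_diff /clp_loss -sumrB; apply: eq_bigr => k _.
rewrite -sumrB; apply: eq_bigr => t _.
have N0 : Num.sqrt N%:R != 0 :> R.
  by rewrite gt_eqF// sqrtr_gt0 ltr0n (leq_ltn_trans _ (ltn_ord t)).
rewrite dotvZl dotvZr mulKf// dotv_col_mx dotvDr dotvNr hy.
have -> : dotv (delta_mx k 0) (\col_k (b k - b0 k)) = b k - b0 k.
  by rewrite -[delta_mx k 0]scale1r dotv_delta mul1r mxE.
by congr (eta _ _ _ - eta _ _ _); ring.
Qed.

End composite_design.

Section asymptotic_linear_form.
Context d (T : measurableType d) (R : realType) (P : probability T R) {m K : nat}.
Variables (p : R) (tau bstar : 'I_K -> R) (x : nat -> 'cV[R]_m) (C : 'M[R]_m).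
Hypotheses (hC : posdefmx C)
  (hXC : (N%:R^-1 *: ((design x N)^T *m design x N)) @[N --> \oo] --> C).

Definition composite_score (s : R) : R := \sum_k phi (tau k) p (s - bstar k).

(** Limit of the sum of squared weights in the central limit theorem: the average is the form of the
    Gram matrix at g = C^-1 a, up to c^-2, and g' C g = a' C^-1 a. *)
Lemma quadratic_mean_cvg (a : 'cV[R]_m) (c : R) :
  N%:R^-1 * \sum_(t < N) (dotv a (invmx C *m x t) / c) ^+ 2 @[N --> \oo] -->
  (c^-1 ^+ 2 * dotv a (invmx C *m a)).
Proof.
set g := invmx C *m a; have [sC _] := hC.
have gE t : dotv a (invmx C *m x t) = dotv g (x t).
  by rewrite /g dotv_mull trmx_inv sC.
have -> : dotv a g = dotv g (C *m g).
  by rewrite /g mulmxA mulmxV ?posdef_unitmx// mul1mx dotvC.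
have qE (A : 'M[R]_m) (h : 'cV[R]_m) :
    dotv h (A *m h) = \sum_i \sum_j h i 0 * h j 0 * A i j.
  rewrite dotvE; apply: eq_bigr => i _; rewrite mxE mulr_sumr.
  by apply: eq_bigr => j _; ring.
have -> : (fun N => N%:R^-1 * \sum_(t < N) (dotv a (invmx C *m x t) / c) ^+ 2) =
    (fun N => c^-1 ^+ 2 * \sum_i \sum_j g i 0 * g j 0 *
       (N%:R^-1 *: ((design x N)^T *m design x N)) i j).
  apply/funext => N; rewrite -qE -scalemxAl dotvZr mulrCA; congr (_ * _).
  rewrite -mulmxA -dotv_mull dotvE mulr_sumr.
  apply: eq_bigr => t _; rewrite gE exprMn mulrC; congr (_ * _).
  have -> : (design x N *m g) t 0 = dotv g (x t).
    by rewrite mxE dotvE; apply: eq_bigr => i _; rewrite mxE mulrC.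
  by rewrite expr2.
rewrite qE; apply: cvgMr; apply: cvg_sum_seq => i; apply: cvg_sum_seq => j.
apply: cvgMr; exact: cvg_entry hXC.
Qed.

(** All K losses share the predictor x_t, so the scores at time t merge into a single one, i.i.d.
    over t. *)
Lemma dsubmx_score N (c : R) (s : 'I_K -> nat -> R) :
  dsubmx (score p tau N s (fun k t => c *: clp_regressor x k t)) =
  \sum_(t < N) (\sum_k phi (tau k) p (s k t)) *: (c *: x t).
Proof.
rewrite /score exchange_big /= linear_sum; apply: eq_bigr => t _.
rewrite linear_sum scaler_suml; apply: eq_bigr => k _.
by rewrite /clp_regressor !scale_col_mx; exact: col_mxKd.
Qed.

End asymptotic_linear_form.

(** * Asymptotic normality *)

Theorem theorem2p1 (R : realType) (d : measure_display)
  (Omega : measurableType d) (P : probability Omega R)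
  (p : R) (hp : 1 < p <= 2)
  (K : nat) (hK : (1 <= K)%N)
  (tau : 'I_K -> R)
  (htau01 : forall k : 'I_K, 0 < tau k < 1)
  (htau_lt : forall k l : 'I_K, (k < l)%N -> tau k < tau l)
  (m : nat) (betastar : 'cV[R]_m) (x : nat -> 'cV[R]_m)
  (hx : centered x)
  (e : {RV P >-> R}) (eps : nat -> {RV P >-> R})
  (heps_id : identically_distributed eps e)
  (heps_indep : mutually_independent eps)
  (y : nat -> Omega -> R)
  (hy : forall (t : nat) (w : Omega), y t w = dotv (x t) betastar + eps t w)
  (bstar : 'I_K -> R)
  (hbstar : forall k : 'I_K, Lp_quantile p (tau k) e (bstar k))
  (* (i) *)
  (C : 'M[R]_m) (hC : posdefmx C)
  (hXC : (T%:R^-1 *: ((design x T)^T *m design x T)) @[T --> \oo] --> C)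
  (* (ii) *)
  (hmoment : ('E_P[fun w => (`|e w| `^ (2 * (p - 1)))%R] < +oo)%E)
  (* (iii) *)
  (hnegmoment : exists2 delta : R, 0 < delta &
     forall (k : 'I_K) (b : R), `|b - bstar k| < delta ->
       (\int[P]_w abs_pow (e w - b)%R (p - 2)%R < +oo)%E)
  (* implied by (iii) if p < 2; if p = 2 and tau k <> 1/2, then
     eta (tau k) p is not twice differentiable at 0 *)
  (hatom : p = 2 -> forall k : 'I_K, tau k != 2^-1 ->
     P [set w | e w = bstar k] = 0%E)
  (bhat : nat -> Omega -> 'I_K -> R) (betahat : nat -> Omega -> 'cV[R]_m)
  (hbetahat_meas : forall T : nat, random_vector (betahat T))
  (hargmin : forall (T : nat) (w : Omega),
     clp_argmin T p tau x (fun t => y t w) (bhat T w) (betahat T w)) :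
  cvg_to_normal P
    (fun T w => Num.sqrt (T%:R : R) *: (betahat T w - betastar))
    0 (Sigma_clp p tau bstar e C).
Proof.
have hneg k : (\int[P]_w abs_pow (e w - bstar k)%R (p - 2)%R < +oo)%E.
  by have [del d0 h] := hnegmoment; apply: (h k (bstar k)); rewrite subrr normr0.
pose psibar k := Ex P (fun w => psiR (tau k) p (e w - bstar k)).
have psi0 k : 0 < psibar k := Ex_psiR_gt0 hp (htau01 k) (hneg k).
(* Below p = 2 an atom would make the negative moment infinite; at p = 2 and tau = 1/2 the loss is
   quadratic and its expansion exact. *)
have atom k : (p = 2 /\ tau k = 2^-1) \/ P [set w | e w = bstar k] = 0%E.
  have [p2|p2] := ltP p 2; first by right; exact: atomless (hneg k) p2.
  have {}p2 : p = 2 by apply/eqP; rewrite eq_le p2 andbT; case/andP: hp.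
  have [t2|t2] := eqVneq (tau k) 2^-1; first by left.
  by right; exact: hatom.
have Ephi k := Ex_phi_quantile hp (htau01 k) (hneg k) hmoment (atom k) (hbstar k).
have iphi k := integ_phi hp (htau01 k) hmoment (bstar k).
have iphi2 k := integ_phi_sqr hp (htau01 k) hmoment (bstar k).
have ipow k := integ_pow (hneg k).
have zG k i j := @clp_gram_cvg R m K x C k i j hx hXC.
pose ps := \sum_k psibar k.
have ps0 : 0 < ps.
  rewrite /ps (bigD1 (Ordinal hK))//= ltr_pwDl// sumr_ge0// => k _; exact: ltW.
have H_pd : posdefmx (\sum_k psibar k *: block_mx (delta_mx k k) 0 0 C).
  by rewrite sum_clp_gram; apply: posdef_block => // k; rewrite mxE.
pose u N k t : 'cV[R]_(K + m) := (Num.sqrt N%:R)^-1 *: clp_regressor x k t.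
pose s w (k : 'I_K) t := eps t w - bstar k.
pose that N w : 'cV[R]_(K + m) :=
  Num.sqrt N%:R *: col_mx (\col_k (bhat N w k - bstar k)) (betahat N w - betastar).
have that_min N w th :
    loss_diff p tau N (s w) (u N) (that N w) <= loss_diff p tau N (s w) (u N) th.
  (* The empty sample is settled apart, because the scaling by sqrt 0 cannot be inverted. *)
  case: N => [|N].
    by rewrite /loss_diff !big1// => k _; rewrite big_ord0.
  have N0 : Num.sqrt N.+1%:R != 0 :> R by rewrite gt_eqF// sqrtr_gt0.
  pose b' k := bstar k + (Num.sqrt N.+1%:R)^-1 * usubmx th k 0.
  pose beta' := betastar + (Num.sqrt N.+1%:R)^-1 *: dsubmx th.
  have -> : th = Num.sqrt N.+1%:R *: col_mx (\col_k (b' k - bstar k)) (beta' - betastar).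
    rewrite -[LHS]vsubmxK scale_col_mx; congr col_mx.
      apply/matrixP => i j; rewrite ord1 [RHS]mxE [X in _ * X]mxE /b' addrAC subrr add0r.
      by rewrite mulVKf.
    by rewrite /beta' addrAC subrr add0r scalerA divff// scale1r.
  have lossE b1 (beta1 : 'cV[R]_m) : loss_diff p tau N.+1 (s w) (u N.+1)
      (Num.sqrt N.+1%:R *: col_mx (\col_k (b1 k - bstar k)) (beta1 - betastar)) =
      clp_loss N.+1 p tau x (fun t => y t w) b1 beta1 -
      clp_loss N.+1 p tau x (fun t => y t w) bstar betastar.
    by apply: loss_diff_clp => t; exact: hy.
  by rewrite /that !lossE lerD2r; exact: hargmin.
have key := argmin_expansion heps_indep heps_id hp htau01 iphi iphi2 Ephi ipow atom zG H_pd
  that_min.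
pose H : 'M[R]_(K + m) := \sum_k psibar k *: block_mx (delta_mx k k) 0 0 C.
pose W N w := score p tau N (s w) (u N).
pose zeta N w : 'cV[R]_m := dsubmx (invmx H) *m W N w.
pose xi := composite_score p tau bstar.
pose c a N t := dotv a (invmx C *m x t) / ps / Num.sqrt N%:R.
have uC := posdef_unitmx hC.
have zetaE a N w : dotv a (zeta N w) = \sum_(t < N) c a N t * xi (eps t w).
  (* Block diagonality removes the intercept part of the score: what remains is C^-1 / ps applied to
     the weighted sum of the x_t. *)
  rewrite /zeta mul_dsub_mx /H sum_clp_gram dsubmx_invmx_block; last 2 first.
  - by rewrite -sum_clp_gram; exact: posdef_unitmx.
  - by rewrite unitmxZ// unitfE gt_eqF.
  have -> : dsubmx (W N w) = \sum_(t < N) xi (eps t w) *: ((Num.sqrt N%:R)^-1 *: x t).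
    exact: dsubmx_score.
  rewrite invmxZ; last by rewrite unitmxZ// unitfE gt_eqF.
  rewrite -/ps -scalemxAl dotvZr mulmx_sumr.
  rewrite /dotv mulmx_sumr summxE mulr_sumr; apply: eq_bigr => t _.
  rewrite -!scalemxAr mxE [X in _ * (_ * X)]mxE -/(dotv a _) /c.
  by move: (xi _) (dotv a _) => a1 a2; ring.
have mxi : measurable_fun setT xi.
  apply: measurable_sum => k; apply: (measurableT_comp (measurable_phi _ _)).
  exact: measurable_funB.
have iphiM k k' : integ P (fun w => phi (tau k') p (e w - bstar k') * phi (tau k) p (e w - bstar k)).
  have mphi l : measurable_fun setT (fun w => phi (tau l) p (e w - bstar l)).
    exact: integ_measurable (iphi l).
  apply: (@integ_le _ _ _ _ _ (fun w => phi (tau k') p (e w - bstar k') ^+ 2 +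
      phi (tau k) p (e w - bstar k) ^+ 2)).
  - exact: measurable_funM.
  - move=> w; move: (phi _ _ _) (phi _ _ _) => a1 a2; rewrite ler_norml.
    have := sqr_ge0 (a1 + a2); have := sqr_ge0 (a1 - a2) => h1 h2.
    have := sqr_ge0 a1; have := sqr_ge0 a2 => h3 h4.
    by apply/andP; split; nra.
  - exact: integD.
have xi2E w : xi (e w) ^+ 2 = \sum_k' \sum_k
    phi (tau k') p (e w - bstar k') * phi (tau k) p (e w - bstar k).
  by rewrite /xi /composite_score expr2 mulr_suml; apply: eq_bigr => k' _; rewrite mulr_sumr.
have ixi2 : integ P (fun w => xi (e w) ^+ 2).
  by rewrite (funext xi2E); do 2![apply: integ_sum => ?].
have Exi0 : Ex P (fun w => xi (e w)) = 0.
  by rewrite Ex_sum//; apply: big1 => k _; exact: Ephi.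
set s2 := Ex P (fun w => xi (e w) ^+ 2) in ixi2 *.
have s20 : 0 <= s2 by apply: Ex_ge0 => w; exact: sqr_ge0.
have SigmaE : Sigma_clp p tau bstar e C = (s2 / ps ^+ 2) *: invmx C.
  rewrite /Sigma_clp; congr (_ / _ ^+ 2 *: _); last first.
    by apply: eq_bigr => k _; exact: fine_integral_psi (hneg k).
  rewrite /s2 (funext xi2E) Ex_sum; last by move=> k'; exact: integ_sum.
  apply: eq_bigr => k' _; rewrite Ex_sum//; apply: eq_bigr => k _.
  by rewrite unlock -EFin_Ex.
(* A square root of C^-1 gives one of Sigma, the form in which [exists_normal_vector] takes a
   covariance. *)
have [L hL] := cholesky (posdef_invmx hC).
pose sg := Num.sqrt s2 / ps.
have SigmaB : Sigma_clp p tau bstar e C = (sg *: L) *m (sg *: L)^T.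
  rewrite SigmaE linearZ /= -scalemxAl -scalemxAr scalerA -hL; congr (_ *: _).
  by rewrite /sg mulrACA -expr2 sqr_sqrtr// -invfM.
have [d1 [Om1 [Q [N [mN lawN]]]]] := exists_normal_vector (sg *: L).
rewrite -SigmaB in lawN.
exists d1, Om1, Q, N; split; first by split.
pose v a := ps^-1 ^+ 2 * dotv a (invmx C *m a).
have [_ pdi] := posdef_invmx hC.
have v0 a : 0 <= dotv a (invmx C *m a).
  have [->|a0] := eqVneq a 0; last exact/ltW/pdi.
  by rewrite mulmx0 /dotv mulmx0 mxE.
have normal_trig a : Ex Q (fun w => cos (dotv a (N w))) = gauss_cos (Num.sqrt s2 * Num.sqrt (v a))
    /\ Ex Q (fun w => sin (dotv a (N w))) = 0.
  have ve : dotv a (Sigma_clp p tau bstar e C *m a) = s2 * v a.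
    rewrite SigmaE -scalemxAl dotvZr /v expr2 invfM; ring.
  rewrite -sqrtrM//; apply: gauss_cosE.
  - by rewrite mulr_ge0// mulr_ge0 ?sqr_ge0.
  - exact: measurable_dotv.
  have a0 : dotv a (0 : 'cV[R]_m) = 0 by rewrite /dotv mulmx0 mxE.
  by move=> B mB; have := lawN a B mB; rewrite ve a0 => <-.
have clt a := trig_clt heps_indep mxi heps_id ixi2 Exi0 (c := c a) (v := v a).
have {}clt a : Ex P (fun w => cos (dotv a (zeta n w))) @[n --> \oo] -->
      Ex Q (fun w => cos (dotv a (N w))) /\
    Ex P (fun w => sin (dotv a (zeta n w))) @[n --> \oo] -->
      Ex Q (fun w => sin (dotv a (N w))).
  have zv := @quadratic_mean_cvg R m x C hC hXC a ps.
  have [||h1 h2] := clt a.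
  - have := zv; apply: cvg_trans; apply: near_eq_cvg; apply: nearW => n /=.
    rewrite mulr_sumr; apply: eq_bigr => t _.
    by rewrite /c [RHS]expr_div_n sqr_sqrtr// mulrC.
  - by move=> delta; exact: (scaled_vanish zv).
  have [-> ->] := normal_trig a.
  split.
    by under eq_fun do under eq_fun do rewrite zetaE.
  by under eq_fun do under eq_fun do rewrite zetaE.
have iW n i := integ_score heps_id iphi (clp_regressor x) n i.
have mzeta n : random_vector (zeta n).
  move=> j; under eq_fun do rewrite mxE; apply: measurable_sum => i.
  apply: measurable_funM => //; exact: integ_measurable (iW n i).
have mZ n : random_vector (fun w => Num.sqrt n%:R *: (betahat n w - betastar)).
  move=> j; under eq_fun do rewrite !mxE; apply: measurable_funM => //.
  by apply: measurable_funB => //; exact: hbetahat_meas.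
apply: (cvg_in_distribution_trig mZ mzeta mN).
- by move=> a; exact: (clt a).1.
- by move=> a; exact: (clt a).2.
- have [B hB] := score_tight heps_indep heps_id iphi iphi2 Ephi zG.
  pose C0 := \sum_i \sum_j `|dsubmx (invmx H) i j|.
  exists (C0 * B); apply: filterS hB => n [i1 E1].
  have mn := measurable_nrm (mzeta n).
  have le w : nrm (zeta n w) <= C0 * nrm (W n w) by exact: nrm_mulmx.
  have iz : integ P (fun w => nrm (zeta n w)).
    apply: (integ_le mn _ (integZ C0 i1)) => w; rewrite ger0_norm ?nrm_ge0//.
  split => //; apply: (@le_trans _ _ (Ex P (fun w => C0 * nrm (W n w)))).
    by apply: Ex_le => //; exact: integZ.
  rewrite ExZ// ler_wpM2l//.
  by do 2![apply: sumr_ge0 => ? _].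
(* The majorant for the full parameter also serves the beta-block, since dropping the intercept
   coordinates can only lower [nrm]. *)
apply/cvgrPdist_le => e0 e00; apply: filterS (key e0 e00) => n [g [ig Eg] hg].
rewrite sub0r normrN ger0_norm; last first.
  by apply: Ex_ge0 => w; rewrite le_min ler01 nrm_ge0.
apply: le_trans Eg; apply: Ex_le => //.
  have md : random_vector (fun w => Num.sqrt n%:R *: (betahat n w - betastar) - zeta n w).
    move=> j; under eq_fun do rewrite mxE [X in _ + X]mxE.
    by apply: measurable_funB; [exact: mZ|exact: mzeta].
  apply: (@integ_bounded _ _ _ _ _ 1).
    by apply: measurable_minr => //; exact: measurable_nrm.
  by move=> w; rewrite ger0_norm ?ge_min ?lexx// le_min ler01 nrm_ge0.
move=> w; apply: le_trans (hg w); rewrite le_min ge_min lexx /= ge_min.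
apply/orP; right.
have -> : Num.sqrt n%:R *: (betahat n w - betastar) - zeta n w =
    dsubmx (that n w - invmx H *m W n w).
  have -> : Num.sqrt n%:R *: (betahat n w - betastar) = dsubmx (that n w).
    by rewrite /that scale_col_mx col_mxKd.
  by rewrite linearB /= /zeta mul_dsub_mx.
rewrite /nrm [leRHS]big_split_ord /= ler_wpDl ?sumr_ge0//.
by apply: ler_sum => j _; rewrite mxE.
Qed.
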